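(* Let $\alpha>-1$, $\beta_0\in(-1,0]$. For every $p,q\in\mathbb N$, consider the integral transform $D_{p,q}$ given by $$D_{p,q}f(z)=c_{p,q}\int_{\mathbb D}\frac{f(w)}{\overline w^pz^q}\ {}_2F_1\left(\left.\begin{array}{c}1,\ \alpha+\beta_0+2\\ \beta_0+1\end{array}\right|\overline wz\right)d\mu_{\alpha,\beta_0+p}(w).$$ Then $D_{p,q}$ is a well defined bounded operator on the Hilbert space $\mathcal A^2(\mathbb D,\mu_{\alpha,\beta_0+p})$ and maps it isometrically onto $\mathcal A^2(\mathbb D,\mu_{\alpha,\beta_0+q})$. Its inverse $D_{p,q}^{-1}=D_{q,p}:\mathcal A^2(\mathbb D,\mu_{\alpha,\beta_0+q})\to\mathcal A^2(\mathbb D,\mu_{\alpha,\beta_0+p})$ is given by $$D_{p,q}^{-1}f(w)=c_{p,q}\int_{\mathbb D}\frac{f(z)}{\overline z^qw^p}\ {}_2F_1\left(\left.\begin{array}{c}1,\ \alpha+\beta_0+2\\ \beta_0+1\end{array}\right|\overline zw\right)d\mu_{\alpha,\beta_0+q}(z).$$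
   Context: $\mathbb N=\{0,1,2,\dots\}$, $\mathbb D$ is the unit disk, $\mathbb D^*=\mathbb D\setminus\{0\}$, $dA(z)=\frac1\pi\,dx\,dy$, $\mathscr B$ is the beta function. For $\alpha,\beta>-1$, $\mu_{\alpha,\beta}$ is the probability measure on $\mathbb D$ given by $d\mu_{\alpha,\beta}(z)=\frac{|z|^{2\beta}(1-|z|^2)^\alpha}{\mathscr B(\alpha+1,\beta+1)}dA(z)$. $\mathcal A^2(\mathbb D,\mu_{\alpha,\beta})$ is the Hilbert space of holomorphic functions on $\mathbb D^*$ that are square integrable with respect to $\mu_{\alpha,\beta}$, with the $L^2(\mathbb D,\mu_{\alpha,\beta})$ inner product. (Output variables $z$, $w$ range over $\mathbb D^*$.) $(a)_n=a(a+1)\cdots(a+n-1)$ is the Pochhammer symbol, ${}_2F_1\left(\left.\begin{array}{c}a,b\\ c\end{array}\right|\xi\right)=\sum_{n=0}^{\infty}\frac{(a)_n(b)_n}{(c)_n}\frac{\xi^n}{n!}$, and $$c_{p,q}=\sqrt{\frac{(\beta_0+1)_p\,(\beta_0+1)_q}{(\alpha+\beta_0+2)_p\,(\alpha+\beta_0+2)_q}}.$$ *)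

(* Defs.v *)
From HB Require Import structures.
From mathcomp Require Import all_boot all_order all_algebra.
From mathcomp Require Import all_classical all_reals all_analysis.
From mathcomp Require Import measurable_realfun.
From mathcomp Require Import complex.

Set Implicit Arguments.
Unset Strict Implicit.
Unset Printing Implicit Defensive.

Import Order.TTheory GRing.Theory Num.Theory.
Import numFieldNormedType.Exports.

Local Open Scope classical_set_scope.
Local Open Scope complex_scope.
Local Open Scope ring_scope.

Section SpecialFunctions.
Context {R : realType}.

Definition pochhammer {K : pzRingType} (a : K) (n : nat) : K :=
  \prod_(i < n) (a + i%:R).

(* R[i]^o is R[i] with its topology and its structure of normed module over
   itself. *)
Definition hyp2F1_series (a b c xi : R[i]) : nat -> R[i]^o :=
  series (fun n => pochhammer a n * pochhammer b n / pochhammer c n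
                   * (xi ^+ n / n`!%:R) : R[i]^o).

Definition hyp2F1 (a b c xi : R[i]) : R[i] := limn (hyp2F1_series a b c xi).

(* The library's [beta_fun] only takes natural arguments. *)
Definition Beta (x y : R) : R :=
  \int[lebesgue_measure]_(t in `]0, 1[) (t `^ (x - 1) * (1 - t) `^ (y - 1)).

End SpecialFunctions.

(* R[i] has no measurable structure: measures and integrals live on R * R,
   identified with R[i] through [to_complex]. *)
Notation plane R := (measurableTypeR R * measurableTypeR R)%type.

Section WeightedMeasure.
Context {R : realType}.

Definition to_complex (v : plane R) : R[i] := v.1 +i* v.2.

Definition unit_disk : set R[i] := [set z | Normc.normc z < 1].

Definition punctured_disk : set R[i] := [set z | unit_disk z /\ z != 0].

Definition area : {measure set (plane R) -> \bar R} :=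
  mscale (NngNum (pi_ge0 R))%:num^-1%:nng
    (@lebesgue_measure R \x @lebesgue_measure R)%E.

Variables alpha beta : R.

Definition weight (z : R[i]) : R :=
  Normc.normc z `^ (2 * beta) * (1 - Normc.normc z ^+ 2) `^ alpha
  / Beta (alpha + 1) (beta + 1).

(* The measure on the plane carried by the unit disk with density [weight]
   with respect to [area]. *)
Definition weighted_area (A : set (plane R)) : \bar R :=
  (\int[area]_(v in A `&` to_complex @^-1` unit_disk) (weight (to_complex v))%:E)%E.

Lemma measurable_normc_plane :
  measurable_fun setT (fun v => Normc.normc (to_complex v)).
Proof.
rewrite /to_complex /=.
apply: (@measurableT_comp _ _ _ _ _ _ (@Num.sqrt R)).
  apply: subspace_continuous_measurable_fun => //.
  by apply: continuous_subspaceT; exact: sqrt_continuous.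
by apply: measurable_funD; apply: measurable_funX;
  [exact: measurable_fst|exact: measurable_snd].
Qed.

Lemma measurable_unit_disk : measurable (to_complex @^-1` unit_disk).
Proof.
have := measurable_fun_ltr measurable_normc_plane
  (@measurable_cst _ _ (plane R) R setT 1).
by move=> /(_ measurableT [set true] I); rewrite setTI.
Qed.

Lemma measurable_weight : measurable_fun setT (fun v => weight (to_complex v)).
Proof.
apply: measurable_funM => //; apply: measurable_funM.
  apply: (@measurableT_comp _ _ _ _ _ _ (@powR R ^~ (2 * beta))).
    exact: measurable_powR.
  exact: measurable_normc_plane.
apply: (@measurableT_comp _ _ _ _ _ _ (@powR R ^~ alpha)).
  exact: measurable_powR.
apply: measurable_funB => //; apply: measurable_funX.
exact: measurable_normc_plane.
Qed.

Lemma weight_ge0 z : 0 <= weight z.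
Proof.
rewrite /weight divr_ge0 ?mulr_ge0 ?powR_ge0//.
by apply: Rintegral_ge0 => //= t _; rewrite mulr_ge0 ?powR_ge0.
Qed.

Let weighted_area0 : weighted_area set0 = 0%E.
Proof. by rewrite /weighted_area set0I integral_set0. Qed.

Let weighted_area_ge0 A : (0 <= weighted_area A)%E.
Proof. by apply: integral_ge0 => v _; rewrite lee_fin weight_ge0. Qed.

Let weighted_area_sigma_additive : semi_sigma_additive weighted_area.
Proof.
move=> /= F mF tF mUF; rewrite /weighted_area; apply: cvg_toP.
  apply: ereal_nondecreasing_is_cvgn => m n mn.
  by apply: lee_sum_nneg_natr => // k _ _; exact: weighted_area_ge0.
rewrite setI_bigcupl ge0_integral_bigcup//=.
- by move=> k; apply: measurableI => //; exact: measurable_unit_disk.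
- apply/measurable_funTS/measurableT_comp => //; exact: measurable_weight.
- by move=> v _; rewrite lee_fin weight_ge0.
- by apply: trivIset_setIr.
Qed.

HB.instance Definition _ := isMeasure.Build _ _ _ weighted_area
  weighted_area0 weighted_area_ge0 weighted_area_sigma_additive.

End WeightedMeasure.

Section ComplexIntegral.
Context {R : realType}.
Variables (mu : {measure set (plane R) -> \bar R}) (F : R[i] -> R[i]).

Definition disk_integrable : Prop :=
  mu.-integrable (to_complex @^-1` unit_disk)
    (fun v => (complex.Re (F (to_complex v)))%:E) /\
  mu.-integrable (to_complex @^-1` unit_disk)
    (fun v => (complex.Im (F (to_complex v)))%:E).

Definition disk_integral : R[i] :=
  (\int[mu]_(v in to_complex @^-1` unit_disk) complex.Re (F (to_complex v)))
  +i* (\int[mu]_(v in to_complex @^-1` unit_disk) complex.Im (F (to_complex v))).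

End ComplexIntegral.

Section BergmanSpace.
Context {R : realType}.

(* Over the field R[i], differentiability in the direction 1 is complex
   differentiability. *)
Definition holomorphic_on (U : set R[i]) (f : R[i] -> R[i]) : Prop :=
  forall z, U z -> derivable (f : R[i]^o -> R[i]^o) z 1.

(* Elements of the space are functions on the punctured disk, represented by
   total functions whose values off the punctured disk are irrelevant: equality
   in the space is equality on [punctured_disk]. *)
Definition bergman (alpha beta : R) : set (R[i] -> R[i]) :=
  [set f | holomorphic_on punctured_disk f /\
     (weighted_area alpha beta).-integrable (to_complex @^-1` unit_disk)
       (fun v => (Normc.normc (f (to_complex v)) ^+ 2)%:E)].

Definition bergman_inner (alpha beta : R) (f g : R[i] -> R[i]) : R[i] :=
  disk_integral (weighted_area alpha beta) (fun w => f w * (g w)^*).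

Definition bergman_norm (alpha beta : R) (f : R[i] -> R[i]) : R :=
  Num.sqrt (complex.Re (bergman_inner alpha beta f f)).

(* The second clause says that T is well defined on functions on the punctured
   disk. *)
Definition bounded_operator (alpha beta alpha' beta' : R)
    (T : (R[i] -> R[i]) -> (R[i] -> R[i])) : Prop :=
  [/\ forall f, bergman alpha beta f -> bergman alpha' beta' (T f),
      forall f g, bergman alpha beta f -> bergman alpha beta g ->
        {in punctured_disk, f =1 g} -> {in punctured_disk, T f =1 T g},
      forall (a : R[i]) f g, bergman alpha beta f -> bergman alpha beta g ->
        {in punctured_disk,
          T (fun w => a * f w + g w) =1 (fun z => a * T f z + T g z)} &
      exists M : R, forall f, bergman alpha beta f ->
        bergman_norm alpha' beta' (T f) <= M * bergman_norm alpha beta f].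

End BergmanSpace.

Section Transform.
Context {R : realType}.
Variables alpha beta0 : R.

Definition cst_pq (p q : nat) : R :=
  Num.sqrt (pochhammer (beta0 + 1) p * pochhammer (beta0 + 1) q
            / (pochhammer (alpha + beta0 + 2) p
               * pochhammer (alpha + beta0 + 2) q)).

Definition transform_integrand (p q : nat) (f : R[i] -> R[i]) (z w : R[i])
    : R[i] :=
  f w / (w^* ^+ p * z ^+ q)
  * hyp2F1 1 (alpha + beta0 + 2)%:C (beta0 + 1)%:C (w^* * z).

Definition transform (p q : nat) (f : R[i] -> R[i]) (z : R[i]) : R[i] :=
  (cst_pq p q)%:C
  * disk_integral (weighted_area alpha (beta0 + p%:R))
      (transform_integrand p q f z).

End Transform.

(* Main.v *)
From HB Require Import structures.
Require Import Defs.
From mathcomp Require Import all_boot all_order all_algebra.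
From mathcomp Require Import all_classical all_reals all_analysis.
From mathcomp Require Import measurable_realfun.
From mathcomp Require Import complex.
From mathcomp Require Import ring lra.

Set Implicit Arguments.
Unset Strict Implicit.
Unset Printing Implicit Defensive.

Import Order.TTheory GRing.Theory Num.Theory.
Import numFieldNormedType.Exports.

Local Open Scope classical_set_scope.
Local Open Scope complex_scope.
Local Open Scope ring_scope.

Import Normc.

(** The transform is a multiplication operator in disguise. Let c_n be the n-th
coefficient of the hypergeometric series F, so that the constant of the transform
is (c_p c_q)^(-1/2). Both c_n and the inverse of the moment of |w|^2n with respect
to mu_(alpha, beta0) obey the recurrence of the beta function, hence they agree
([kernel_coef_moment]), and on the punctured disk the density of
mu_(alpha, beta0 + n) is c_n |w|^2n times that of mu_(alpha, beta0)
([weight_plane_shift]). If f lies in the space with exponent beta0 + p, then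
g w = w^p f w is square integrable for mu_(alpha, beta0), and the integral in
D_(p,q) f z is c_p z^(-q) times the integral of g against F (conj w * z). This last
integral is g z, by the reproducing formula. So D_(p,q) is multiplication by
(c_p / c_q)^(1/2) z^p / z^q ([transform_formula]). This multiplication transforms
|f|^2 times one weight into |D f|^2 times the other at every point
([multiplier_weight]), which gives the isometry, and it is undone by the
multiplication with p and q exchanged ([multiplierK]), which gives surjectivity and
the inverse.

The reproducing formula ([reproducing_formula]) is obtained by integrating the
series of F term by term. Let a_n be the integral of g w * w^(-n) over a circle; it
does not depend on the circle, by Goursat's theorem in logarithmic coordinates
([circle_int_annulus]). On the circle of radius r the integral of
g w * (conj w)^n is r^2n a_n, so by rotation invariance of the area its integral
over the disk is a_n / (2 pi) times a moment, that is a_n / (2 pi c_n)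
([disk_integral_circle]). The partial sums of the kernel series therefore integrate
to the partial sums of the series of the a_n z^n / (2 pi).

It remains to see that the a_n z^n, n >= 0, sum to 2 pi g z ([cauchy_series]): a
square integrable holomorphic function on the punctured disk has no polar part.
This is proved directly, by Cauchy's argument for the function
h w = w (g w - g z) / (w - z). Its circle integrals are constant on each side of
the circle |w| = |z| and depend continuously on the radius. They vanish near the
origin: otherwise the square integrability of h w / w there, which follows from that
of g because beta0 <= 0, would make 1 / |w|^2 integrable
([circle_mean_vanishes]). *)

(** * Complex numbers *)

Section ComplexNumbers.
Context {R : realType}.
Implicit Types (z w : R[i]) (r t : R).

Lemma normc_norm z : `|z| = (normc z)%:C.
Proof. by case: z. Qed.

Lemma normc_ge0 z : 0 <= normc z.
Proof. by case: z => a b; exact: sqrtr_ge0. Qed.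

Lemma normc_eq0 z : (normc z == 0) = (z == 0).
Proof.
by apply/eqP/eqP => [/eq0_normc//|->]; exact: normc0.
Qed.

Lemma normc_gt0 z : (0 < normc z) = (z != 0).
Proof. by rewrite lt_neqAle normc_ge0 andbT eq_sym normc_eq0. Qed.

Lemma ler_normcD z w : normc (z + w) <= normc z + normc w.
Proof. exact: le_normcD. Qed.

Lemma normcN z : normc (- z) = normc z.
Proof. exact: complex.normcN. Qed.

Lemma normc_distC z w : normc (z - w) = normc (w - z).
Proof. by rewrite -normcN opprB. Qed.

Lemma ler_normcB z w : normc (z - w) <= normc z + normc w.
Proof. by rewrite -(normcN w) ler_normcD. Qed.

Lemma lerB_normc z w : normc z - normc w <= normc (z - w).
Proof. by rewrite lerBlDr -{1}(subrK w z) ler_normcD. Qed.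

Lemma normc_real r : normc r%:C = `|r|.
Proof. by rewrite /= expr0n /= addr0 sqrtr_sqr. Qed.

Lemma normcX z n : normc (z ^+ n) = normc z ^+ n.
Proof. by elim: n => [|n IH]; rewrite ?normc1 // !exprS normcM IH. Qed.

Lemma normc_div z w : normc (z / w) = normc z / normc w.
Proof. by rewrite normcM normcV. Qed.

Lemma normc_sqr z : normc z ^+ 2 = complex.Re z ^+ 2 + complex.Im z ^+ 2.
Proof. by case: z => a b /=; rewrite sqr_sqrtr // addr_ge0 ?sqr_ge0. Qed.

Lemma ler_Re_normc z : `|complex.Re z| <= normc z.
Proof.
rewrite -ler_sqr ?nnegrE ?normc_ge0 // normc_sqr real_normK ?num_real //.
by rewrite lerDl sqr_ge0.
Qed.

Lemma ler_Im_normc z : `|complex.Im z| <= normc z.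
Proof.
rewrite -ler_sqr ?nnegrE ?normc_ge0 // normc_sqr real_normK ?num_real //.
by rewrite lerDr sqr_ge0.
Qed.

Lemma ler_normc_ReIm z : normc z <= `|complex.Re z| + `|complex.Im z|.
Proof.
case: z => a b; rewrite (_ : a +i* b = a%:C + 'i * b%:C); last by simpc.
apply: le_trans (ler_normcD _ _) _; rewrite normcM !normc_real /=.
by simpc; rewrite /= expr0n /= add0r expr1n sqrtr1 mul1r.
Qed.

Lemma normc_conj z : normc z^* = normc z.
Proof. by case: z => a b /=; rewrite sqrrN. Qed.

Lemma mulc_conj z : z * z^* = (normc z ^+ 2)%:C.
Proof.
by rewrite normc_sqr; case: z => a b /=; apply/eqP; rewrite eq_complex /=;
  apply/andP; split; apply/eqP; ring.
Qed.

Lemma ler_normc_sum (I : Type) (s : seq I) (F : I -> R[i]) :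
  normc (\sum_(i <- s) F i) <= \sum_(i <- s) normc (F i).
Proof.
elim: s => [|i s IH]; first by rewrite !big_nil normc0.
by rewrite !big_cons (le_trans (ler_normcD _ _)) // lerD2l.
Qed.

Lemma sqr_normcD_le z w : normc (z + w) ^+ 2 <= 2 * (normc z ^+ 2 + normc w ^+ 2).
Proof.
have t := ler_normcD z w; have n0 := normc_ge0 (z + w).
apply: (@le_trans _ _ ((normc z + normc w) ^+ 2)).
  by rewrite ler_sqr ?nnegrE ?addr_ge0 ?normc_ge0.
by have := sqr_ge0 (normc z - normc w); rewrite !expr2; lra.
Qed.

Lemma complex_eta z : z = complex.Re z +i* complex.Im z.
Proof. by case: z. Qed.

Lemma Re_mul z w : complex.Re (z * w)
  = complex.Re z * complex.Re w - complex.Im z * complex.Im w.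
Proof. by case: z => a b; case: w => c d. Qed.

Lemma Im_mul z w : complex.Im (z * w)
  = complex.Re z * complex.Im w + complex.Im z * complex.Re w.
Proof. by case: z => a b; case: w => c d. Qed.

Lemma Re_add z w : complex.Re (z + w) = complex.Re z + complex.Re w.
Proof. by case: z => a b; case: w => c d. Qed.

Lemma Im_add z w : complex.Im (z + w) = complex.Im z + complex.Im w.
Proof. by case: z => a b; case: w => c d. Qed.

Lemma Re_opp z : complex.Re (- z) = - complex.Re z.
Proof. by case: z. Qed.

Lemma Im_opp z : complex.Im (- z) = - complex.Im z.
Proof. by case: z. Qed.

Lemma Re_sum (I : Type) (s : seq I) (F : I -> R[i]) :
  complex.Re (\sum_(i <- s) F i) = \sum_(i <- s) complex.Re (F i).
Proof. by elim/big_rec2: _ => // i x y _ <-; rewrite Re_add. Qed.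

Lemma Im_sum (I : Type) (s : seq I) (F : I -> R[i]) :
  complex.Im (\sum_(i <- s) F i) = \sum_(i <- s) complex.Im (F i).
Proof. by elim/big_rec2: _ => // i x y _ <-; rewrite Im_add. Qed.

Definition cis t : R[i] := cos t +i* sin t.

Lemma cisD t u : cis (t + u) = cis t * cis u.
Proof.
by rewrite /cis cosD sinD; simpc; congr (_ +i* _); rewrite addrC.
Qed.

Lemma normc_cis t : normc (cis t) = 1.
Proof. by rewrite /= cos2Dsin2 sqrtr1. Qed.

Lemma cis0 : cis 0 = 1.
Proof. by rewrite /cis cos0 sin0. Qed.

Lemma cis_neq0 t : cis t != 0.
Proof. by rewrite -normc_gt0 normc_cis. Qed.

Lemma cis2pi t : cis (t + pi *+ 2) = cis t.
Proof. by rewrite /cis cosD2pi sinD2pi. Qed.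

Lemma normc_mul_cis z t : normc (z * cis t) = normc z.
Proof. by rewrite normcM normc_cis mulr1. Qed.

Lemma polar_form z : exists2 t, `|t| <= pi & z = (normc z)%:C * cis t.
Proof.
have [->|z0] := eqVneq z 0.
  by exists 0; rewrite ?normr0 ?pi_ge0 // normc0 mul0r.
have n0 : 0 < normc z by rewrite normc_gt0.
set u := z / (normc z)%:C.
have nu : normc u = 1.
  by rewrite normc_div normc_real ger0_norm ?ltW // divff ?gt_eqF.
have uz : z = (normc z)%:C * u.
  by rewrite /u mulrC divfK // -normc_eq0 normc_real normr_eq0 gt_eqF.
have u2 : complex.Re u ^+ 2 + complex.Im u ^+ 2 = 1.
  by rewrite -normc_sqr nu expr1n.
have cu : -1 <= complex.Re u <= 1.
  by rewrite -ler_norml -nu ler_Re_normc.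
have sa : sin (acos (complex.Re u)) = `|complex.Im u|.
  by rewrite sin_acos // -u2 addrC addKr sqrtr_sqr.
have ca : `|acos (complex.Re u)| <= pi.
  by rewrite ger0_norm ?acos_ge0 // acos_lepi.
have [s0|s0] := leP 0 (complex.Im u).
  exists (acos (complex.Re u)) => //; rewrite [LHS]uz; congr (_ * _).
  rewrite /cis acosK ?sa ?ger0_norm ?in_itv //=; exact: complex_eta.
exists (- acos (complex.Re u)); rewrite ?normrN // [LHS]uz; congr (_ * _).
rewrite /cis cosN sinN acosK ?sa ?ltr0_norm ?in_itv //= opprK.
exact: complex_eta.
Qed.

Lemma cvg_normcP (T : Type) (F : set_system T) {FF : Filter F}
    (f : T -> R[i]^o) (l : R[i]^o) :
  f x @[x --> F] --> l <->
  (forall e : R, 0 < e -> \forall x \near F, normc (l - f x) < e).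
Proof.
split=> [/cvgrPdist_lt fl e e0|fl].
  have e0' : 0 < e%:C :> R[i] by rewrite ltcR.
  by apply: filterS (fl _ e0') => x; rewrite normc_norm ltcR.
apply/cvgrPdist_lt => e; rewrite ltcE => /andP[/eqP ie re].
apply: filterS (fl _ re) => x; rewrite normc_norm (complex_eta e) ie => h.
by rewrite ltcR.
Qed.

End ComplexNumbers.

(** * Complex differentiability *)

Section ComplexDerivative.
Context {R : realType}.
Implicit Types (f g : R[i] -> R[i]) (z w : R[i]).

Definition cderiv_at f z (l : R[i]) := forall e : R, 0 < e ->
  exists2 d : R, 0 < d & forall w, normc (w - z) < d ->
    normc (f w - f z - l * (w - z)) <= e * normc (w - z).

Definition ccontinuous_at f z := forall e : R, 0 < e ->
  exists2 d : R, 0 < d & forall w, normc (w - z) < d -> normc (f w - f z) < e.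

Lemma dnbhs0_normcP (P : set (R[i]^o)) : (\forall h \near 0^', P h) <->
  exists2 d : R, 0 < d & forall h, normc h < d -> h != 0 -> P h.
Proof.
split=> [[d /= d0 dP]|[d d0 dP]].
  move: d0; rewrite ltcE => /andP[/eqP id rd]; exists (complex.Re d) => // h hd h0.
  apply: dP => //=; rewrite sub0r normrN normc_norm (complex_eta d) id ltcR.
  exact: hd.
exists d%:C => /=; first by rewrite ltcR.
by move=> h /=; rewrite sub0r normrN normc_norm ltcR => hd h0; exact: dP.
Qed.

Lemma derivable_cderiv f z : derivable (f : R[i]^o -> R[i]^o) z 1 ->
  exists l, cderiv_at f z l.
Proof.
move=> /cvg_ex[l /cvg_normcP fl]; exists l => e e0.
have /dnbhs0_normcP[d d0 dP] := fl _ e0; exists d => // w wzd.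
have [->|wz] := eqVneq w z.
  by rewrite !subrr mulr0 subr0 normc0 mulr0.
have wz0 : w - z != 0 by rewrite subr_eq0.
have := dP _ wzd wz0; rewrite /= /shift /=.
rewrite [_ *: 1]mulr1 subrK => /ltW.
rewrite -(@ler_pM2r _ (normc (w - z))) ?normc_gt0 // -normcM.
move=> h; apply: le_trans h; rewrite -normcN le_eqVlt; apply/orP; left.
apply/eqP; congr normc; set x := f w - f z; set y := w - z.
rewrite [LHS](_ : _ = ((l : R[i]) - y^-1 * x) * y) //.
by rewrite mulrBl mulrAC mulVf // mul1r opprB.
Qed.

Lemma cderiv_continuous f z l : cderiv_at f z l -> ccontinuous_at f z.
Proof.
move=> fl e e0; have [d d0 dP] := fl _ ltr01.
have M0 : 0 < 1 + normc l by rewrite ltr_pwDl ?normc_ge0.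
exists (Num.min d (e / (1 + normc l))); first by rewrite lt_min d0 divr_gt0.
move=> w; rewrite lt_min => /andP[wd we].
have -> : f w - f z = (f w - f z - l * (w - z)) + l * (w - z) by ring.
apply: le_lt_trans (ler_normcD _ _) _.
apply: le_lt_trans (lerD (dP _ wd) (lexx _)) _.
by rewrite normcM -mulrDl mulrC -ltr_pdivlMr.
Qed.

Lemma holomorphic_ccontinuous (U : set R[i]) f z :
  holomorphic_on U f -> U z -> ccontinuous_at f z.
Proof. by move=> hf /hf/derivable_cderiv[l]; exact: cderiv_continuous. Qed.

Lemma nbhs_normcP z (P : set R[i]) :
  (\forall w \near (z : R[i]^o), P w) <->
  exists2 d : R, 0 < d & forall w, normc (w - z) < d -> P w.
Proof.
split=> [/nbhs_ballP[d /= d0 dP]|[d d0 dP]].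
  move: d0; rewrite ltcE => /andP[/eqP id rd]; exists (complex.Re d) => // h hd.
  apply: dP => /=; rewrite /ball /= distrC normc_norm (complex_eta d) id ltcR.
  exact: hd.
apply/nbhs_ballP; exists d%:C => /=; first by rewrite ltcR.
move=> w; rewrite /ball /= distrC normc_norm ltcR; exact: dP.
Qed.

Definition copen (U : set R[i]) := forall z, U z ->
  exists2 d : R, 0 < d & forall w, normc (w - z) < d -> U w.

Lemma eq_holomorphic U f g : copen U -> (forall z, U z -> f z = g z) ->
  holomorphic_on U f -> holomorphic_on U g.
Proof.
move=> oU fg hf z Uz; apply: near_eq_derivable (hf z Uz).
by apply/nbhs_normcP; have [d d0 dP] := oU z Uz; exists d => // w /dP/fg.
Qed.

Lemma subset_holomorphic U V f : U `<=` V ->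
  holomorphic_on V f -> holomorphic_on U f.
Proof. by move=> UV hf z /UV/hf. Qed.

Lemma holomorphicD U f g : holomorphic_on U f -> holomorphic_on U g ->
  holomorphic_on U (fun z => f z + g z).
Proof. by move=> hf hg z Uz; apply: derivableD; [exact: hf|exact: hg]. Qed.

Lemma holomorphicB U f g : holomorphic_on U f -> holomorphic_on U g ->
  holomorphic_on U (fun z => f z - g z).
Proof. by move=> hf hg z Uz; apply: derivableB; [exact: hf|exact: hg]. Qed.

Lemma holomorphicM U f g : holomorphic_on U f -> holomorphic_on U g ->
  holomorphic_on U (fun z => f z * g z).
Proof.
by move=> hf hg z Uz; apply: (@derivableM R[i] R[i]^o);
  [exact: hf|exact: hg].
Qed.

Lemma holomorphicV U f : (forall z, U z -> f z != 0) ->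
  holomorphic_on U f -> holomorphic_on U (fun z => (f z)^-1).
Proof.
by move=> f0 hf z Uz; apply: (@derivableV R[i] R[i]^o); [exact: f0|exact: hf].
Qed.

Lemma holomorphic_cst U (a : R[i]) : holomorphic_on U (fun=> a).
Proof. by move=> z _; exact: derivable_cst. Qed.

Lemma holomorphic_id U : @holomorphic_on R U id.
Proof. by move=> z _; exact: derivable_id. Qed.

Lemma holomorphicX U n : @holomorphic_on R U (fun z => z ^+ n).
Proof. by move=> z _; exact: (@exprn_derivable R[i]). Qed.

Lemma copen_annulus (r1 r2 : R) : copen [set z | r1 < normc z < r2].
Proof.
move=> z /= /andP[z1 z2]; exists (Num.min (normc z - r1) (r2 - normc z)).
  by rewrite lt_min !subr_gt0 z1 z2.
move=> w; rewrite lt_min => /andP[w1 w2]; apply/andP; split.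
  rewrite normc_distC in w1.
  by have := lerB_normc z w; lra.
by have := lerB_normc w z; lra.
Qed.

Lemma punctured_diskE : @punctured_disk R = [set z | 0 < normc z < 1].
Proof.
rewrite /punctured_disk /unit_disk; apply/seteqP; split=> z /=.
  by move=> [z1 z0]; rewrite normc_gt0 z0.
by rewrite normc_gt0 => /andP[z0 z1].
Qed.

Lemma copen_punctured_disk : copen (@punctured_disk R).
Proof. by rewrite punctured_diskE; exact: copen_annulus. Qed.

End ComplexDerivative.

(** * Integrals of complex-valued functions *)

Section RealIntegral.
Context d (T : measurableType d) (R : realType).
Variables (mu : {measure set T -> \bar R}) (D : set T).
Hypothesis mD : measurable D.
Implicit Types f g : T -> R.

Lemma integrable_dominated f g : measurable_fun D f ->
  (forall x, D x -> `|f x| <= g x) ->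
  mu.-integrable D (EFin \o g) -> mu.-integrable D (EFin \o f).
Proof.
move=> mf fg; apply: (@le_integrable _ _ _ mu D mD _ (EFin \o g)).
  exact/measurable_EFinP.
by move=> x Dx /=; rewrite lee_fin (le_trans (fg _ Dx)) // ler_norm.
Qed.

Lemma integrableR_measurable f : mu.-integrable D (EFin \o f) -> measurable_fun D f.
Proof. by move=> /measurable_int/measurable_EFinP. Qed.

Lemma integrableRD f g : mu.-integrable D (EFin \o f) ->
  mu.-integrable D (EFin \o g) ->
  mu.-integrable D (EFin \o (fun x => f x + g x)).
Proof.
move=> f1 g1; apply: eq_integrable (integrableD mD f1 g1) => // x _ /=.
Qed.

Lemma integrableRB f g : mu.-integrable D (EFin \o f) ->
  mu.-integrable D (EFin \o g) ->
  mu.-integrable D (EFin \o (fun x => f x - g x)).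
Proof.
move=> f1 g1; apply: eq_integrable (integrableB mD f1 g1) => // x _ /=.
Qed.

Lemma integrableRZ r f : mu.-integrable D (EFin \o f) ->
  mu.-integrable D (EFin \o (fun x => r * f x)).
Proof. by move=> f1; exact: (integrableZl mD r f1). Qed.

End RealIntegral.

Section ComplexIntegral.
Context d (T : measurableType d) (R : realType).
Variables (mu : {measure set T -> \bar R}) (D : set T).
Hypothesis mD : measurable D.
Implicit Types F G : T -> R[i].
Local Notation Re := complex.Re.
Local Notation Im := complex.Im.

Definition Cmeasurable F :=
  measurable_fun D (fun x => Re (F x)) /\ measurable_fun D (fun x => Im (F x)).

Definition Cintegrable F :=
  mu.-integrable D (EFin \o (fun x => Re (F x))) /\
  mu.-integrable D (EFin \o (fun x => Im (F x))).

Definition Cint F : R[i] :=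
  (\int[mu]_(x in D) Re (F x)) +i* (\int[mu]_(x in D) Im (F x)).

Lemma Cmeasurable_cst a : Cmeasurable (fun=> a).
Proof. by split; exact: measurable_cst. Qed.

Lemma CmeasurableM F G : Cmeasurable F -> Cmeasurable G ->
  Cmeasurable (fun x => F x * G x).
Proof.
move=> [F1 F2] [G1 G2]; split.
  by under eq_fun do rewrite Re_mul; apply: measurable_funB; exact: measurable_funM.
by under eq_fun do rewrite Im_mul; apply: measurable_funD; exact: measurable_funM.
Qed.

Lemma Cmeasurable_real (f : T -> R) : measurable_fun D f ->
  Cmeasurable (fun x => (f x)%:C).
Proof. by move=> mf; split => //=; exact: measurable_cst. Qed.

Lemma measurable_normc F : Cmeasurable F -> measurable_fun D (fun x => normc (F x)).
Proof.
move=> [F1 F2].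
rewrite (_ : (fun _ => _) = (fun x => Num.sqrt (Re (F x) ^+ 2 + Im (F x) ^+ 2))).
  apply: (@measurableT_comp _ _ _ _ _ _ (@Num.sqrt R)).
    by apply: continuous_measurable_fun; exact: sqrt_continuous.
  by apply: measurable_funD; apply: measurable_funX.
by apply/funext => x; case: (F x).
Qed.

Lemma Cintegrable_measurable F : Cintegrable F -> Cmeasurable F.
Proof. by move=> [F1 F2]; split; apply: integrableR_measurable; [exact: F1|exact: F2]. Qed.

Lemma Cintegrable_dominated F (g : T -> R) : Cmeasurable F ->
  (forall x, D x -> normc (F x) <= g x) ->
  mu.-integrable D (EFin \o g) -> Cintegrable F.
Proof.
move=> [F1 F2] Fg ig; split; apply: integrable_dominated ig => // x Dx.
  exact: le_trans (ler_Re_normc _) (Fg _ Dx).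
exact: le_trans (ler_Im_normc _) (Fg _ Dx).
Qed.

Lemma Cintegrable_normc F : Cintegrable F ->
  mu.-integrable D (EFin \o (fun x => normc (F x))).
Proof.
move=> iF; have [F1 F2] := iF.
apply: (@integrable_dominated _ _ _ _ _ mD _ (fun x => `|Re (F x)| + `|Im (F x)|)).
- exact/measurable_normc/Cintegrable_measurable.
- by move=> x _; rewrite ger0_norm ?normc_ge0 // ler_normc_ReIm.
- by apply: integrableRD => //; exact: integrable_norm.
Qed.

Lemma eq_Cint F G : (forall x, D x -> F x = G x) -> Cint F = Cint G.
Proof.
move=> FG; rewrite /Cint; congr (_ +i* _); apply: eq_Rintegral => x;
  by rewrite inE => /FG ->.
Qed.

Lemma eq_Cintegrable F G : (forall x, D x -> F x = G x) ->
  Cintegrable F -> Cintegrable G.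
Proof.
move=> FG [F1 F2]; split.
  by apply: eq_integrable F1 => // x; rewrite inE => /FG /= ->.
by apply: eq_integrable F2 => // x; rewrite inE => /FG /= ->.
Qed.

Lemma CintegrableD F G : Cintegrable F -> Cintegrable G ->
  Cintegrable (fun x => F x + G x).
Proof.
move=> [F1 F2] [G1 G2]; split.
  by under eq_fun do rewrite Re_add; exact: integrableRD.
by under eq_fun do rewrite Im_add; exact: integrableRD.
Qed.

Lemma CintD F G : Cintegrable F -> Cintegrable G ->
  Cint (fun x => F x + G x) = Cint F + Cint G.
Proof.
move=> [F1 F2] [G1 G2]; rewrite /Cint.
under eq_Rintegral do rewrite Re_add.
under [X in _ +i* X]eq_Rintegral do rewrite Im_add.
by rewrite !RintegralD.
Qed.

Lemma CintegrableZ a F : Cintegrable F -> Cintegrable (fun x => a * F x).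
Proof.
move=> [F1 F2]; split.
  under eq_fun do rewrite Re_mul.
  by apply: integrableRB => //; exact: integrableRZ.
under eq_fun do rewrite Im_mul.
by apply: integrableRD => //; exact: integrableRZ.
Qed.

Lemma CintZ a F : Cintegrable F -> Cint (fun x => a * F x) = a * Cint F.
Proof.
move=> [F1 F2]; rewrite /Cint.
under eq_Rintegral do rewrite Re_mul.
under [X in _ +i* X]eq_Rintegral do rewrite Im_mul.
rewrite RintegralB//; try exact: integrableRZ.
rewrite RintegralD//; try exact: integrableRZ.
by rewrite !RintegralZl//; case: a.
Qed.

Lemma CintegrableB F G : Cintegrable F -> Cintegrable G ->
  Cintegrable (fun x => F x - G x).
Proof.
move=> iF iG; apply: CintegrableD => //.
by under eq_fun do rewrite -mulN1r; exact: CintegrableZ.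
Qed.

Lemma CintB F G : Cintegrable F -> Cintegrable G ->
  Cint (fun x => F x - G x) = Cint F - Cint G.
Proof.
move=> iF iG; rewrite CintD//.
  by congr (_ + _); under eq_fun do rewrite -mulN1r; rewrite CintZ // mulN1r.
by under eq_fun do rewrite -mulN1r; exact: CintegrableZ.
Qed.

Lemma Cintegrable0 : Cintegrable (fun=> 0).
Proof. by split; exact: integrable0. Qed.

Lemma Cint0 : Cint (fun=> 0) = 0.
Proof. by rewrite /Cint /= !Rintegral_cst // !mul0r. Qed.

Lemma Cintegrable_sum (I : Type) (s : seq I) (F : I -> T -> R[i]) :
  (forall i, Cintegrable (F i)) -> Cintegrable (fun x => \sum_(i <- s) F i x).
Proof.
move=> iF; elim: s => [|i s IH].
  by under eq_fun do rewrite big_nil; exact: Cintegrable0.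
by under eq_fun do rewrite big_cons; exact: CintegrableD.
Qed.

Lemma Cint_sum (I : Type) (s : seq I) (F : I -> T -> R[i]) :
  (forall i, Cintegrable (F i)) ->
  Cint (fun x => \sum_(i <- s) F i x) = \sum_(i <- s) Cint (F i).
Proof.
move=> iF; elim: s => [|i s IH].
  by rewrite big_nil; under eq_fun do rewrite big_nil; exact: Cint0.
rewrite big_cons -IH -CintD//; last exact: Cintegrable_sum.
by under eq_fun do rewrite big_cons.
Qed.

Lemma ler_normc_Cint F : Cintegrable F ->
  normc (Cint F) <= \int[mu]_(x in D) normc (F x).
Proof.
move=> iF; have [I0|I0] := eqVneq (Cint F) 0.
  by rewrite I0 normc0; apply: Rintegral_ge0 => x _; exact: normc_ge0.
(* rotating the integral onto the positive real axis reduces to a real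
   integral *)
set n := normc (Cint F); set u := (Cint F)^* / n%:C.
have n0 : 0 < n by rewrite normc_gt0.
have nu : normc u = 1.
  by rewrite normc_div normc_conj normc_real gtr0_norm // divff // gt_eqF.
have -> : n = Re (u * Cint F).
  rewrite /u mulrAC [_^* * _]mulrC mulc_conj -/n -(fmorphV (real_complex R)) -rmorphM /=.
  by rewrite expr2 mulfK // gt_eqF.
rewrite -CintZ// /Cint; apply: le_Rintegral => //.
- by case: (CintegrableZ u iF).
- exact: Cintegrable_normc.
- move=> x _; apply: le_trans (ler_norm _) _; apply: le_trans (ler_Re_normc _) _.
  by rewrite normcM nu mul1r.
Qed.

Lemma Cint_dominated_convergence (F_ : nat -> T -> R[i]) F (g : T -> R) :
  (forall n, Cmeasurable (F_ n)) ->
  (forall x, D x -> forall e : R, 0 < e ->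
     \forall n \near \oo, normc (F x - F_ n x) < e) ->
  mu.-integrable D (EFin \o g) ->
  (forall n x, D x -> normc (F_ n x) <= g x) ->
  Cintegrable F /\
  (forall e : R, 0 < e -> \forall n \near \oo, normc (Cint F - Cint (F_ n)) < e).
Proof.
move=> mF FF ig Fg.
have ReF x : D x -> (fun n => Re (F_ n x)) @ \oo --> Re (F x).
  move=> Dx; apply/cvgrPdist_lt => e e0; apply: filterS (FF x Dx e e0) => n.
  by apply: le_lt_trans; rewrite -Re_opp -Re_add; exact: ler_Re_normc.
have ImF x : D x -> (fun n => Im (F_ n x)) @ \oo --> Im (F x).
  move=> Dx; apply/cvgrPdist_lt => e e0; apply: filterS (FF x Dx e e0) => n.
  by apply: le_lt_trans; rewrite -Im_opp -Im_add; exact: ler_Im_normc.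
have iFn n : Cintegrable (F_ n) by apply: (Cintegrable_dominated (mF n) (Fg n) ig).
have dct (p : R[i] -> R) : (forall z, `|p z| <= normc z) ->
    (forall n, measurable_fun D (fun x => p (F_ n x))) ->
    (forall x, D x -> (fun n => p (F_ n x)) @ \oo --> p (F x)) ->
    mu.-integrable D (EFin \o (fun x => p (F x))) /\
    (fun n => \int[mu]_(x in D) p (F_ n x)) @ \oo --> \int[mu]_(x in D) p (F x).
  move=> pn mp pF.
  have mpF : measurable_fun D (fun x => p (F x)) by exact: measurable_fun_cvg mp pF.
  have [] := @dominated_convergence _ _ _ mu D mD
    (fun n x => (p (F_ n x))%:E) (fun x => (p (F x))%:E) (EFin \o g).
  - by move=> n; exact/measurable_EFinP.
  - exact/measurable_EFinP.
  - by apply: aeW => x Dx; apply: cvg_EFin; [exact: nearW|exact: pF].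
  - exact: ig.
  - apply: aeW => x n Dx; rewrite /= lee_fin.
    exact: le_trans (pn _) (Fg n x Dx).
  move=> ipF _ cvgp; split => //.
  have fin : (\int[mu]_(x in D) (p (F x))%:E)%E \is a fin_num.
    exact: integrable_fin_num.
  apply: fine_cvg; rewrite fineK //; exact: cvgp.
have [iR cR] := dct (@complex.Re R) (@ler_Re_normc R) (fun n => (mF n).1) ReF.
have [iI cI] := dct (@complex.Im R) (@ler_Im_normc R) (fun n => (mF n).2) ImF.
split=> // e e0; have e2 : 0 < e / 2 by rewrite divr_gt0.
move/cvgrPdist_lt/(_ _ e2) : cR => cR; move/cvgrPdist_lt/(_ _ e2) : cI => cI.
near=> n; apply: le_lt_trans (ler_normc_ReIm _) _.
rewrite /Cint Re_add Im_add Re_opp Im_opp /= (splitr e).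
by apply: ltrD; near: n.
Unshelve. all: by end_near. Qed.

End ComplexIntegral.

(** * Integrals of paths *)

Section IntervalIntegral.
Context {R : realType}.
Local Notation leb := (@lebesgue_measure R).
Implicit Types (F : R -> R[i]) (a b c : R).

Definition path_continuous_at F s := forall e : R, 0 < e ->
  exists2 d : R, 0 < d & forall s', `|s' - s| < d -> normc (F s' - F s) < e.

Lemma path_continuous_Re F s : path_continuous_at F s ->
  {for s, continuous (fun t => complex.Re (F t))}.
Proof.
move=> cF; apply/cvgrPdist_lt => e /cF[d d0 dP].
apply/nbhs_ballP; exists d => //= t; rewrite /ball /= distrC => /dP.
by rewrite normc_distC; apply: le_lt_trans; rewrite -Re_opp -Re_add; exact: ler_Re_normc.
Qed.

Lemma path_continuous_Im F s : path_continuous_at F s ->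
  {for s, continuous (fun t => complex.Im (F t))}.
Proof.
move=> cF; apply/cvgrPdist_lt => e /cF[d d0 dP].
apply/nbhs_ballP; exists d => //= t; rewrite /ball /= distrC => /dP.
by rewrite normc_distC; apply: le_lt_trans; rewrite -Im_opp -Im_add; exact: ler_Im_normc.
Qed.

Lemma path_continuousB F G s : path_continuous_at F s -> path_continuous_at G s ->
  path_continuous_at (fun t => F t - G t) s.
Proof.
move=> cF cG e e0; have e2 : 0 < e / 2 by rewrite divr_gt0.
have [d d0 dP] := cF _ e2; have [d' d'0 d'P] := cG _ e2.
exists (Num.min d d'); first by rewrite lt_min d0.
move=> t; rewrite lt_min => /andP[td td'].
have -> : F t - G t - (F s - G s) = (F t - F s) - (G t - G s) by ring.
rewrite (splitr e); apply: le_lt_trans (ler_normcB _ _) _.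
by apply: ltrD; [exact: dP|exact: d'P].
Qed.

Lemma path_continuous_Cintegrable F a b :
  (forall s, a <= s <= b -> path_continuous_at F s) ->
  Cintegrable leb `[a, b] F.
Proof.
move=> cF; split; apply: continuous_compact_integrable;
  try exact: segment_compact;
  apply: continuous_in_subspaceT => s; rewrite inE /= in_itv /= => /cF cs.
- exact: path_continuous_Re.
- exact: path_continuous_Im.
Qed.

Lemma Cint_itv_split F a b c : a <= b -> b <= c -> Cintegrable leb `[a, c] F ->
  Cint leb `[a, c] F = Cint leb `[a, b] F + Cint leb `[b, c] F.
Proof.
move=> ab bc [F1 F2].
have split_real (f : R -> R) : leb.-integrable `[a, c] (EFin \o f) ->
    \int[leb]_(x in `[a, c]) f x =
    \int[leb]_(x in `[a, b]) f x + \int[leb]_(x in `[b, c]) f x.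
  move=> fi; rewrite -(@Rintegral_itv_obnd_cbnd _ b).
    rewrite -(@Rintegral_itvB _ _ (BLeft a) (BRight c) b) //.
    - by rewrite addrC subrK.
  apply: integrableS fi => //.
  by apply: subset_itvr; rewrite bnd_simp.
by rewrite /Cint !split_real //; simpc.
Qed.

Lemma Rintegral_itv_cst a b (k : R) : a <= b ->
  \int[leb]_(x in `[a, b]) k = k * (b - a).
Proof.
move=> ab; rewrite (Rintegral_cst leb); last exact: measurable_itv.
congr (_ * _); rewrite [X in fine X](_ : _ = (b - a)%:E) //.
rewrite [LHS]lebesgue_measure_itv /= lte_fin; case: ltgtP ab => // [->] _.
by rewrite subrr.
Qed.

Lemma ler_normc_Cint_itv F a b (M : R) : a <= b ->
  Cintegrable leb `[a, b] F -> (forall s, a <= s <= b -> normc (F s) <= M) ->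
  normc (Cint leb `[a, b] F) <= M * (b - a).
Proof.
move=> ab iF FM; apply: le_trans (ler_normc_Cint _ iF) _; first exact: measurable_itv.
rewrite -(Rintegral_itv_cst M ab).
apply: le_Rintegral; first exact: measurable_itv.
- by apply: Cintegrable_normc => //; exact: measurable_itv.
- apply: continuous_compact_integrable; first exact: segment_compact.
  by apply: continuous_subspaceT => x; exact: cst_continuous.
- by move=> s; rewrite /= in_itv; exact: FM.
Qed.

Lemma Cint_itv_cst a b (k : R[i]) : a <= b ->
  Cint leb `[a, b] (fun=> k) = k * (b - a)%:C.
Proof.
move=> ab; rewrite /Cint !Rintegral_itv_cst //.
by case: k => x y; simpc.
Qed.

End IntervalIntegral.

(** * Goursat's theorem on rectangles *)

Section Goursat.
Context {R : realType}.
Local Notation leb := (@lebesgue_measure R).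
Implicit Types (H : R -> R -> R[i]) (a c l m s t : R).

Definition plane_cderiv_at H s t (k : R[i]) := forall e : R, 0 < e ->
  exists2 d : R, 0 < d & forall s' t', `|s' - s| < d -> `|t' - t| < d ->
    normc (H s' t' - H s t - k * ((s' - s) +i* (t' - t)))
    <= e * (`|s' - s| + `|t' - t|).

Definition plane_ccontinuous_at H s t := forall e : R, 0 < e ->
  exists2 d : R, 0 < d & forall s' t', `|s' - s| < d -> `|t' - t| < d ->
    normc (H s' t' - H s t) < e.

Lemma plane_cderiv_continuous H s t k :
  plane_cderiv_at H s t k -> plane_ccontinuous_at H s t.
Proof.
move=> Hk e e0; have [d d0 dP] := Hk _ ltr01.
have M0 : 0 < 1 + normc k by rewrite ltr_pwDl ?normc_ge0.
exists (Num.min d (e / (1 + normc k) / 2)); first by rewrite lt_min d0 !divr_gt0.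
move=> s' t'; rewrite !lt_min => /andP[sd se] /andP[td te].
set v := (s' - s) +i* (t' - t).
have -> : H s' t' - H s t = (H s' t' - H s t - k * v) + k * v by ring.
have nv : normc v <= `|s' - s| + `|t' - t| by exact: ler_normc_ReIm.
apply: le_lt_trans (ler_normcD _ _) _.
apply: le_lt_trans (lerD (dP _ _ sd td) (lexx _)) _.
rewrite normcM; apply: (@le_lt_trans _ _ ((1 + normc k) * (`|s' - s| + `|t' - t|))).
  by rewrite mulrDl lerD2l ler_wpM2l ?normc_ge0.
by rewrite mulrC -ltr_pdivlMr // (splitr (e / _)) ltrD.
Qed.

Definition in_rect a l c m s t := [/\ a <= s, s <= a + l, c <= t & t <= c + m].

(** The two vertical sides of the rectangle with lower left corner (a, c), width l
and height m, up to the factor i; exchanging the variables gives the horizontal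
sides. *)
Definition vertical_sum H a l c m :=
  Cint leb `[c, c + m] (fun t => H (a + l) t - H a t).

(** The integral of H d(s + it) along the boundary, anticlockwise. *)
Definition boundary_integral H a l c m :=
  'i * vertical_sum H a l c m - vertical_sum (fun t s => H s t) c m a l.

Lemma vertical_path_continuous H a l c m s : 0 <= l ->
  (forall s t, in_rect a l c m s t -> plane_ccontinuous_at H s t) ->
  a <= s <= a + l -> forall t, c <= t <= c + m -> path_continuous_at (H s) t.
Proof.
move=> l0 cH /andP[s1 s2] t /andP[t1 t2] e e0.
have [|d d0 dP] := cH s t _ e e0; first by split.
exists d => // t' td; apply: dP => //; by rewrite subrr normr0.
Qed.

Lemma vertical_sum_quarters H a l c m : 0 <= l -> 0 <= m ->
  (forall s t, in_rect a (l + l) c (m + m) s t -> plane_ccontinuous_at H s t) ->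
  vertical_sum H a (l + l) c (m + m) =
  vertical_sum H a l c m + vertical_sum H (a + l) l c m +
  (vertical_sum H a l (c + m) m + vertical_sum H (a + l) l (c + m) m).
Proof.
move=> l0 m0 cH; have ll0 : 0 <= l + l by rewrite addr_ge0.
have vc := vertical_path_continuous ll0 cH.
have mc (b d : R) : measurable (`[b, d] : set (measurableTypeR R)).
  exact: measurable_itv.
have vi (s s' d d' : R) : c <= d -> d' <= c + (m + m) ->
    a <= s <= a + (l + l) -> a <= s' <= a + (l + l) ->
    Cintegrable leb `[d, d'] (fun t => H s' t - H s t).
  move=> cd dm sa sa'; apply: path_continuous_Cintegrable => t /andP[t1 t2].
  by apply: path_continuousB; apply: vc => //;
    rewrite (le_trans cd t1) (le_trans t2 dm).
have al : a <= a + l <= a + (l + l) by lra.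
have aa : a <= a <= a + (l + l) by lra.
have all : a <= a + (l + l) <= a + (l + l) by lra.
rewrite /vertical_sum -!addrA.
have col (d d' : R) : c <= d -> d' <= c + (m + m) ->
    Cint leb `[d, d'] (fun t => H (a + (l + l)) t - H a t) =
    Cint leb `[d, d'] (fun t => H (a + l) t - H a t) +
    Cint leb `[d, d'] (fun t => H (a + (l + l)) t - H (a + l) t).
  move=> cd dm; rewrite -CintD //; try exact: vi.
  by apply: eq_Cint => t _; ring.
rewrite (@Cint_itv_split _ _ c (c + m)); first last.
- by apply: vi => //; lra.
- by lra.
- by lra.
have c1 : c + m <= c + (m + m) by lra.
have c2 : c <= c + m by lra.
by rewrite !col // -!addrA.
Qed.

(** The integrals along the inner sides of the four quarters cancel. *)
Lemma boundary_integral_quarters H a l c m : 0 <= l -> 0 <= m ->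
  (forall s t, in_rect a (l + l) c (m + m) s t -> plane_ccontinuous_at H s t) ->
  boundary_integral H a (l + l) c (m + m) =
  boundary_integral H a l c m + boundary_integral H (a + l) l c m +
  (boundary_integral H a l (c + m) m + boundary_integral H (a + l) l (c + m) m).
Proof.
move=> l0 m0 cH; rewrite /boundary_integral vertical_sum_quarters //.
rewrite (@vertical_sum_quarters (fun t s => H s t)) //; first by ring.
move=> t s [t1 t2 s1 s2] e e0.
have [|d d0 dP] := cH s t _ e e0; first by split.
by exists d => // t' s' td sd; exact: dP.
Qed.

(** The affine part of H contributes its horizontal coefficient p times the area of
the rectangle; applied to both pairs of sides, the contributions cancel when the
vertical coefficient is 'i times the horizontal one. *)
Lemma vertical_sum_affine H a l c m s t p r e : 0 <= l -> 0 <= m ->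
  (forall s t, in_rect a l c m s t -> plane_ccontinuous_at H s t) ->
  (forall s' t', in_rect a l c m s' t' ->
    normc (H s' t' - H s t - (p * (s' - s)%:C + r * (t' - t)%:C)) <= e) ->
  normc (vertical_sum H a l c m - p * (l * m)%:C) <= 2 * e * m.
Proof.
move=> l0 m0 cH He.
have mc (b d : R) : measurable (`[b, d] : set (measurableTypeR R)).
  exact: measurable_itv.
have vc := vertical_path_continuous l0 cH.
have iv : Cintegrable leb `[c, c + m] (fun t => H (a + l) t - H a t).
  by apply: path_continuous_Cintegrable => u uc;
    apply: path_continuousB; apply: vc => //; lra.
have ik : Cintegrable leb `[c, c + m] (fun=> p * l%:C).
  by apply: path_continuous_Cintegrable => u uc e' e'0; exists 1 => // ? _;
    rewrite subrr normc0.
have -> : p * (l * m)%:C = Cint leb `[c, c + m] (fun=> p * l%:C).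
  by rewrite Cint_itv_cst ?lerDl // addrC addKr -mulrA rmorphM.
rewrite -CintB // (_ : 2 * e * m = 2 * e * (c + m - c)); last by ring.
apply: ler_normc_Cint_itv; first by rewrite lerDl.
  exact: CintegrableB.
move=> u /andP[u1 u2].
have -> : H (a + l) u - H a u - p * l%:C =
  (H (a + l) u - H s t - (p * (a + l - s)%:C + r * (u - t)%:C)) -
  (H a u - H s t - (p * (a - s)%:C + r * (u - t)%:C)).
  by rewrite !rmorphB !rmorphD /=; ring.
apply: le_trans (ler_normcB _ _) _; rewrite mulrDl !mul1r.
by apply: lerD; apply: He; split; lra.
Qed.

(** On a small rectangle the affine part of H contributes nothing to the
boundary integral, and the remainder is at most the error times the square of
the perimeter. *)
Lemma boundary_integral_small H a l c m s t k e : 0 <= l -> 0 <= m ->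
  in_rect a l c m s t ->
  (forall s t, in_rect a l c m s t -> plane_ccontinuous_at H s t) ->
  (forall s' t', in_rect a l c m s' t' ->
    normc (H s' t' - H s t - k * ((s' - s) +i* (t' - t)))
    <= e * (`|s' - s| + `|t' - t|)) -> 0 <= e ->
  normc (boundary_integral H a l c m) <= 2 * e * (l + m) ^+ 2.
Proof.
move=> l0 m0 [s1 s2 t1 t2] cH Hk e0.
have Hb s' t' : in_rect a l c m s' t' ->
    normc (H s' t' - H s t - (k * (s' - s)%:C + k * 'i * (t' - t)%:C)) <= e * (l + m).
  move=> r; have -> : k * (s' - s)%:C + k * 'i * (t' - t)%:C =
    k * ((s' - s) +i* (t' - t)).
    by rewrite -mulrA -mulrDr; simpc.
  apply: le_trans (Hk _ _ r) _; apply: ler_wpM2l => //.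
  by case: r => *; apply: lerD; rewrite ler_norml; lra.
have V := vertical_sum_affine l0 m0 cH Hb.
have W : normc (vertical_sum (fun t s => H s t) c m a l - k * 'i * (m * l)%:C)
    <= 2 * (e * (l + m)) * l.
  apply: (@vertical_sum_affine _ _ _ _ _ t s _ k) => //.
    move=> t' s' [? ? ? ?] e' e'0; have [|d d0 dP] := cH s' t' _ e' e'0; first by split.
    by exists d => // t'' s'' td sd; exact: dP.
  by move=> t' s' [? ? ? ?]; rewrite [X in _ - X]addrC; apply: Hb.
rewrite /boundary_integral.
have -> : 'i * vertical_sum H a l c m - vertical_sum (fun t s => H s t) c m a l =
  'i * (vertical_sum H a l c m - k * (l * m)%:C) -
  (vertical_sum (fun t s => H s t) c m a l - k * 'i * (m * l)%:C).
  by rewrite (mulrC m); ring.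
apply: le_trans (ler_normcB _ _) _; rewrite normcM.
have -> : normc ('i : R[i]) = 1 by rewrite /= expr0n expr1n add0r sqrtr1.
rewrite mul1r; have -> : 2 * e * (l + m) ^+ 2 =
  2 * (e * (l + m)) * m + 2 * (e * (l + m)) * l by ring.
exact: lerD.
Qed.

Lemma nested_intervals (u v : nat -> R) : (forall n, 0 <= v n) ->
  (forall n, u n <= u n.+1) -> (forall n, u n.+1 + v n.+1 <= u n + v n) ->
  exists x, forall n, u n <= x <= u n + v n.
Proof.
move=> v0 uS vS.
have ule : {homo u : i j / (i <= j)%N >-> i <= j} by exact/nondecreasing_seqP.
have vle : {homo (fun n => u n + v n) : i j / (i <= j)%N >-> j <= i}.
  exact/nonincreasing_seqP.
have uv i j : u i <= u j + v j.
  have [ij|/ltnW ji] := leqP i j.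
    by rewrite (le_trans (ule _ _ ij)) // lerDl.
  by apply: le_trans (vle _ _ ji); rewrite lerDl.
have ub n : ubound (range u) (u n + v n) by move=> _ [k _ <-]; exact: uv.
exists (sup (range u)) => n; apply/andP; split.
  by apply: ub_le_sup; [exists (u 0%N + v 0%N); exact: ub|exists n].
by apply: ge_sup; [exists (u n), n|exact: ub].
Qed.

(** Quartering the rectangle repeatedly, always keeping a quarter whose
boundary integral is at least a quarter of the preceding one, leads to a point
at which complex differentiability forbids a nonzero integral. *)
Theorem Goursat_rectangle H a l c m : 0 <= l -> 0 <= m ->
  (forall s t, in_rect a l c m s t -> exists k, plane_cderiv_at H s t k) ->
  boundary_integral H a l c m = 0.
Proof.
move=> l0 m0 dH.
have cH s t : in_rect a l c m s t -> plane_ccontinuous_at H s t.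
  by move=> /dH[k]; exact: plane_cderiv_continuous.
pose ln n := l / 2 ^+ n; pose mn n := m / 2 ^+ n.
have half_pow (r : R) n : r / 2 ^+ n = r / 2 ^+ n.+1 + r / 2 ^+ n.+1.
  by rewrite exprS invfM; field; rewrite expf_neq0.
have ln0 n : 0 <= ln n by rewrite divr_ge0 // exprn_ge0.
have mn0 n : 0 <= mn n by rewrite divr_ge0 // exprn_ge0.
have lnS n : ln n = ln n.+1 + ln n.+1 by exact: half_pow.
have mnS n : mn n = mn n.+1 + mn n.+1 by exact: half_pow.
pose B n (x : R * R) := normc (boundary_integral H x.1 (ln n) x.2 (mn n)).
pose q01 n (x : R * R) := (x.1 + ln n.+1, x.2).
pose q10 n (x : R * R) := (x.1, x.2 + mn n.+1).
pose q11 n (x : R * R) := (x.1 + ln n.+1, x.2 + mn n.+1).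
(* the quarters are tried in turn; the last one is taken when the triangle
   inequality leaves no other choice *)
pose step n x := if B n x <= 4 * B n.+1 x then x
  else if B n x <= 4 * B n.+1 (q01 n x) then q01 n x
  else if B n x <= 4 * B n.+1 (q10 n x) then q10 n x else q11 n x.
pose X := fix X n := if n is k.+1 then step k (X k) else (a, c).
have XS n : [\/ X n.+1 = X n, X n.+1 = q01 n (X n), X n.+1 = q10 n (X n)
    | X n.+1 = q11 n (X n)].
  rewrite /= /step; do 3 (case: ifP => _; first by
    [constructor 1|constructor 2|constructor 3]).
  by constructor 4.
have X1 n : (X n).1 <= (X n.+1).1.
  by have := ln0 n.+1; case: (XS n) => ->; rewrite /=; lra.
have X2 n : (X n).2 <= (X n.+1).2.
  by have := mn0 n.+1; case: (XS n) => ->; rewrite /=; lra.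
have X3 n : (X n.+1).1 + ln n.+1 <= (X n).1 + ln n.
  by have := ln0 n.+1; rewrite (lnS n); case: (XS n) => ->; rewrite /=; lra.
have X4 n : (X n.+1).2 + mn n.+1 <= (X n).2 + mn n.
  by have := mn0 n.+1; rewrite (mnS n); case: (XS n) => ->; rewrite /=; lra.
have Xin n s t : in_rect (X n).1 (ln n) (X n).2 (mn n) s t -> in_rect a l c m s t.
  elim: n => [|n IH]; first by rewrite /= /ln /mn expr0 !divr1.
  move=> [s1 s2 t1 t2]; apply: IH.
  by have := X1 n; have := X2 n; have := X3 n; have := X4 n; split; lra.
have BS n : B n (X n) <= 4 * B n.+1 (X n.+1).
  have tri : B n (X n) <= B n.+1 (X n) + B n.+1 (q01 n (X n)) +
      (B n.+1 (q10 n (X n)) + B n.+1 (q11 n (X n))).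
    rewrite {1}/B lnS mnS boundary_integral_quarters //; last first.
      by move=> s t; rewrite -lnS -mnS => /Xin; exact: cH.
    by apply: le_trans (ler_normcD _ _) _; apply: lerD; exact: ler_normcD.
  rewrite [X n.+1]/= /step; case: ifPn => // h1; case: ifPn => // h2.
  by case: ifPn => // h3; move: h1 h2 h3; rewrite -!ltNge; lra.
have B0 n : normc (boundary_integral H a l c m) <= 4 ^+ n * B n (X n).
  elim: n => [|n IH]; first by rewrite expr0 mul1r /B /ln /mn expr0 !divr1.
  apply: le_trans IH _; rewrite exprSr -mulrA ler_wpM2l ?exprn_ge0 //; exact: BS.
have [s sP] := nested_intervals ln0 X1 X3.
have [t tP] := nested_intervals mn0 X2 X4.
have rst n : in_rect (X n).1 (ln n) (X n).2 (mn n) s t.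
  by have /andP[? ?] := sP n; have /andP[? ?] := tP n.
have [k Hk] := dH _ _ (Xin 0%N _ _ (rst 0%N)).
apply: eq0_normc; apply/eqP; rewrite eq_le normc_ge0 andbT; apply/ler_addgt0Pr => e e0.
rewrite add0r; set M := 2 * (l + m) ^+ 2.
have M0 : 0 < M + 1 by rewrite ltr_wpDl // mulr_ge0 // sqr_ge0.
have e'0 : 0 < e / (M + 1) by rewrite divr_gt0.
have [d d0 dP] := Hk _ e'0.
have pow2 : exists n, l + m < d * 2 ^+ n.
  have /cvgrPdist_lt/(_ (d / (l + m + 1))) : (@GRing.exp R 2^-1 n) @[n --> \oo] --> 0.
    by apply: cvg_expr; rewrite ger0_norm // invf_lt1 // ltr1n.
  have lm0 : 0 < l + m + 1 by rewrite ltr_wpDl // addr_ge0.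
  move=> /(_ (divr_gt0 d0 lm0))[n _ /(_ n (leqnn n))] /=.
  rewrite sub0r normrN ger0_norm ?exprn_ge0 ?invr_ge0 // exprVn => h; exists n.
  have p0 : 0 < (2 : R) ^+ n by rewrite exprn_gt0.
  move: h; rewrite ltr_pdivlMr // mulrC ltr_pdivrMr //; apply: lt_trans.
  by rewrite ltrDl.
have [n nP] := pow2.
have p0 : 0 < (2 : R) ^+ n by rewrite exprn_gt0.
have lmd : ln n + mn n < d by rewrite -mulrDl ltr_pdivrMr.
apply: le_trans (B0 n) _.
have : B n (X n) <= 2 * (e / (M + 1)) * (ln n + mn n) ^+ 2.
  apply: (@boundary_integral_small _ _ _ _ _ s t k) => //; last exact: ltW.
    by move=> ? ? /Xin; exact: cH.
  move=> s' t' [? ? ? ?]; have [? ? ? ?] := rst n.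
  have := ln0 n; have := mn0 n.
  by move=> ? ?; apply: dP; rewrite ltr_norml; lra.
have -> : (ln n + mn n) ^+ 2 = (l + m) ^+ 2 / 4 ^+ n.
  rewrite -mulrDl exprMn exprVn -exprM mulnC exprM; congr (_ / _ ^+ _).
  by rewrite -natrX.
move=> h; apply: (@le_trans _ _ (4 ^+ n * (2 * (e / (M + 1)) * ((l + m) ^+ 2 / 4 ^+ n)))).
  by rewrite ler_wpM2l ?exprn_ge0.
have p4 : (4 : R) ^+ n != 0 by rewrite expf_neq0.
have -> : 4 ^+ n * (2 * (e / (M + 1)) * ((l + m) ^+ 2 / 4 ^+ n)) = e * (M / (M + 1)).
  by rewrite /M; field; rewrite p4 gt_eqF.
by rewrite ler_piMr ?ltW // ltr_pdivrMr // mul1r ltrDl.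
Qed.

End Goursat.

(** * Translation invariance of Lebesgue measure *)

Section Translation.
Context {R : realType}.
Local Notation leb := (@lebesgue_measure R).

Definition translate (c : R) (x : measurableTypeR R) : measurableTypeR R := x + c.

Lemma measurable_translate c : measurable_fun setT (translate c).
Proof. by apply: measurable_funD => //; exact: measurable_cst. Qed.

(** Lebesgue measure is determined by its values on half-open intervals. *)
Lemma lebesgue_measure_translate c (A : set (measurableTypeR R)) :
  measurable A -> pushforward leb (translate c) A = leb A.
Proof.
move=> mA; apply/esym/lebesgue_measure_unique => //=.
  exact: measurable_translate.
move=> mt _ [[a b]] _ <-; rewrite /pushforward /=.
have -> : translate c @^-1` `]a, b] = `](a - c), (b - c)]%classic.
  by apply/seteqP; split=> x /=; rewrite !in_itv /= ltrBlDr lerBrDr.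
rewrite !lebesgue_measure_itv /= !lte_fin ltrD2r -!EFinB.
by case: ifP => // _; congr _%:E; ring.
Qed.

Lemma ge0_integral_translate c (f : measurableTypeR R -> \bar R) :
  measurable_fun setT f -> (forall x, 0 <= f x)%E ->
  (\int[leb]_x f (translate c x) = \int[leb]_x f x)%E.
Proof.
move=> mf f0; transitivity (\int[pushforward leb (translate c)]_x f x)%E.
  by rewrite ge0_integral_pushforward //; exact: measurable_translate.
apply: eq_measure_integral => [|mt A mA _]; first exact: measurable_translate.
exact: lebesgue_measure_translate.
Qed.

Lemma Rintegral_translate c (D : set (measurableTypeR R)) (f : R -> R) :
  measurable D -> measurable_fun setT f ->
  leb.-integrable (translate c @^-1` D) (EFin \o (fun x => f (x + c))) ->
  \int[leb]_(x in translate c @^-1` D) f (x + c) = \int[leb]_(x in D) f x.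
Proof.
move=> mD mf fi; rewrite /Rintegral; congr fine.
transitivity (\int[pushforward leb (translate c)]_(x in D) (f x)%:E)%E.
  rewrite (@integral_pushforward _ _ _ _ _ (translate c)) //.
  - exact: measurable_translate.
  - exact/measurable_EFinP.
apply: eq_measure_integral => [|mt A mA _]; first exact: measurable_translate.
exact: lebesgue_measure_translate.
Qed.

End Translation.

(** * Circle integrals on annuli *)

Section PolarCoordinates.
Context {R : realType}.
Implicit Types (s t : R).

Lemma derive_bound (f : R -> R) (x l : R) : is_derive x 1 f l ->
  forall e : R, 0 < e -> exists2 d : R, 0 < d &
    forall y, `|y - x| < d -> `|f y - f x - l * (y - x)| <= e * `|y - x|.
Proof.
move=> [df <-] e e0.
move/cvgrPdist_lt : df => /(_ _ e0)[d /= d0 dP]; exists d => // y yd.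
have [->|yx] := eqVneq y x; first by rewrite !subrr mulr0 subr0 normr0 mulr0.
have yx0 : y - x != 0 by rewrite subr_eq0.
have := dP (y - x); rewrite /= sub0r normrN => /(_ yd yx0).
rewrite /shift /= [_ *: 1]mulr1 subrK => /ltW.
rewrite -(@ler_pM2r _ `|y - x|) ?normr_gt0 // -normrM.
move=> h; apply: le_trans h; rewrite -normrN le_eqVlt; apply/orP; left.
apply/eqP; congr `|_|; set z := y - x; set u := f y - f x.
rewrite [RHS](_ : _ = ('D_1 f x - z^-1 * u) * z) //.
by rewrite mulrBl mulrAC mulVf // mul1r opprB.
Qed.

(** The complex exponential, as a function of the real and imaginary parts. *)
Definition polar s t : R[i] := (expR s)%:C * cis t.

Lemma polarD s t s' t' : polar (s + s') (t + t') = polar s t * polar s' t'.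
Proof. by rewrite /polar expRD cisD rmorphM /= mulrACA. Qed.

Lemma normc_polar s t : normc (polar s t) = expR s.
Proof. by rewrite normc_mul_cis normc_real ger0_norm ?expR_ge0. Qed.

Lemma polar_cderiv0 : plane_cderiv_at polar 0 0 1.
Proof.
move=> e e0; have e4 : 0 < e / 8 by rewrite divr_gt0.
have [dx dx0 dxP] := derive_bound (is_derive_expR 0) e4.
have [ds ds0 dsP] := derive_bound (is_derive_sin 0) e4.
have [dc dc0 dcP] := derive_bound (is_derive_cos 0) e4.
have [d1 d10 d1P] := derive_bound (is_derive_expR 0) ltr01.
exists (Num.min (Num.min dx ds) (Num.min (Num.min dc d1) (Num.min (e / 8) (1 / 2)))).
  by rewrite !lt_min dx0 ds0 dc0 d10 !divr_gt0.
move=> x y; rewrite !subr0 !lt_min => /andP[/andP[x1 _] /andP[/andP[_ x3] /andP[x4 x5]]].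
move=> /andP[/andP[_ y2] /andP[/andP[y3 _] _]].
have Hx : `|expR x - 1 - x| <= e / 8 * `|x|.
  by have := dxP x; rewrite !subr0 expR0 mul1r; apply.
have Hx1 : `|expR x - 1 - x| <= `|x|.
  by have := d1P x; rewrite !subr0 expR0 !mul1r; apply.
have Hs : `|sin y - y| <= e / 8 * `|y|.
  by have := dsP y; rewrite sin0 cos0 mul1r !subr0; apply.
have Hc : `|cos y - 1| <= e / 8 * `|y|.
  by have := dcP y; rewrite sin0 cos0 oppr0 mul0r !subr0 !addr0; apply.
have ex1 : `|expR x - 1| <= e / 4.
  have -> : expR x - 1 = (expR x - 1 - x) + x by ring.
  by apply: le_trans (ler_normD _ _) _; lra.
have ex2 : `|expR x| <= 2.
  have -> : expR x = (expR x - 1 - x) + x + 1 by ring.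
  apply: le_trans (ler_normD _ _) _; rewrite normr1.
  by have := ler_normD (expR x - 1 - x) x; lra.
rewrite /polar expR0 cis0 mulr1 mul1r.
apply: le_trans (ler_normc_ReIm _) _.
rewrite Re_add Im_add Re_add Im_add Re_opp Im_opp Re_opp Im_opp Re_mul Im_mul /=.
have -> : expR x * cos y - 0 * sin y - 1 - x
    = expR x * (cos y - 1) + (expR x - 1 - x) by ring.
have -> : expR x * sin y + 0 * cos y - 0 - y
    = expR x * (sin y - y) + (expR x - 1) * y by ring.
have b1 : `|expR x * (cos y - 1)| <= 2 * (e / 8 * `|y|).
  by rewrite normrM ler_pM.
have b2 : `|expR x * (sin y - y)| <= 2 * (e / 8 * `|y|).
  by rewrite normrM ler_pM.
have b3 : `|(expR x - 1) * y| <= e / 4 * `|y|.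
  by rewrite normrM ler_wpM2r.
have := ler_normD (expR x * (cos y - 1)) (expR x - 1 - x).
have := ler_normD (expR x * (sin y - y)) ((expR x - 1) * y).
have : 0 <= e * `|x| by rewrite mulr_ge0 // ltW.
have : 0 <= e * `|y| by rewrite mulr_ge0 // ltW.
by lra.
Qed.

Lemma polar_cderiv s t (w : R[i]) :
  plane_cderiv_at (fun s t => w * polar s t) s t (w * polar s t).
Proof.
move=> e e0; set E := w * polar s t.
have M0 : 0 < 1 + normc E by rewrite ltr_pwDl ?normc_ge0.
have [d d0 dP] := polar_cderiv0 (divr_gt0 e0 M0); exists d => // s' t' sd td.
have := dP (s' - s) (t' - t); rewrite !subr0 => /(_ sd td).
have -> : polar s' t' = polar s t * polar (s' - s) (t' - t).
  by rewrite -polarD !(addrC s) !(addrC t) !subrK.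
have -> : polar 0 0 = 1 by rewrite /polar expR0 cis0 mulr1.
rewrite mul1r; set v := _ +i* _; set u := polar (_ - _) _ => h.
have -> : w * (polar s t * u) - E - E * v = E * (u - 1 - v).
  by rewrite /E; ring.
rewrite normcM; apply: le_trans (ler_wpM2l (normc_ge0 _) h) _.
rewrite mulrA ler_wpM2r ?addr_ge0 // mulrA ler_pdivrMr // mulrC.
by rewrite ler_wpM2l ?ltW // ltrDr.
Qed.

(** The chain rule that turns complex differentiability of h into that of h in
logarithmic polar coordinates. *)
Lemma plane_cderiv_comp (h : R[i] -> R[i]) (Z : R -> R -> R[i]) s t k l :
  plane_cderiv_at Z s t k -> cderiv_at h (Z s t) l ->
  plane_cderiv_at (fun s t => h (Z s t)) s t (l * k).
Proof.
move=> Zk hl e e0.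
have k0 : 0 < 1 + normc k by rewrite ltr_pwDl ?normc_ge0.
have l0 : 0 < 1 + normc l by rewrite ltr_pwDl ?normc_ge0.
have e1 : 0 < e / 2 / (1 + normc k) by rewrite !divr_gt0.
have e2 : 0 < e / 2 / (1 + normc l) by rewrite !divr_gt0.
have [dh dh0 dhP] := hl _ e1; have [dZ dZ0 dZP] := Zk _ e2.
have [d1 d10 d1P] := Zk _ ltr01.
have [dc dc0 dcP] := plane_cderiv_continuous Zk dh0.
exists (Num.min (Num.min dZ d1) dc); first by rewrite !lt_min dZ0 d10 dc0.
move=> s' t'; rewrite !lt_min => /andP[/andP[sZ s1] sc] /andP[/andP[tZ t1] tc].
set v := _ +i* _; set r := `|s' - s| + `|t' - t|.
have r0 : 0 <= r by rewrite addr_ge0.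
have nv : normc v <= r by exact: ler_normc_ReIm.
have Zr : normc (Z s' t' - Z s t) <= (1 + normc k) * r.
  have -> : Z s' t' - Z s t = (Z s' t' - Z s t - k * v) + k * v by ring.
  apply: le_trans (ler_normcD _ _) _; rewrite mulrDl.
  by apply: lerD; [exact: d1P|rewrite normcM ler_wpM2l ?normc_ge0].
have -> : h (Z s' t') - h (Z s t) - l * k * v =
  (h (Z s' t') - h (Z s t) - l * (Z s' t' - Z s t)) +
  l * (Z s' t' - Z s t - k * v) by ring.
apply: le_trans (ler_normcD _ _) _; rewrite (splitr e) mulrDl; apply: lerD.
  apply: le_trans (dhP _ (dcP _ _ sc tc)) _.
  apply: le_trans (ler_wpM2l (ltW e1) Zr) _.
  by rewrite mulrA divfK ?gt_eqF.
rewrite normcM; apply: le_trans (ler_wpM2l (normc_ge0 _) (dZP _ _ sZ tZ)) _.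
rewrite -/r mulrA ler_wpM2r // mulrA ler_pdivrMr // mulrC.
by rewrite ler_wpM2l ?divr_ge0 ?ltW // ltrDr.
Qed.

End PolarCoordinates.

Section CircleMeans.
Context {R : realType}.
Local Notation leb := (@lebesgue_measure R).
Implicit Types (h : R[i] -> R[i]) (z w : R[i]) (r : R).

(** 2 pi times the mean of h over the circle through w centred at 0. *)
Definition circle_int h w := Cint leb `[- pi, pi] (fun t => h (w * cis t)).

Lemma circle_path_continuous h w :
  (forall z, normc z = normc w -> ccontinuous_at h z) ->
  forall t, path_continuous_at (fun t => h (w * cis t)) t.
Proof.
move=> ch t e e0; have [|d d0 dP] := ch (w * cis t) _ _ e0.
  exact: normc_mul_cis.
have [d' d'0 d'P] := plane_cderiv_continuous (@polar_cderiv _ 0 t w) d0.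
exists d' => // t' td; apply: dP; have := d'P 0 t'.
by rewrite subrr normr0 => /(_ d'0 td); rewrite /polar expR0 !mul1r.
Qed.

Lemma circle_Cintegrable h w :
  (forall z, normc z = normc w -> ccontinuous_at h z) ->
  forall a b, Cintegrable leb `[a, b] (fun t => h (w * cis t)).
Proof.
move=> ch a b; apply: path_continuous_Cintegrable => t _.
exact: circle_path_continuous.
Qed.

Lemma Cint_translate (F : R -> R[i]) (c a b : R) :
  (forall t, path_continuous_at F t) ->
  Cint leb `[a, b] (fun t => F (t + c)) = Cint leb `[a + c, b + c] F.
Proof.
move=> cF.
have cFc t : path_continuous_at (fun t => F (t + c)) t.
  move=> e e0; have [d d0 dP] := cF (t + c) _ e0; exists d => // t' td.
  by apply: dP; rewrite opprD addrACA subrr addr0.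
have [i1 i2] : Cintegrable leb `[a, b] (fun t => F (t + c)).
  by apply: path_continuous_Cintegrable.
have pre : translate c @^-1` `[a + c, b + c] = `[a, b]%classic.
  by apply/seteqP; split=> x /=; rewrite !in_itv /= /translate !lerD2r.
have mc : measurable (`[a + c, b + c] : set (measurableTypeR R)).
  exact: measurable_itv.
have tr (p : R[i] -> R) : (forall t, {for t, continuous (fun t => p (F t))}) ->
    leb.-integrable `[a, b] (EFin \o (fun t => p (F (t + c)))) ->
    \int[leb]_(t in `[a, b]) p (F (t + c)) = \int[leb]_(t in `[a + c, b + c]) p (F t).
  move=> cp ip; have mp : measurable_fun setT (fun t => p (F t)).
    exact: continuous_measurable_fun.
  by rewrite -(@Rintegral_translate _ c _ _ mc mp) pre.
rewrite /Cint; congr (_ +i* _).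
- by apply: (tr (@complex.Re R)) => // t; exact: path_continuous_Re.
- by apply: (tr (@complex.Im R)) => // t; exact: path_continuous_Im.
Qed.

Lemma Cint_periodic_shift (F : R -> R[i]) (c : R) :
  (forall t, path_continuous_at F t) -> (forall t, F (t + pi *+ 2) = F t) ->
  `|c| <= pi ->
  Cint leb `[- pi, pi] (fun t => F (t + c)) = Cint leb `[- pi, pi] F.
Proof.
move=> cF pF; rewrite ler_norml => /andP[c1 c2].
have pi2 : - pi + pi *+ 2 = pi :> R by rewrite mulr2n; ring.
have iF a b : Cintegrable leb `[a, b] F by apply: path_continuous_Cintegrable.
have shift a b : Cint leb `[a + pi *+ 2, b + pi *+ 2] F = Cint leb `[a, b] F.
  by rewrite -Cint_translate //; apply: eq_Cint => t _; exact: pF.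
have J a b : a <= b -> b <= a + pi *+ 2 ->
    Cint leb `[a, a + pi *+ 2] F = Cint leb `[b, b + pi *+ 2] F.
  move=> ab ba; rewrite (@Cint_itv_split _ _ a b) // -(shift a b) addrC.
  rewrite -Cint_itv_split ?lerD2r //.
rewrite Cint_translate //.
have -> : pi + c = - pi + c + pi *+ 2 by rewrite -[in LHS]pi2 [LHS]addrAC.
transitivity (Cint leb `[- pi, - pi + pi *+ 2] F); last by rewrite pi2.
have p2 : pi *+ 2 = pi + pi :> R by rewrite mulr2n.
have [c0|c0] := leP 0 c; last first.
  by apply: J; rewrite ?p2; lra.
by apply/esym/J; rewrite ?p2; lra.
Qed.

(** In logarithmic coordinates circles become vertical segments of height 2 pi.
For the rectangle between two of them the horizontal sides cancel by
periodicity, and Goursat's theorem equates the vertical ones. *)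
Lemma circle_int_radial h w (r1 r2 S : R) :
  holomorphic_on [set z | r1 < normc z < r2] h ->
  r1 < normc w -> 0 <= S -> normc w * expR S < r2 ->
  circle_int h (w * (expR S)%:C) = circle_int h w.
Proof.
move=> hh w1 S0 w2; pose H s t := h (w * polar s t).
have pi2 : 0 <= pi + pi :> R by rewrite addr_ge0 ?pi_ge0.
have dHs s t : 0 <= s <= S -> exists k, plane_cderiv_at H s t k.
  move=> /andP[s0 sS]; have [] := @derivable_cderiv _ h (w * polar s t).
    apply: hh => /=; rewrite normcM normc_polar; apply/andP; split.
      by apply: lt_le_trans w1 _; rewrite ler_peMr ?normc_ge0 // -expR0 ler_expR.
    by apply: le_lt_trans w2; rewrite ler_wpM2l ?normc_ge0 // ler_expR.
  by move=> l hl; exists (l * (w * polar s t)); apply: plane_cderiv_comp => //;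
    exact: polar_cderiv.
have dH s t : in_rect 0 S (- pi) (pi + pi) s t -> exists k, plane_cderiv_at H s t k.
  by rewrite /in_rect add0r => -[s0 sS _ _]; apply: dHs; rewrite s0.
have := Goursat_rectangle S0 pi2 dH; rewrite /boundary_integral.
have -> : vertical_sum (fun t s => H s t) (- pi) (pi + pi) 0 S = 0.
  rewrite /vertical_sum -[RHS](@Cint0 _ _ _ leb `[0, 0 + S]); last first.
    exact: measurable_itv.
  apply: eq_Cint => s _; rewrite /H /polar addrA addNr add0r.
  have -> : cis (- pi) = cis pi :> R[i].
    by rewrite -[LHS]cis2pi mulr2n addrA addNr add0r.
  by rewrite subrr.
move=> /eqP; rewrite subr0 mulf_eq0 => /orP[/eqP i0|].
  by have := congr1 (@complex.Im R) i0; rewrite /= => /eqP; rewrite oner_eq0.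
rewrite /vertical_sum add0r addrA addNr add0r.
have cH s : 0 <= s <= S -> forall t, path_continuous_at (H s) t.
  move=> sS t e e0; have [k Hk] := dHs s t sS.
  have [d d0 dP] := plane_cderiv_continuous Hk e0.
  by exists d => // t' td; apply: dP; rewrite ?subrr ?normr0.
rewrite CintB; try exact: measurable_itv; last 2 first.
- by apply: path_continuous_Cintegrable => t _; apply: cH; rewrite lexx S0.
- by apply: path_continuous_Cintegrable => t _; apply: cH; rewrite lexx S0.
rewrite subr_eq0 => /eqP HH; rewrite /circle_int; transitivity
  (Cint leb `[- pi, pi] (fun t => H S t)).
  by apply: eq_Cint => t _; rewrite /H /polar mulrA.
by rewrite HH; apply: eq_Cint => t _; rewrite /H /polar expR0 mul1r.
Qed.

(** Periodicity makes the integral independent of the point at which the circle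
starts, so that only the radial displacement matters. *)
Theorem circle_int_annulus h (r1 r2 : R) z w : 0 <= r1 ->
  holomorphic_on [set z | r1 < normc z < r2] h ->
  r1 < normc z < r2 -> r1 < normc w < r2 -> circle_int h z = circle_int h w.
Proof.
move=> r10 hh zr wr.
have ch z' : r1 < normc z' < r2 -> ccontinuous_at h z'.
  by move=> zr'; apply: (holomorphic_ccontinuous hh).
have rot z' : r1 < normc z' < r2 -> circle_int h z' = circle_int h (normc z')%:C.
  move=> zr'; have [t tpi zt] := polar_form z'; rewrite /circle_int.
  transitivity (Cint leb `[- pi, pi] (fun t' => h ((normc z')%:C * cis (t' + t)))).
    apply: eq_Cint => t' _; rewrite [in LHS]zt -mulrA -cisD addrC //.
  rewrite (@Cint_periodic_shift (fun t => h ((normc z')%:C * cis t))) //.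
    move=> t'; apply: circle_path_continuous => z'' e; apply: ch; rewrite e.
    by rewrite normc_real ger0_norm ?normc_ge0.
  by move=> t'; rewrite cis2pi.
rewrite (rot z) // (rot w) //; move: zr wr.
have : forall x y : R, r1 < x < r2 -> r1 < y < r2 -> x <= y ->
    circle_int h x%:C = circle_int h y%:C.
  move=> x y /andP[x1 x2] /andP[y1 y2] xy.
  have x0 : 0 < x by exact: le_lt_trans x1.
  have y0 : 0 < y by exact: le_lt_trans y1.
  have E : x * expR (ln (y / x)) = y.
    by rewrite lnK ?posrE ?divr_gt0 // mulrC divfK ?gt_eqF.
  have nx : normc (x%:C : R[i]) = x by rewrite normc_real gtr0_norm.
  rewrite -[in RHS]E rmorphM; apply/esym/(circle_int_radial hh).
  - by rewrite nx.
  - by rewrite ln_ge0 // ler_pdivlMr // mul1r.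
  - by rewrite nx E.
move=> mono zr wr; have [zw|/ltW wz] := leP (normc z) (normc w).
  exact: mono.
by apply/esym/mono.
Qed.

End CircleMeans.

(** * Rotation invariance of the area *)

Section Rotation.
Context {R : realType}.
Local Notation leb := (@lebesgue_measure R).
Local Notation leb2 := (leb \x leb)%E.

(** A constant for the product measure, which can carry the sigma-finiteness
needed to take its product with the measure of the angles. *)
Definition lebesgue_plane : set (plane R) -> \bar R := leb2.

HB.instance Definition _ := Measure.on lebesgue_plane.

Let lebesgue_plane_sigma_finite : sigma_finite [set: plane R] leb2.
Proof.
pose I (n : nat) : set (measurableTypeR R) := `[- n%:R, n%:R]%classic.
have mI n : measurable (I n) by exact: measurable_itv.
have I_fin n : (leb (I n) < +oo)%E.
  by rewrite /I lebesgue_measure_itv /=; case: ifP => _; rewrite ?ltry.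
exists (fun n => I n `*` I n) => [|n].
  apply/seteqP; split=> // -[x y] _; exists (Num.truncn (`|x| + `|y|)).+1 => //.
  have := truncnS_gt (`|x| + `|y|); set n := _.+1 => xy.
  by split; rewrite /I /= in_itv /= -ler_norml; apply: ltW; apply: le_lt_trans xy;
    rewrite (lerDl, lerDr).
split; first exact: measurableX.
rewrite [X in (X < _)%E](_ : _ = (leb (I n) * leb (I n))%E).
  by rewrite lte_mul_pinfty // ge0_fin_numE.
exact: product_measure1E.
Qed.

HB.instance Definition _ := Measure_isSigmaFinite.Build _ _ _ lebesgue_plane
  lebesgue_plane_sigma_finite.

Definition shear1 (c : R) (v : plane R) : plane R := (v.1 + c * v.2, v.2).
Definition shear2 (c : R) (v : plane R) : plane R := (v.1, v.2 + c * v.1).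
Definition rotation (t : R) (v : plane R) : plane R :=
  (cos t * v.1 - sin t * v.2, sin t * v.1 + cos t * v.2).

Lemma to_complex_rotation t v : to_complex (rotation t v) = cis t * to_complex v.
Proof. by case: v => x y; congr (_ +i* _); rewrite addrC. Qed.

Lemma measurable_shear1 c : measurable_fun setT (shear1 c).
Proof.
apply: measurable_fun_pair; last exact: measurable_snd.
apply: measurable_funD; first exact: measurable_fst.
by apply: measurable_funM => //; exact: measurable_snd.
Qed.

Lemma measurable_shear2 c : measurable_fun setT (shear2 c).
Proof.
apply: measurable_fun_pair; first exact: measurable_fst.
apply: measurable_funD; first exact: measurable_snd.
by apply: measurable_funM => //; exact: measurable_fst.
Qed.

Lemma ge0_integral_shear1 c (f : plane R -> \bar R) :
  measurable_fun setT f -> (forall v, 0 <= f v)%E ->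
  (\int[leb2]_v f (shear1 c v) = \int[leb2]_v f v)%E.
Proof.
move=> mf f0.
rewrite fubini_tonelli2 //; last exact: measurableT_comp mf (measurable_shear1 c).
rewrite [RHS]fubini_tonelli2 //; apply: eq_integral => y _; rewrite /fubini_G.
by apply: (@ge0_integral_translate _ (c * y) (fun x => f (x, y))) => //;
  exact: measurable_fun_pair1.
Qed.

Lemma ge0_integral_shear2 c (f : plane R -> \bar R) :
  measurable_fun setT f -> (forall v, 0 <= f v)%E ->
  (\int[leb2]_v f (shear2 c v) = \int[leb2]_v f v)%E.
Proof.
move=> mf f0.
rewrite fubini_tonelli1 //; last exact: measurableT_comp mf (measurable_shear2 c).
rewrite [RHS]fubini_tonelli1 //; apply: eq_integral => x _; rewrite /fubini_F.
by apply: (@ge0_integral_translate _ (c * x) (fun y => f (x, y))) => //;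
  exact: measurable_fun_pair2.
Qed.

Lemma measurable_rotation t : measurable_fun setT (rotation t).
Proof.
apply: measurable_fun_pair.
  by apply: measurable_funB; apply: measurable_funM.
by apply: measurable_funD; apply: measurable_funM.
Qed.

(** Shears preserve area by Fubini and the translation invariance of the line;
this factorisation transfers the invariance to rotations. *)
Lemma rotation_shears t v : cos t != -1 ->
  rotation t v = shear1 (- (sin t / (1 + cos t)))
    (shear2 (sin t) (shear1 (- (sin t / (1 + cos t))) v)).
Proof.
move=> ct; have c0 : 1 + cos t != 0 by rewrite addrC addr_eq0.
rewrite /rotation /shear1 /shear2 /=.
have s2 : sin t ^+ 2 = (1 + cos t) * (1 - cos t).
  by rewrite sin2cos2; ring.
have E : v.2 + sin t * (v.1 + - (sin t / (1 + cos t)) * v.2) =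
    sin t * v.1 + cos t * v.2.
  have -> : v.2 + sin t * (v.1 + - (sin t / (1 + cos t)) * v.2) =
    sin t * v.1 + (1 - sin t ^+ 2 / (1 + cos t)) * v.2 by field.
  by rewrite s2 mulrAC divff // mul1r subKr.
congr (_, _); last by rewrite E.
rewrite E.
have -> : v.1 + - (sin t / (1 + cos t)) * v.2 +
   - (sin t / (1 + cos t)) * (sin t * v.1 + cos t * v.2) =
   (1 - sin t ^+ 2 / (1 + cos t)) * v.1 - sin t * v.2 by field.
by rewrite s2 mulrAC divff // mul1r subKr.
Qed.

Lemma ge0_integral_rotation t (f : plane R -> \bar R) :
  measurable_fun setT f -> (forall v, 0 <= f v)%E ->
  (\int[leb2]_v f (rotation t v) = \int[leb2]_v f v)%E.
Proof.
have direct u (g : plane R -> \bar R) : cos u != -1 -> measurable_fun setT g ->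
    (forall v, 0 <= g v)%E ->
    (\int[leb2]_v g (rotation u v) = \int[leb2]_v g v)%E.
  move=> cu mg g0; set b := - (sin u / (1 + cos u)).
  have m1 := measurable_shear1 b; have m2 := measurable_shear2 (sin u).
  under eq_integral do rewrite rotation_shears // -/b.
  rewrite (@ge0_integral_shear1 b (fun v => g (shear1 b (shear2 (sin u) v)))) //.
  - rewrite (@ge0_integral_shear2 (sin u) (fun v => g (shear1 b v))) //.
    + exact: ge0_integral_shear1.
    + exact: (measurableT_comp mg m1).
  - exact: (measurableT_comp (measurableT_comp mg m1) m2).
move=> mf f0; have [ct|] := eqVneq (cos t) (-1); last by move=> ct; exact: direct.
(* the angle pi is reached in two equal steps *)
have ch : cos (t / 2) != -1.
  apply/eqP => ch; have := cos_mulr2n (t / 2).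
  rewrite [X in cos X](_ : _ = t) ?ct ?ch; last by rewrite mulr2n -splitr.
  by move=> /eqP; rewrite sqrrN expr1n mulr2n; lra.
have rr v : rotation t v = rotation (t / 2) (rotation (t / 2) v).
  have E : to_complex (rotation t v) =
      to_complex (rotation (t / 2) (rotation (t / 2) v)).
    by rewrite !to_complex_rotation mulrA -cisD -splitr.
  by case: E; rewrite /rotation /= => -> ->.
under eq_integral do rewrite rr.
rewrite (direct _ (fun v => f (rotation (t / 2) v))) //; first exact: direct.
exact: (measurableT_comp mf (measurable_rotation _)).
Qed.

Lemma measurable_rotation2 :
  measurable_fun setT (fun x : plane R * measurableTypeR R => rotation x.2 x.1).
Proof.
have m1 : measurable_fun setT (fun x : plane R * measurableTypeR R => x.1.1).
  exact: (measurableT_comp measurable_fst measurable_fst).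
have m2 : measurable_fun setT (fun x : plane R * measurableTypeR R => x.1.2).
  exact: (measurableT_comp measurable_snd measurable_fst).
have mc : measurable_fun setT (fun x : plane R * measurableTypeR R => cos x.2).
  apply: (measurableT_comp _ measurable_snd).
  by apply: continuous_measurable_fun; exact: continuous_cos.
have ms : measurable_fun setT (fun x : plane R * measurableTypeR R => sin x.2).
  apply: (measurableT_comp _ measurable_snd).
  by apply: continuous_measurable_fun; exact: continuous_sin.
apply: measurable_fun_pair.
  by apply: measurable_funB; exact: measurable_funM.
by apply: measurable_funD; exact: measurable_funM.
Qed.

(** Every rotation preserves the integral of f; averaging over the angles and
exchanging the two integrals gives the length 2 pi of the interval of angles. *)
Lemma integral_rotation_average (f phi : plane R -> R) :
  lebesgue_plane.-integrable setT (EFin \o f) ->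
  (forall v, leb.-integrable `[- pi, pi] (EFin \o (fun t => f (rotation t v))) /\
     \int[leb]_(t in `[- pi, pi]) f (rotation t v) = phi v) ->
  lebesgue_plane.-integrable setT (EFin \o phi) /\
  \int[lebesgue_plane]_v phi v = pi *+ 2 * \int[lebesgue_plane]_v f v.
Proof.
move=> fi fphi; set I : set (measurableTypeR R) := `[- pi, pi]%classic.
have mI : measurable I by exact: measurable_itv.
have mf : measurable_fun setT f by apply: integrableR_measurable fi.
have mfr t : measurable_fun setT (fun v => f (rotation t v)).
  exact: (measurableT_comp mf (measurable_rotation t)).
pose g (x : plane R * measurableTypeR R) : \bar R :=
  (f (rotation x.2 x.1) * \1_I x.2)%:E.
have mg : measurable_fun setT g.
  apply/measurable_EFinP/measurable_funM.
    exact: (measurableT_comp mf measurable_rotation2).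
  by apply: (measurableT_comp _ measurable_snd); exact: measurable_indic.
have lebI : leb I = (pi *+ 2)%:E.
  rewrite /I lebesgue_measure_itv /= lte_fin gtrN ?pi_gt0 //.
  by rewrite -EFinB opprK mulr2n.
have fl : (\int[lebesgue_plane]_v `|(f v)%:E| < +oo)%E by case/integrableP: fi.
have slice t : (\int[lebesgue_plane]_v `|g (v, t)| = \int[lebesgue_plane]_v `|(f v)%:E| * (\1_I t)%:E)%E.
  rewrite -[in RHS](@ge0_integral_rotation t (fun v => `|(f v)%:E|)%E) //; last first.
    by apply: measurableT_comp => //; exact/measurable_EFinP.
  rewrite -ge0_integralZr ?lee_fin ?indicE //=.
  - apply: eq_integral => v _; rewrite /g /= normrM EFinM indicE.
    by congr (_ * _)%E; case: (_ \in _); rewrite ?normr1 ?normr0.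
  - by apply/measurable_EFinP; apply: measurableT_comp => //; exact: mfr.
have gi : (lebesgue_plane \x leb)%E.-integrable setT g.
  have [_] := @integrable21ltyP _ _ _ _ R lebesgue_plane leb g mg; apply.
  under eq_integral do rewrite slice.
  rewrite ge0_integralZl //.
  - rewrite integral_indic // setIT [X in (_ * X)%E](_ : _ = (pi *+ 2)%:E) //.
    apply: lte_mul_pinfty; [exact: integral_ge0| |exact: ltry].
    by rewrite ge0_fin_numE //; exact: integral_ge0.
  - exact/measurable_EFinP/measurable_indic.
  - by apply: integral_ge0.
have F v : fubini_F leb g v = (phi v)%:E.
  have [f1 <-] := fphi v; rewrite /fubini_F /Rintegral fineK; last first.
    exact: integrable_fin_num.
  rewrite [RHS]integral_mkcond; apply: eq_integral => t _.
  by rewrite /g /patch indicE; case: (_ \in _); rewrite ?mulr1 ?mulr0.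
have G t : fubini_G lebesgue_plane g t = ((\int[lebesgue_plane]_v f v) * \1_I t)%:E.
  rewrite /fubini_G /g EFinM; under eq_integral do rewrite EFinM /=.
  have frt : lebesgue_plane.-integrable setT (EFin \o (fun v => f (rotation t v))).
    apply/integrableP; split; first exact/measurable_EFinP.
    by rewrite (@ge0_integral_rotation t (fun v => `|(f v)%:E|)%E) //;
      apply: measurableT_comp => //; exact/measurable_EFinP.
  rewrite integralZr //; congr (_ * _)%E.
  rewrite /Rintegral fineK; last exact: integrable_fin_num.
  rewrite integralE [RHS]integralE; congr (_ - _)%E.
    have mp : measurable_fun setT (EFin \o f)^\+%E.
      by apply: measurable_funepos; exact/measurable_EFinP.
    rewrite -[RHS](@ge0_integral_rotation t _ mp) //.
    by apply: eq_integral => v _; rewrite !unlock.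
  have mn : measurable_fun setT (EFin \o f)^\-%E.
    by apply: measurable_funeneg; exact/measurable_EFinP.
  rewrite -[RHS](@ge0_integral_rotation t _ mn) //.
  by apply: eq_integral => v _; rewrite !unlock.
have iF := integrable_fubini_F gi.
split; first by apply: eq_integrable iF => // v _; rewrite F.
rewrite {1}/Rintegral.
have -> : (\int[lebesgue_plane]_v (phi v)%:E = \int[leb]_t fubini_G lebesgue_plane g t)%E.
  rewrite integral21_prod_meas1 // -integral12_prod_meas1 //.
  by apply: eq_integral => v _; rewrite F.
under eq_integral do rewrite G EFinM.
rewrite integralZl //; last exact: integrable_indic_itv.
by rewrite integral_indic // setIT [X in (_ * X)%E](_ : _ = (pi *+ 2)%:E) // -EFinM mulrC.
Qed.

End Rotation.

(** * Measurability on the plane, densities *)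

Section PlaneMeasurability.
Context {R : realType}.
Implicit Types (U : set R[i]) (F : R[i] -> R[i]).

(** An open set is the union of the rational squares that it contains. *)
Lemma measurable_copen U : copen U -> measurable (to_complex @^-1` U : set (plane R)).
Proof.
move=> oU.
pose box (x : rat * rat * nat) : set (plane R) :=
  [set` `](ratr x.1.1 - x.2.+1%:R^-1), (ratr x.1.1 + x.2.+1%:R^-1)[ ] `*`
  [set` `](ratr x.1.2 - x.2.+1%:R^-1), (ratr x.1.2 + x.2.+1%:R^-1)[ ].
pose B x := if pselect (box x `<=` to_complex @^-1` U) then box x else set0.
have mB x : measurable (B x).
  rewrite /B; case: pselect => //= bU.
  by apply: measurableX; exact: measurable_itv.
rewrite (_ : _ @^-1` U = \bigcup_x B x).
  by apply: countable_bigcupT_measurable; first exact: countableP.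
apply/seteqP; split=> [[v1 v2] /= Uv|v [x _]]; last first.
  by rewrite /B; case: pselect => // h /h.
have [d d0 dP] := oU _ Uv.
have d4 : 0 < d / 4 by rewrite divr_gt0.
pose n := Num.truncn ((d / 4)^-1).
have n4 : n.+1%:R^-1 < d / 4.
  rewrite -[ltRHS]invrK ltf_pV2 ?posrE ?invr_gt0 //.
  by apply: truncnS_gt.
have n0 : 0 < n.+1%:R^-1 :> R by rewrite invr_gt0.
have approx (r x : R) : 0 < r -> exists q : rat, `|ratr q - x| < r.
  move=> r0; have /rat_in_itvoo[q] : x - r < x + r by lra.
  by rewrite in_itv /= => /andP[h1 h2]; exists q; rewrite ltr_norml; lra.
have [q1 q1P] := approx _ v1 n0; have [q2 q2P] := approx _ v2 n0.
have box_v (r x y : R) : `|y - x| < r -> y - r < x < y + r.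
  by rewrite ltr_norml; lra.
have box_w (r x y z : R) : `|y - x| < r -> r < d / 4 -> y - r < z < y + r ->
    `|z - x| < d / 2.
  by rewrite !ltr_norml; lra.
exists (q1, q2, n) => //; rewrite /B; case: pselect => [bU|[]]; last first.
  case=> [w1 w2]; rewrite /box /= !in_itv /= => -[w1P w2P]; apply: dP.
  apply: le_lt_trans (ler_normc_ReIm _) _; rewrite /to_complex /=.
  have h1 := box_w _ _ _ _ q1P n4 w1P.
  have h2 := box_w _ _ _ _ q2P n4 w2P.
  by rewrite (splitr d) ltrD.
by split; rewrite /= in_itv /=; apply: box_v.
Qed.

Lemma Cmeasurable_ccontinuous U F : copen U ->
  (forall z, U z -> ccontinuous_at F z) ->
  Cmeasurable (to_complex @^-1` U : set (plane R)) (F \o to_complex).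
Proof.
move=> oU cF.
have mp (p : R[i] -> R) : (forall z w, p (z - w) = p z - p w) ->
    (forall z, `|p z| <= normc z) ->
    measurable_fun (to_complex @^-1` U : set (plane R)) (fun v => p (F (to_complex v))).
  move=> pB pn; apply: (measurability _ (RGenOInfty.measurableE R)).
  move=> _ [_ [a ->] <-].
  rewrite (_ : _ `&` _ = to_complex @^-1` [set z | U z /\ a < p (F z)]); last first.
    by apply/seteqP; split=> v /=; rewrite in_itv /= andbT.
  apply: measurable_copen => z /= [Uz az].
  have [d d0 dP] := oU z Uz.
  have e0 : 0 < p (F z) - a by rewrite subr_gt0.
  have [d' d'0 d'P] := cF z Uz _ e0.
  exists (Num.min d d'); first by rewrite lt_min d0.
  move=> w; rewrite lt_min => /andP[wd wd']; split; first exact: dP.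
  have := le_lt_trans (pn _) (d'P w wd'); rewrite pB ltr_norml => /andP[h _].
  by lra.
split; apply: mp.
- by move=> z w; rewrite Re_add Re_opp.
- exact: ler_Re_normc.
- by move=> z w; rewrite Im_add Im_opp.
- exact: ler_Im_normc.
Qed.

Lemma preimage_diskE : (to_complex @^-1` @unit_disk R : set (plane R)) =
  (to_complex @^-1` @punctured_disk R) `|` [set (0, 0)].
Proof.
apply/seteqP; split=> [[x y] /= xy|v [[]|->]] //=; last first.
  by rewrite /unit_disk /to_complex /= expr0n addr0 sqrtr0.
have [/eqP|z0] := boolP ((x +i* y : R[i]) == 0); last by left.
by move=> [-> ->]; right.
Qed.

Lemma measurable_punctured_disk :
  measurable (to_complex @^-1` @punctured_disk R : set (plane R)).
Proof. by apply: measurable_copen; exact: copen_punctured_disk. Qed.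

Lemma measurable_plane_origin : measurable [set ((0, 0) : plane R)].
Proof.
rewrite (_ : [set _] = [set (0 : measurableTypeR R)] `*` [set (0 : measurableTypeR R)]).
  by apply: measurableX; exact: measurable_set1.
by apply/seteqP; split=> [_ ->|[x y] [/= -> ->]].
Qed.

(** The disk is the punctured disk together with a measurable singleton. *)
Lemma measurable_fun_disk d' (T : measurableType d') (f : plane R -> T) :
  measurable_fun (to_complex @^-1` @punctured_disk R) f ->
  measurable_fun (to_complex @^-1` @unit_disk R) f.
Proof.
move=> mf; rewrite preimage_diskE; apply/measurable_funU.
- exact: measurable_punctured_disk.
- exact: measurable_plane_origin.
- by split => //; exact: measurable_fun_set1.
Qed.

End PlaneMeasurability.

Section Density.
Context d (T : measurableType d) (R : realType).
Variables (m nu : {measure set T -> \bar R}) (E : set T) (w : T -> R).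
Hypotheses (mE : measurable E) (mw : measurable_fun E w).
Hypothesis w0 : forall x, E x -> 0 <= w x.
Hypothesis nuE : forall A, measurable A ->
  (nu (A `&` E) = \int[m]_(x in A `&` E) (w x)%:E)%E.

Import HBNNSimple.

Let integral_density_indic (c : R) A : 0 <= c -> measurable A ->
  (\int[nu]_(x in E) (c * \1_A x)%:E = \int[m]_(x in E) (c * \1_A x * w x)%:E)%E.
Proof.
move=> c0 mA.
under eq_integral do rewrite EFinM.
under [RHS]eq_integral do rewrite -mulrA EFinM.
have mi D : measurable_fun D (\1_A : T -> R) by exact/measurable_funTS/measurable_indic.
rewrite ge0_integralZl //; last by apply/measurable_EFinP; exact: mi.
rewrite ge0_integralZl //; first last.
- by move=> x Ex; rewrite lee_fin mulr_ge0 ?w0.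
- by apply/measurable_EFinP; apply: measurable_funM.
congr (_ * _)%E; rewrite integral_indic // nuE // setIC integral_mkcondr.
apply: eq_integral => x _; rewrite /patch indicE.
by case: (x \in A); rewrite ?mul1r ?mul0r.
Qed.

Let integral_density_nnsfun (h : {nnsfun T >-> R}) :
  (\int[nu]_(x in E) (h x)%:E = \int[m]_(x in E) (h x * w x)%:E)%E.
Proof.
pose s := finmap.enum_fset (fset_set (range h)).
pose A y := h @^-1` [set y].
have mA y : measurable (A y) by exact: measurable_sfunP.
have s0 y : y \in s -> 0 <= y.
  have range_h := in_fset_set (fimfunP h).
  move=> ys; have : y \in range h by rewrite -range_h.
  by rewrite inE => -[x _ <-]; exact: fun_ge0.
(* the maximum with 0 changes no value of h, but makes all terms nonnegative *)
pose c y : R := Num.max y 0.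
have c0 y : 0 <= c y by rewrite le_max lexx orbT.
have hE x : h x = \sum_(y <- s) c y * \1_(A y) x.
  rewrite fimfunE fsbig_finite //= big_seq [RHS]big_seq.
  by apply: eq_bigr => y /s0 y0; rewrite /c max_l.
have mi y D : measurable_fun D (fun x => c y * \1_(A y) x).
  by apply: measurable_funM => //; apply/measurable_funTS; exact: measurable_indic.
have L x : (h x)%:E = (\sum_(y <- s) (c y * \1_(A y) x)%:E)%E.
  by rewrite {1}hE sumEFin.
have M x : (h x * w x)%:E = (\sum_(y <- s) (c y * \1_(A y) x * w x)%:E)%E.
  by rewrite {1}hE mulr_suml sumEFin.
under eq_integral do rewrite L.
under [RHS]eq_integral do rewrite M.
rewrite ge0_integral_sum //; first last.
- by move=> y x _; rewrite lee_fin mulr_ge0.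
- by move=> y; apply/measurable_EFinP; exact: mi.
rewrite ge0_integral_sum //; first last.
- by move=> y x Ex; rewrite lee_fin !mulr_ge0 ?w0.
- by move=> y; apply/measurable_EFinP; apply: measurable_funM => //; exact: mi.
by apply: eq_bigr => y _; exact: integral_density_indic.
Qed.

(** The hypothesis on nu is the case of indicator functions; it extends to simple
functions by linearity and to all nonnegative ones by monotone convergence. *)
Lemma ge0_integral_density (f : T -> \bar R) :
  measurable_fun E f -> (forall x, E x -> 0 <= f x)%E ->
  (\int[nu]_(x in E) f x = \int[m]_(x in E) (f x * (w x)%:E))%E.
Proof.
move=> mf f0; pose h := nnsfun_approx mE mf.
have hf x : E x -> (h n x)%:E @[n --> \oo] --> f x by exact: cvg_nnsfun_approx.
have hnd x : {homo (fun n => h n x) : n k / (n <= k)%N >-> n <= k}.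
  by move=> n k nk; exact/lefP/nd_nnsfun_approx.
have mh n : measurable_fun E (h n) by exact/measurable_funTS/measurable_funP.
have c1 := @cvg_monotone_convergence _ _ _ nu E mE (fun n x => (h n x)%:E).
have c2 := @cvg_monotone_convergence _ _ _ m E mE (fun n x => (h n x * w x)%:E).
have {}c1 : (\int[nu]_(x in E) (h n x)%:E)%E @[n --> \oo] -->
    (\int[nu]_(x in E) f x)%E.
  rewrite (eq_integral (fun x => lim ((h n x)%:E @[n --> \oo]))); last first.
    by move=> x; rewrite inE => /hf/cvg_lim ->.
  apply: c1.
  - by move=> n; exact/measurable_EFinP.
  - by move=> n x _; rewrite lee_fin.
  - by move=> x _ n k nk; rewrite lee_fin hnd.
have {}c2 : (\int[m]_(x in E) (h n x * w x)%:E)%E @[n --> \oo] -->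
    (\int[m]_(x in E) (f x * (w x)%:E))%E.
  rewrite (eq_integral (fun x => lim ((h n x * w x)%:E @[n --> \oo]))); last first.
    move=> x; rewrite inE => Ex; apply/esym/cvg_lim => //.
    by under eq_fun do rewrite EFinM; apply: cvgeZr => //; exact: hf.
  apply: c2.
  - by move=> n; apply/measurable_EFinP; exact: measurable_funM.
  - by move=> n x Ex; rewrite lee_fin mulr_ge0 ?w0.
  - by move=> x Ex n k nk; rewrite lee_fin ler_wpM2r ?w0 ?hnd.
move: c1; under eq_fun do rewrite integral_density_nnsfun.
by move=> c1; exact: (cvg_unique _ c1 c2).
Qed.

Lemma integrable_density (f : T -> R) : measurable_fun E f ->
  nu.-integrable E (EFin \o f) <-> m.-integrable E (EFin \o (fun x => f x * w x)).
Proof.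
move=> mf.
have E1 : (\int[nu]_(x in E) `|(f x)%:E| = \int[m]_(x in E) `|(f x * w x)%:E|)%E.
  rewrite ge0_integral_density //; last first.
    by apply: measurableT_comp => //; exact/measurable_EFinP.
  apply: eq_integral => x; rewrite inE => Ex.
  by rewrite /= normrM EFinM (ger0_norm (w0 Ex)).
split=> /integrableP[_ fi]; apply/integrableP; split.
- by apply/measurable_EFinP; exact: measurable_funM.
- by rewrite -E1.
- exact/measurable_EFinP.
- by rewrite E1.
Qed.

Lemma Rintegral_density (f : T -> R) : measurable_fun E f ->
  \int[nu]_(x in E) f x = \int[m]_(x in E) (f x * w x).
Proof.
move=> mf; rewrite /Rintegral; congr fine; rewrite integralE [RHS]integralE.
have mp : measurable_fun E (EFin \o f)^\+%E.
  by apply: measurable_funepos; exact/measurable_EFinP.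
have mn : measurable_fun E (EFin \o f)^\-%E.
  by apply: measurable_funeneg; exact/measurable_EFinP.
congr (_ - _)%E.
  rewrite (@ge0_integral_density (EFin \o f)^\+%E) //.
  apply: eq_integral => x; rewrite inE => Ex; rewrite !unlock /=.
  by rewrite -EFin_max -EFinM maxr_pMl ?w0 // mul0r EFin_max.
rewrite (@ge0_integral_density (EFin \o f)^\-%E) //.
apply: eq_integral => x; rewrite inE => Ex; rewrite !unlock /=.
by rewrite -?EFinN -!EFin_max -EFinM maxr_pMl ?w0 // mul0r mulNr.
Qed.

End Density.

(** * The distribution of the squared modulus *)

Section DiskArea.
Context {R : realType}.
Local Notation leb := (@lebesgue_measure R).

(** The substitution x = r sin t. *)
Lemma integral_half_circle (r : R) : 0 < r ->
  (\int[leb]_(x in `[(- r)%R, r]) (2 * Num.sqrt (r ^+ 2 - x ^+ 2))%R%:E =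
   (pi * r ^+ 2)%R%:E)%E.
Proof.
move=> r0.
have pi0 : - (pi / 2) < pi / 2 :> R by have := @pi_gt0 R; lra.
pose F (t : R) : R := r * sin t; pose G (x : R) : R := 2 * Num.sqrt (r ^+ 2 - x ^+ 2).
have dF (t : R) : is_derive t 1 F (r * cos t).
  by apply: is_deriveZ.
have F' : F^`()%classic = fun t => r * cos t.
  by apply/funext => t; rewrite derive1E; apply: derive_val.
have cF' : continuous F^`()%classic.
  rewrite F' => t; apply: cvgM; first exact: cvg_cst.
  exact: continuous_cos.
have cF : continuous F.
  move=> t; apply: cvgM; first exact: cvg_cst.
  exact: continuous_sin.
have Fa : F (- (pi / 2)) = - r by rewrite /F sinN sin_pihalf mulrN1.
have Fb : F (pi / 2) = r by rewrite /F sin_pihalf mulr1.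
have := @integration_by_substitution_increasing R F G _ _ (ltW pi0).
rewrite Fa Fb => -> //; first last.
- apply: continuous_subspaceT => x; apply: cvgM; first exact: cvg_cst.
  apply: continuous_comp; last exact: sqrt_continuous.
  by apply: cvgB; [exact: cvg_cst|exact: exprn_continuous].
- split.
  + by move=> t _; case: (dF t).
  + exact: cvg_at_right_filter (cF _).
  + exact: cvg_at_left_filter (cF _).
- by apply/cvg_ex; exists (F^`()%classic (pi / 2)); exact: cvg_at_left_filter (cF' _).
- by apply/cvg_ex; exists (F^`()%classic (- (pi / 2))); exact: cvg_at_right_filter (cF' _).
- by move=> s t sI tI st; rewrite /F ltr_pM2l // ltr_sin.
pose g (t : R) := 2 * r ^+ 2 * cos t ^+ 2.
pose P (t : R) := r ^+ 2 * (t + sin t * cos t).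
have key (x : R) : 0 <= cos x ->
    2 * Num.sqrt (r ^+ 2 - (r * sin x) ^+ 2) * (r * cos x) = g x.
  move=> c0; have -> : r ^+ 2 - (r * sin x) ^+ 2 = (r * cos x) ^+ 2.
    by rewrite !exprMn cos2sin2; ring.
  by rewrite sqrtr_sqr (ger0_norm (mulr_ge0 (ltW r0) c0)) /g; ring.
transitivity (\int[leb]_(t in `[(- (pi / 2))%R, (pi / 2)%R]) (g t)%:E)%E.
  apply: eq_integral => t; rewrite inE /= in_itv /= => tI.
  by rewrite F' -[in RHS]key //; exact: cos_ge0_pihalf.
have dP (t : R) : is_derive t 1 P (g t).
  apply: is_derive_eq; rewrite /g /GRing.scale /= -(expr2 (cos t)) cos2sin2.
  by ring.
have cP : continuous P.
  by move=> t; apply: differentiable_continuous; apply/derivable1_diffP; case: (dP t).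
have cg : continuous g.
  move=> x; apply: cvgM; first exact: cvg_cst.
  by apply: (@continuous_comp _ _ _ cos (fun y : R => y ^+ 2));
    [exact: continuous_cos|exact: exprn_continuous].
rewrite (@continuous_FTC2 _ g P) //.
- rewrite -EFinB /P cosN sinN cos_pihalf; by congr (_%:E); field.
- exact: continuous_subspaceT cg.
- split.
  + by move=> t _; case: (dP t).
  + exact: cvg_at_right_filter (cP _).
  + exact: cvg_at_left_filter (cP _).
- by move=> t _; rewrite derive1E; apply: derive_val.
Qed.

Lemma measurable_sqnorm :
  measurable_fun setT (fun v : plane R => v.1 ^+ 2 + v.2 ^+ 2).
Proof.
by apply: measurable_funD; apply: measurable_funX;
  [exact: measurable_fst|exact: measurable_snd].
Qed.

Definition open_disk (s : R) : set (plane R) := [set v | v.1 ^+ 2 + v.2 ^+ 2 < s].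

Lemma measurable_open_disk s : measurable (open_disk s).
Proof.
have := measurable_fun_ltr measurable_sqnorm (@measurable_cst _ _ (plane R) R setT s).
by move=> /(_ measurableT [set true] I); rewrite setTI.
Qed.

(** The vertical slices of the disk are intervals; the parameter s is the square
of the radius, and may be negative. *)
Lemma area_open_disk s : lebesgue_plane (open_disk s) = (pi * Num.max s 0)%:E.
Proof.
have slice (x : R) : leb (xsection (open_disk s) x) =
    (2 * Num.sqrt (s - x ^+ 2))%:E.
  rewrite (_ : xsection _ _ =
    `](- Num.sqrt (s - x ^+ 2)), (Num.sqrt (s - x ^+ 2))[%classic); last first.
    apply/seteqP; split=> y; rewrite /xsection /= inE /open_disk /= in_itv /= -ltr_norml;
      rewrite [x ^+ 2 + _]addrC -ltrBrDr -[`|y|]sqrtr_sqr.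
      by move=> h; rewrite ltr_sqrt // (le_lt_trans (sqr_ge0 y) h).
    have [h|h] := ltP 0 (s - x ^+ 2); first by rewrite ltr_sqrt.
    by rewrite (ler0_sqrtr h) ltNge sqrtr_ge0.
  rewrite lebesgue_measure_itv /= lte_fin; case: ltP => [_|].
    by rewrite -EFinB; congr (_%:E); ring.
  move=> q0; have -> : Num.sqrt (s - x ^+ 2) = 0.
    by have := sqrtr_ge0 (s - x ^+ 2); lra.
  by rewrite mulr0.
rewrite /lebesgue_plane /product_measure1 /=.
under eq_integral do rewrite slice.
have [s0|s0] := leP s 0.
  rewrite mulr0; apply: integral0_eq => x _; congr (_%:E).
  by rewrite ler0_sqrtr ?mulr0 // subr_le0 (le_trans s0) // sqr_ge0.
have r0 : 0 < Num.sqrt s by rewrite sqrtr_gt0.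
rewrite -[in RHS](sqr_sqrtr (ltW s0)) -integral_half_circle // sqr_sqrtr ?ltW //.
rewrite [RHS]integral_mkcond; apply: eq_integral => x _.
rewrite /patch; case: ifPn => //; rewrite notin_setE /= in_itv /= -ler_norml.
move=> /negP; rewrite -ltNge => h; congr (_%:E).
rewrite ler0_sqrtr ?mulr0 // subr_le0 -(sqr_sqrtr (ltW s0)).
rewrite -[leRHS]real_normK ?num_real //.
by rewrite ler_sqr ?nnegrE ?sqrtr_ge0 // ltW.
Qed.

(** In this coordinate the area of the disk is uniformly distributed and the weight
becomes the density of a beta distribution. *)
Definition sqnorm_compl (v : plane R) : measurableTypeR R := 1 - (v.1 ^+ 2 + v.2 ^+ 2).

Lemma measurable_sqnorm_compl : measurable_fun setT sqnorm_compl.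
Proof. by apply: measurable_funB => //; exact: measurable_sqnorm. Qed.

(** The preimage of an interval is an annulus, whose area is proportional to the
length of the interval. *)
Lemma area_sqnorm_compl (A : set (measurableTypeR R)) :
  measurable A -> A `<=` `]0, 1] ->
  (pushforward lebesgue_plane sqnorm_compl A = pi%:E * leb A)%E.
Proof.
move=> mA A01.
have mpsi := measurable_sqnorm_compl.
have m1y : measurable (`]1, +oo[%classic : set (measurableTypeR R)).
  exact: measurable_itv.
have pii0 : 0 <= (pi : R)^-1 by rewrite invr_ge0 pi_ge0.
(* the image only charges the values at most 1; adding Lebesgue measure beyond 1
   gives a measure that agrees with Lebesgue measure on all intervals *)
pose m' : {measure set (measurableTypeR R) -> \bar R} :=
  measure_add (mscale (NngNum pii0) (pushforward lebesgue_plane sqnorm_compl))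
    (mrestr leb m1y).
pose m := m' mpsi.
have mE X : m X = ((pi^-1)%:E * lebesgue_plane (sqnorm_compl @^-1` X)
    + leb (X `&` `]1%R, +oo[))%E.
  by rewrite /m /m' /=; exact: measure_addE.
have leb_m : leb A = m A.
  apply: lebesgue_measure_unique => // _ [[a b]] _ <-.
  rewrite mE /=.
  have [ba|ab] := leP b a.
    rewrite set_itv_ge ?bnd_simp -?leNgt // set0I preimage_set0 !measure0.
    by rewrite mule0 adde0.
  have -> : sqnorm_compl @^-1` `]a, b] = open_disk (1 - a) `\` open_disk (1 - b).
    apply/seteqP; split=> v /=; rewrite in_itv /= /sqnorm_compl /open_disk /=.
      by move=> /andP[h1 h2]; split; [|apply/negP; rewrite -leNgt]; lra.
    by move=> [h1 /negP]; rewrite -leNgt => h2; lra.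
  have -> : lebesgue_plane (open_disk (1 - a) `\` open_disk (1 - b)) =
      (pi * Num.max (1 - a) 0 - pi * Num.max (1 - b) 0)%:E.
    transitivity (lebesgue_plane (open_disk (1 - a)) -
        lebesgue_plane (open_disk (1 - a) `&` open_disk (1 - b)))%E.
      apply: measureD; try exact: measurable_open_disk.
      have fin : (lebesgue_plane (open_disk (1 - a)) < +oo)%E by rewrite area_open_disk ltry.
      exact: fin.
    have -> : open_disk (1 - a) `&` open_disk (1 - b) = open_disk (1 - b).
      apply/seteqP; split=> v; first by case.
      by rewrite /open_disk /= => h; split=> //=; lra.
    by rewrite !area_open_disk.
  have -> : `]a, b] `&` `]1, +oo[ = `](Num.max a 1), b]%classic.
    apply/seteqP; split=> x /=; rewrite !in_itv /= andbT gt_max.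
      by move=> [/andP[-> ->] ->].
    by move=> /andP[/andP[-> ->] ->].
  rewrite !lebesgue_measure_itv /= !lte_fin ab gt_max ab /=.
  rewrite -?EFinB -EFinM -mulrBr mulrA mulVf ?mul1r ?gt_eqF ?pi_gt0 //.
  case: ifP => [b1|/negbT]; last rewrite -leNgt => b1.
    rewrite -EFinD; congr (_%:E).
    by rewrite (max_r (_ : 1 - b <= 0)) ?subr_le0 1?ltW // maxEle maxEle;
      case: ifP => ?; case: ifP => ?; lra.
  rewrite adde0; congr (_%:E).
  by rewrite !max_l ?subr_ge0 //; [ring|lra].
have A1y : A `&` `]1, +oo[ = set0.
  apply/seteqP; split=> x //= [/A01 /=]; rewrite !in_itv /= andbT.
  by move=> /andP[_ x1] x2; have := le_lt_trans x1 x2; rewrite ltxx.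
rewrite leb_m mE A1y measure0.
by rewrite adde0 muleA -EFinM divff ?mul1e // gt_eqF // pi_gt0.
Qed.

Lemma ge0_integral_sqnorm_compl (k : R -> \bar R) :
  measurable_fun (`]0, 1[ : set (measurableTypeR R)) k ->
  (forall t : R, 0 < t < 1 -> (0 <= k t)%E) ->
  (\int[lebesgue_plane]_(v in sqnorm_compl @^-1` `]0%R, 1%R[) k (sqnorm_compl v) =
   pi%:E * \int[leb]_(t in `]0%R, 1%R[) k t)%E.
Proof.
move=> mk k0; have mpsi := measurable_sqnorm_compl.
have k0' : {in (`]0%R, 1%R[%classic : set (measurableTypeR R)), forall t, (0 <= k t)%E}.
  by move=> t; rewrite inE /= in_itv; exact: k0.
rewrite -[LHS](@ge0_integral_pushforward _ _ _ _ _ _ mpsi lebesgue_plane) //.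
have -> : pi%:E = (NngNum (pi_ge0 R))%:num%:E :> \bar R by [].
rewrite -ge0_integral_mscale //.
apply: eq_measure_integral => A mA A01; rewrite /mscale /=.
apply: area_sqnorm_compl => // t /A01 /=; rewrite !in_itv /= => /andP[-> /ltW ->].
by [].
Qed.

End DiskArea.

(** * The fundamental theorem of calculus on the open unit interval *)

Section UnitIntervalFTC.
Context {R : realType}.
Local Notation leb := (@lebesgue_measure R).
Local Notation I01 := (`]0%R, 1%R[%classic : set (measurableTypeR R)).

Let eps (n : nat) : R := n.+2%:R^-1.

Let eps_gt0 n : 0 < eps n.
Proof. by rewrite invr_gt0. Qed.

Let eps_le n : eps n <= 2^-1.
Proof. by rewrite lef_pV2 ?posrE // ler_nat. Qed.

Let eps_cvg0 : eps @ \oo --> 0.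
Proof.
apply/cvgrPdist_lt => e e0; have /cvgrPdist_lt/(_ _ e0)[N _ NP] := @cvg_harmonic R.
by exists N => // n /= Nn; exact: (NP n.+1 (leqW Nn)).
Qed.

Let J n : set (measurableTypeR R) := `[eps n, 1 - eps n]%classic.

(* eps n is at most 1/2, so that the bounds of J n are in the right order *)
Let J_nd : {homo J : n m / (n <= m)%N >-> (n <= m)%O}.
Proof.
move=> n m nm; apply/subsetPset => t; rewrite /J /= !in_itv /= => /andP[h1 h2].
have : eps m <= eps n by rewrite lef_pV2 ?posrE // ler_nat !ltnS.
by move=> h; rewrite (le_trans h h1) (le_trans h2) // lerD2l lerN2.
Qed.

Let J_cup : \bigcup_n J n = I01.
Proof.
apply/seteqP; split=> t /=.
  move=> [n _]; rewrite /J /= !in_itv /= => /andP[h1 h2].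
  by have := eps_gt0 n; rewrite (lt_le_trans (eps_gt0 n) h1) /=; lra.
rewrite in_itv /= => /andP[t0 t1].
have : 0 < Num.min t (1 - t) by rewrite lt_min t0 subr_gt0.
move/cvgrPdist_lt : eps_cvg0 => /[apply] -[n _ /(_ n (leqnn n))] /=.
rewrite sub0r normrN gtr0_norm // lt_min => /andP[h1 h2].
by exists n => //; rewrite /J /= in_itv /= (ltW h1) /=; lra.
Qed.

Variables (f F : R -> R).
Hypothesis cf : forall t, 0 < t < 1 -> {for t, continuous f}.
Hypothesis dF : forall t : R, 0 < t < 1 -> is_derive t 1 F (f t).

Let J_sub n t : t \in `[eps n, 1 - eps n] -> 0 < t < 1.
Proof.
rewrite in_itv /= => /andP[h1 h2]; rewrite (lt_le_trans (eps_gt0 n) h1) /=.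
by have := eps_gt0 n; lra.
Qed.

Let within_cf n : {within `[eps n, 1 - eps n], continuous f}.
Proof.
by apply: continuous_in_subspaceT => t; rewrite inE => /J_sub; exact: cf.
Qed.

Let mf : measurable_fun I01 f.
Proof.
apply: open_continuous_measurable_fun; first exact: interval_open.
by move=> t; rewrite inE /= in_itv /=; exact: cf.
Qed.

Let FTC_J n : (\int[leb]_(t in J n) (f t)%:E = (F (1 - eps n))%:E - (F (eps n))%:E)%E.
Proof.
have e1 := eps_le n; have e0 := eps_gt0 n.
have cF t : 0 < t < 1 -> {for t, continuous F}.
  by move=> t01; apply: differentiable_continuous; apply/derivable1_diffP;
    case: (dF t01).
have h1 : 0 < eps n < 1 by lra.
have h2 : 0 < 1 - eps n < 1 by lra.
have [e2|e2] := eqVneq (eps n) 2^-1.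
  have e3 : 1 - eps n = eps n by rewrite e2; lra.
  by rewrite /J e3 set_itv1 integral_set1 subee.
have e3 : eps n < 1 - eps n by move/eqP: e2; lra.
rewrite (@continuous_FTC2 _ f F _ _ e3) //.
- split.
  + move=> t tI; have /dF[] // : 0 < t < 1.
    by move: tI; rewrite in_itv /=; lra.
  + exact: cvg_at_right_filter (cF _ h1).
  + exact: cvg_at_left_filter (cF _ h2).
- move=> t tI; have /dF t01 : 0 < t < 1 by move: tI; rewrite in_itv /=; lra.
  by rewrite derive1E; apply: derive_val.
Qed.

(** The integrals over the intervals J n are increments of F, hence at most 2 M,
and increase to the integral of f. *)
Lemma integrable_bounded_primitive (M : R) :
  (forall t, 0 < t < 1 -> 0 <= f t) -> (forall t, 0 < t < 1 -> `|F t| <= M) ->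
  leb.-integrable I01 (EFin \o f).
Proof.
move=> f0 FM; apply/integrableP; split; first exact/measurable_EFinP.
rewrite (_ : (\int[leb]_(x in I01) _)%E = \int[leb]_(x in I01) (f x)%:E)%E; last first.
  by apply: eq_integral => t; rewrite inE /= in_itv /= => /f0 h; rewrite ger0_norm.
apply: (@le_lt_trans _ _ (M *+ 2)%:E); last exact: ltry.
have := @ge0_nondecreasing_set_cvg_integral _ _ _ J (EFin \o f) leb J_nd.
rewrite J_cup => cv.
have {}cv : (\int[leb]_(x in J n) (EFin \o f) x)%E @[n --> \oo] -->
    (\int[leb]_(x in I01) (EFin \o f) x)%E.
  apply: cv.
  - by move=> n; exact: measurable_itv.
  - move=> n; apply/measurable_EFinP; apply: measurable_funS mf => //.
    by rewrite -J_cup; exact: bigcup_sup.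
  - by move=> n t /J_sub/f0; rewrite lee_fin.
have := cvg_lim (@ereal_hausdorff R) cv => <-.
apply: lime_le; first by apply/cvg_ex; eexists; exact: cv.
apply: nearW => n; rewrite [leLHS]FTC_J -EFinB lee_fin mulr2n.
have e1 := eps_le n; have e0 := eps_gt0 n.
have /FM : 0 < eps n < 1 by lra.
have /FM : 0 < 1 - eps n < 1 by lra.
by rewrite !ler_norml; lra.
Qed.

(** The integral over J n is an increment of F between points that tend to the
ends of the interval. *)
Lemma Rintegral_vanishing_primitive :
  leb.-integrable I01 (EFin \o f) ->
  F t @[t --> 0^'+] --> 0 -> F (1 - t) @[t --> 0^'+] --> 0 ->
  \int[leb]_(t in I01) f t = 0.
Proof.
move=> fi F0 F1.
have to0 (G : R -> R) : G t @[t --> 0^'+] --> 0 -> G (eps n) @[n --> \oo] --> 0.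
  move=> /cvgrPdist_lt G0; apply/cvgrPdist_lt => e /G0[d /= d0 dP].
  move/cvgrPdist_lt : eps_cvg0 => /(_ _ d0); apply: filterS => n /= nd.
  by apply: dP.
have lim0 : (\int[leb]_(x in I01) ((f \_ (J n)) x)%:E)%E @[n --> \oo] --> 0%E.
  rewrite (_ : (fun _ => _) = fun n => (F (1 - eps n) - F (eps n))%:E).
    apply: cvg_EFin; first exact: nearW.
    by rewrite -[0]subr0; apply: cvgB; [exact: (to0 (fun t => F (1 - t)))|exact: to0].
  apply/funext => n; rewrite EFinB -FTC_J.
  have JE : I01 `&` J n = J n by rewrite setIidr // -J_cup; exact: bigcup_sup.
  transitivity (\int[leb]_(t in I01 `&` J n) (f t)%:E)%E; last by rewrite JE.
  by rewrite [RHS]integral_mkcondr; apply: eq_integral => t _;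
    rewrite /patch; case: ifP.
have [] := @dominated_convergence _ _ _ leb I01 (measurable_itv _)
  (fun n t => ((f \_ (J n)) t)%:E) (EFin \o f) (EFin \o (fun t => `|f t|)).
- move=> n; apply/measurable_EFinP.
  apply/(measurable_restrict _ _ _) => //; first exact: measurable_itv.
  by apply: measurable_funS mf => //; exact: subIsetl.
- exact/measurable_EFinP.
- apply: aeW => t tI; have := tI; rewrite -J_cup => -[n _ tJ].
  apply: cvg_near_cst; exists n => // m /= nm; rewrite /patch mem_set //.
  by have := J_nd nm => /subsetPset; apply.
- exact: integrable_norm.
- apply: aeW => t n tI /=; rewrite lee_fin /patch; case: ifP => //.
  by rewrite normr0.
move=> _ _ cv; rewrite /Rintegral (_ : (\int[leb]_(t in I01) _)%E = 0%E) //.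
exact: cvg_unique cv lim0.
Qed.

End UnitIntervalFTC.

(** * The beta function *)

Section BetaFunction.
Context {R : realType}.
Local Notation leb := (@lebesgue_measure R).
Local Notation I01 := (`]0%R, 1%R[%classic : set (measurableTypeR R)).
Implicit Types a b t : R.

Definition beta_density a b t : R := t `^ a * (1 - t) `^ b.

Lemma powRDs t a b : 0 < t -> t `^ (a + b) = t `^ a * t `^ b.
Proof. by move=> t0; rewrite powRD // (gt_eqF t0) implybT. Qed.

Lemma powR_le1 t a : 0 < t < 1 -> 0 < a -> t `^ a <= 1.
Proof.
move=> /andP[t0 t1] a0; rewrite -(powRr0 t); apply: ger_powR; last exact: ltW.
by rewrite t0 ltW.
Qed.

Lemma onem_01 t : 0 < t < 1 -> 0 < 1 - t < 1.
Proof. by lra. Qed.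

Lemma continuous_powR_gt0 t a : 0 < t -> {for t, continuous (@powR R ^~ a)}.
Proof.
move=> t0; apply: differentiable_continuous; apply/derivable1_diffP.
by apply: derivable_powR; rewrite in_itv /= t0.
Qed.

Lemma is_derive_onem_powR t a : t < 1 ->
  is_derive t 1 (fun s : R => (1 - s) `^ a) (- (a * (1 - t) `^ (a - 1))).
Proof.
move=> t1; have t0 : 0 < 1 - t by rewrite subr_gt0.
have d1 : is_derive (1 - t) 1 (@powR R ^~ a) (a * (1 - t) `^ (a - 1)).
  exact: is_derive1_powR.
have d2 : is_derive t 1 (fun s : R => 1 - s) (- 1).
  by apply: is_derive_eq; rewrite add0r mul1r.
have := @is_derive1_comp _ (@powR R ^~ a) (fun s : R => 1 - s) t _ _ d1 d2.
by rewrite mulrN1.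
Qed.

Lemma continuous_onem_powR t a : t < 1 ->
  {for t, continuous (fun s : R => (1 - s) `^ a)}.
Proof.
move=> t1; apply: differentiable_continuous; apply/derivable1_diffP.
by case: (is_derive_onem_powR a t1).
Qed.

Lemma integrable_powR a : -1 < a -> leb.-integrable I01 (EFin \o (@powR R ^~ a)).
Proof.
move=> a1; have a0 : 0 < a + 1 by lra.
apply: (@integrable_bounded_primitive _ _ (fun t => (a + 1)^-1 * t `^ (a + 1)) _ _ (a + 1)^-1).
- by move=> t /andP[t0 _]; exact: continuous_powR_gt0.
- move=> t /andP[t0 _].
  have d1 := is_derive1_powR (a + 1) t0.
  apply: is_derive_eq; rewrite /GRing.scale /= addrK mulrA mulVf ?mul1r // gt_eqF //.
- by move=> t _; exact: powR_ge0.
- move=> t t01; rewrite ger0_norm; last by rewrite mulr_ge0 ?powR_ge0 // invr_ge0 (ltW a0).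
  by rewrite ler_piMr ?invr_ge0 ?(ltW a0) ?powR_le1.
Qed.

Lemma integrable_onem_powR a : -1 < a ->
  leb.-integrable I01 (EFin \o (fun t => (1 - t) `^ a)).
Proof.
move=> a1; have a0 : 0 < a + 1 by lra.
apply: (@integrable_bounded_primitive _ _ (fun t => - (a + 1)^-1 * (1 - t) `^ (a + 1)) _ _ (a + 1)^-1).
- by move=> t /andP[_ t1]; exact: continuous_onem_powR.
- move=> t /andP[_ t1].
  have d1 := is_derive_onem_powR (a + 1) t1.
  apply: is_derive_eq; rewrite /GRing.scale /= addrK mulrNN mulrA mulVf ?mul1r // gt_eqF //.
- by move=> t _; exact: powR_ge0.
- move=> t /onem_01 t01; rewrite mulNr normrN ger0_norm; last by rewrite mulr_ge0 ?powR_ge0 // invr_ge0 (ltW a0).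
  by rewrite ler_piMr ?invr_ge0 ?(ltW a0) ?powR_le1.
Qed.

Lemma measurable_beta_density a b : measurable_fun I01 (beta_density a b).
Proof.
apply: open_continuous_measurable_fun; first exact: interval_open.
move=> t; rewrite inE /= in_itv /= => /andP[t0 t1]; apply: cvgM.
  exact: continuous_powR_gt0.
exact: continuous_onem_powR.
Qed.

(** As t + (1 - t) = 1, the density is a sum of two terms with one singular
endpoint each. *)
Lemma integrable_beta_density a b : -1 < a -> -1 < b ->
  leb.-integrable I01 (EFin \o beta_density a b).
Proof.
move=> a1 b1.
apply: (@integrable_dominated _ _ _ leb I01 (measurable_itv _) _
  (fun t => t `^ a + (1 - t) `^ b)).
- exact: measurable_beta_density.
- move=> t; rewrite /= in_itv /= => t01; have /andP[t0 t1] := t01.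
  have s01 := onem_01 t01; have /andP[s0 s1] := s01.
  rewrite ger0_norm ?mulr_ge0 ?powR_ge0 //.
  have -> : beta_density a b t = t `^ a * (1 - t) `^ (b + 1) + t `^ (a + 1) * (1 - t) `^ b.
    by rewrite /beta_density !powRDs // !powRr1 ?ltW //; ring.
  apply: lerD.
    by rewrite ler_piMr ?powR_ge0 // powR_le1 //; lra.
  by rewrite ler_piMl ?powR_ge0 // powR_le1 //; lra.
- apply: integrableRD; first exact: measurable_itv.
    exact: integrable_powR.
  exact: integrable_onem_powR.
Qed.

Lemma BetaE a b : Beta (a + 1) (b + 1) = \int[leb]_(t in I01) beta_density a b t.
Proof. by apply: eq_Rintegral => t _; rewrite /beta_density !addrK. Qed.

(** Integration by parts: the function t^(a+1) (1-t)^(b+1) vanishes at both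
endpoints. *)
Lemma Beta_recurrence a b : -1 < a -> -1 < b ->
  (a + b + 2) * Beta (a + 1) (b + 1 + 1) = (b + 1) * Beta (a + 1) (b + 1).
Proof.
move=> a1 b1; have b2 : -1 < b + 1 by lra.
have i1 := integrable_beta_density a1 b1.
have i2 := integrable_beta_density a1 b2.
rewrite !BetaE; apply/eqP; rewrite -subr_eq0.
have mI : measurable I01 by exact: measurable_itv.
rewrite -!RintegralZl // -RintegralB //; try exact: integrableRZ.
apply/eqP; apply: (@Rintegral_vanishing_primitive _ _
  (fun t => t `^ (a + 1) * (1 - t) `^ (b + 1))).
- move=> t /andP[t0 t1]; apply: cvgB; apply: cvgM; try exact: cvg_cst.
    by apply: cvgM; [exact: continuous_powR_gt0|exact: continuous_onem_powR].
  by apply: cvgM; [exact: continuous_powR_gt0|exact: continuous_onem_powR].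
- move=> t /andP[t0 t1]; have s0 : 0 < 1 - t by lra.
  have d1 := is_derive1_powR (a + 1) t0.
  have d2 := is_derive_onem_powR (b + 1) t1.
  apply: is_derive_eq; rewrite /GRing.scale /= /beta_density !addrK.
  by rewrite !powRDs // !powRr1 ?ltW //; ring.
- apply: integrableRB => //; exact: integrableRZ.
- have c1 : (1 - t) `^ (b + 1) @[t --> 0^'+] --> (1 - 0) `^ (b + 1).
    by apply: cvg_at_right_filter; exact: continuous_onem_powR.
  have c0 : t `^ (a + 1) @[t --> 0^'+] --> 0 by apply: powR_cvg0; lra.
  have h : t `^ (a + 1) * (1 - t) `^ (b + 1) @[t --> 0^'+] -->
      0 * (1 - 0) `^ (b + 1) by exact: cvgM.
  by rewrite mul0r in h.
- have c1 : t `^ (b + 1) @[t --> 0^'+] --> 0 by apply: powR_cvg0; lra.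
  have c2 : (1 - t) `^ (a + 1) @[t --> 0^'+] --> (1 - 0) `^ (a + 1).
    by apply: cvg_at_right_filter; exact: continuous_onem_powR.
  under eq_fun do rewrite subKr.
  have h : (1 - t) `^ (a + 1) * t `^ (b + 1) @[t --> 0^'+] -->
      (1 - 0) `^ (a + 1) * 0 by exact: cvgM.
  by rewrite mulr0 in h.
Qed.

Lemma Beta_gt0 a b : -1 < a -> -1 < b -> 0 < Beta (a + 1) (b + 1).
Proof.
move=> a1 b1; rewrite BetaE.
have mI : measurable I01 by exact: measurable_itv.
have bd0 t : I01 t -> 0 < beta_density a b t.
  by rewrite /= in_itv /= => /andP[t0 t1]; rewrite mulr_gt0 // powR_gt0 //; lra.
rewrite lt_neqAle; apply/andP; split; last first.
  by apply: Rintegral_ge0 => t /bd0/ltW.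
apply/eqP => /esym J0.
have : (\int[leb]_(t in I01) `|(beta_density a b t)%:E|)%E = 0%E.
  transitivity (\int[leb]_(t in I01) (beta_density a b t)%:E)%E.
    by apply: eq_integral => t; rewrite inE => /bd0/ltW h; rewrite /= ger0_norm.
  rewrite -[LHS]fineK; last exact: integrable_fin_num (integrable_beta_density a1 b1).
  by move: J0; rewrite /Rintegral => ->.
move/(ae_eq_integral_abs leb mI) => h.
have /h [N [mN N0 IN]] : measurable_fun I01 (EFin \o beta_density a b).
  by apply/measurable_EFinP; exact: measurable_beta_density.
have : (leb I01 <= leb N)%E.
  apply: le_measure; rewrite ?inE // => t tI; apply: IN => /= /(_ tI) [] /eqP.
  by rewrite gt_eqF // bd0.
by rewrite N0 lebesgue_measure_itv /= lte_fin ltr01 oppr0 adde0 lee_fin ler10.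
Qed.

End BetaFunction.

(** * The weighted area as a density *)

Section WeightedDisk.
Context {R : realType}.
Variables alpha beta : R.
Local Notation leb := (@lebesgue_measure R).
Local Notation mu := (weighted_area alpha beta).
Local Notation Dp := (to_complex @^-1` @punctured_disk R : set (plane R)).
Local Notation Dd := (to_complex @^-1` @unit_disk R : set (plane R)).

Definition weight_plane (v : plane R) : R := weight alpha beta (to_complex v) / pi.

Lemma weight_plane_ge0 v : 0 <= weight_plane v.
Proof. by rewrite divr_ge0 ?weight_ge0 // pi_ge0. Qed.

Lemma measurable_weight_plane : measurable_fun setT weight_plane.
Proof. by apply: measurable_funM => //; exact: measurable_weight. Qed.

Lemma weighted_area_density (A : set (plane R)) : measurable A ->
  (mu (A `&` Dp) = \int[lebesgue_plane]_(v in A `&` Dp) (weight_plane v)%:E)%E.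
Proof.
move=> mA; have mDp := @measurable_punctured_disk R.
rewrite /weighted_area /area.
have -> : A `&` Dp `&` Dd = A `&` Dp by rewrite setIidl // => v [_ []].
have mADp : measurable (A `&` Dp) by exact: measurableI.
rewrite [LHS]ge0_integral_mscale //; first last.
- by move=> v _; rewrite lee_fin weight_ge0.
- by apply/measurable_EFinP/measurable_funTS; exact: measurable_weight.
rewrite -ge0_integralZl //; first last.
- by move=> v _; rewrite lee_fin weight_ge0.
- by apply/measurable_EFinP/measurable_funTS; exact: measurable_weight.
by apply: eq_integral => v _; rewrite -EFinM /weight_plane mulrC.
Qed.

Lemma weighted_area_origin : mu [set ((0, 0) : plane R)] = 0%E.
Proof.
rewrite /weighted_area; apply: null_set_integral.
- apply: measurableI; first exact: measurable_plane_origin.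
  exact: measurable_unit_disk.
- by apply/measurable_EFinP/measurable_funTS; exact: measurable_weight.
have N0 : area [set ((0, 0) : plane R)] = 0%E.
  have E : area [set ((0, 0) : plane R)] =
      ((pi^-1)%:E * lebesgue_plane [set ((0, 0)%R : plane R)])%E by [].
  have E0 : [set ((0, 0) : plane R)] =
      [set (0 : measurableTypeR R)] `*` [set (0 : measurableTypeR R)].
    by apply/seteqP; split=> [_ ->|[x y] [/= -> ->]].
  have m0 : measurable [set (0 : measurableTypeR R)] by exact: measurable_set1.
  have E1 : lebesgue_plane [set ((0, 0) : plane R)] =
      (leb [set 0%R] * leb [set 0%R])%E.
    by rewrite E0; exact: product_measure1E.
  by rewrite E E1 [X in (_ * (X * _))%E]lebesgue_measure_set1 mul0e mule0.
apply/eqP; rewrite eq_le measure_ge0 andbT -N0; apply: le_measure; rewrite ?inE.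
- apply: measurableI; first exact: measurable_plane_origin.
  exact: measurable_unit_disk.
- exact: measurable_plane_origin.
- exact: subIsetl.
Qed.

Lemma disk_minus_origin : Dd `\` [set (0, 0)] = Dp.
Proof.
apply/seteqP; split=> -[x y] /=.
  move=> [xy xy0]; split=> //; apply/eqP => -[x0 y0]; apply: xy0.
  by rewrite x0 y0.
move=> [xy xy0]; split=> // -[x0 y0]; move/eqP: xy0; apply.
by rewrite /to_complex /= x0 y0.
Qed.

(** The origin is negligible for the weighted area, so that integrals over the disk
are integrals over the punctured disk, where the weight is a density. *)
Lemma disk_integrable_densityR (f : plane R -> R) : measurable_fun Dp f ->
  mu.-integrable Dd (EFin \o f) <->
  lebesgue_plane.-integrable Dp (EFin \o (fun v => f v * weight_plane v)).
Proof.
move=> mf; have mDd : measurable Dd by exact: measurable_unit_disk.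
rewrite (@negligible_integrable _ _ _ mu Dd [set (0, 0)]) //; last 3 first.
- exact: measurable_plane_origin.
- by apply/measurable_EFinP; exact: measurable_fun_disk.
- exact: weighted_area_origin.
rewrite disk_minus_origin.
apply: integrable_density => //.
- exact: measurable_punctured_disk.
- by apply: measurable_funTS; exact: measurable_weight_plane.
- by move=> v _; exact: weight_plane_ge0.
- exact: weighted_area_density.
Qed.

Lemma disk_Rintegral_density (f : plane R -> R) : measurable_fun Dp f ->
  mu.-integrable Dd (EFin \o f) ->
  \int[mu]_(v in Dd) f v = \int[lebesgue_plane]_(v in Dp) (f v * weight_plane v).
Proof.
move=> mf fi; have mDd : measurable Dd by exact: measurable_unit_disk.
rewrite -(@Rintegral_density _ _ _ lebesgue_plane mu) //; first last.
- exact: weighted_area_density.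
- by move=> v _; exact: weight_plane_ge0.
- by apply: measurable_funTS; exact: measurable_weight_plane.
- exact: measurable_punctured_disk.
rewrite /Rintegral; congr fine.
rewrite (@negligible_integral _ _ _ mu Dd [set (0, 0)]) //.
- by rewrite disk_minus_origin.
- exact: measurable_plane_origin.
- exact: weighted_area_origin.
Qed.

Lemma disk_integrable_density F : Cmeasurable Dp (F \o to_complex) ->
  disk_integrable mu F <->
  Cintegrable lebesgue_plane Dp (fun v => F (to_complex v) * (weight_plane v)%:C).
Proof.
move=> [m1 m2]; rewrite /disk_integrable /Cintegrable.
have E1 : (EFin \o (fun v => complex.Re (F (to_complex v) * (weight_plane v)%:C))) =
    EFin \o (fun v => complex.Re (F (to_complex v)) * weight_plane v).
  by apply/funext => v /=; rewrite Re_mul /= mulr0 subr0.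
have E2 : (EFin \o (fun v => complex.Im (F (to_complex v) * (weight_plane v)%:C))) =
    EFin \o (fun v => complex.Im (F (to_complex v)) * weight_plane v).
  by apply/funext => v /=; rewrite Im_mul /= mulr0 add0r.
rewrite E1 E2; have [h1 h1'] := disk_integrable_densityR m1.
have [h2 h2'] := disk_integrable_densityR m2.
by split=> -[i1 i2]; split; [exact: h1|exact: h2|exact: h1'|exact: h2'].
Qed.

Lemma disk_integral_density F : Cmeasurable Dp (F \o to_complex) ->
  disk_integrable mu F ->
  disk_integral mu F =
  Cint lebesgue_plane Dp (fun v => F (to_complex v) * (weight_plane v)%:C).
Proof.
move=> [m1 m2] [i1 i2]; rewrite /disk_integral /Cint; congr (_ +i* _).
  rewrite (disk_Rintegral_density m1 i1); apply: eq_Rintegral => v _.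
  by rewrite Re_mul /= mulr0 subr0.
rewrite (disk_Rintegral_density m2 i2); apply: eq_Rintegral => v _.
by rewrite Im_mul /= mulr0 add0r.
Qed.

Lemma sqnorm_compl_normc (v : plane R) : sqnorm_compl v = 1 - normc (to_complex v) ^+ 2.
Proof. by rewrite normc_sqr. Qed.

Lemma preimage_sqnorm_compl : sqnorm_compl @^-1` `]0, 1[ = Dp.
Proof.
rewrite punctured_diskE; apply/seteqP; split=> v /=;
  rewrite in_itv /= sqnorm_compl_normc; set n := normc (to_complex v);
  have n0 : 0 <= n by exact: normc_ge0.
  move=> /andP[h1 h2]; have n2 : n ^+ 2 < 1 by lra.
  rewrite expr_lt1 // in n2; rewrite n2 andbT lt_neqAle n0 andbT.
  by apply/eqP => E; move: h2; rewrite (esym E : n = 0) expr0n /= subr0 ltxx.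
move=> /andP[h1 h2]; have n2 : n ^+ 2 < 1 by rewrite expr_lt1 // ltW.
by have n3 : 0 < n ^+ 2 by [rewrite exprn_gt0]; lra.
Qed.

End WeightedDisk.

(** * Moments of the weight *)

Section Moments.
Context {R : realType}.
Variables alpha beta : R.
Hypotheses (alpha_gt : -1 < alpha) (beta_gt : -1 < beta).
Local Notation leb := (@lebesgue_measure R).
Local Notation mu := (weighted_area alpha beta).
Local Notation Dp := (to_complex @^-1` @punctured_disk R : set (plane R)).
Local Notation Dd := (to_complex @^-1` @unit_disk R : set (plane R)).
Local Notation weight_plane := (weight_plane alpha beta).
Local Notation moment n := (Beta (alpha + 1) (beta + n%:R + 1) / Beta (alpha + 1) (beta + 1)).

Lemma ge0_integrable_sqnorm_compl (k : R -> R) (f : plane R -> R) :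
  (forall t, 0 < t < 1 -> 0 <= k t) ->
  leb.-integrable `]0, 1[ (EFin \o k) ->
  (forall v, Dp v -> f v = k (sqnorm_compl v)) ->
  lebesgue_plane.-integrable Dp (EFin \o f) /\
  \int[lebesgue_plane]_(v in Dp) f v = pi * \int[leb]_(t in `]0, 1[) k t.
Proof.
move=> k0 ki fk.
have mk : measurable_fun (`]0, 1[ : set (measurableTypeR R)) k.
  by apply: integrableR_measurable ki.
have f0 v : Dp v -> 0 <= f v.
  by move=> Dv; rewrite fk // k0 //; move: Dv;
    rewrite -preimage_sqnorm_compl /= in_itv.
have mDp := @measurable_punctured_disk R.
have m01 : measurable (`]0, 1[%classic : set (measurableTypeR R)) by exact: measurable_itv.
have mf : measurable_fun Dp f.
  apply: (@eq_measurable_fun _ _ _ _ _ (k \o (@sqnorm_compl R))).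
    by move=> v; rewrite inE => /fk.
  apply: (measurable_comp (F := `]0, 1[%classic : set (measurableTypeR R))) => //.
    by move=> _ [v Dv <-]; move: Dv; rewrite -preimage_sqnorm_compl.
  by apply: measurable_funTS; exact: measurable_sqnorm_compl.
have E : (\int[lebesgue_plane]_(v in Dp) (f v)%:E =
    pi%:E * \int[leb]_(t in `]0%R, 1%R[) (k t)%:E)%E.
  rewrite -(@ge0_integral_sqnorm_compl _ (EFin \o k)) //; last first.
    exact/measurable_EFinP.
  rewrite preimage_sqnorm_compl; apply: eq_integral => v; rewrite inE => Dv.
  by rewrite fk.
have fin := integrable_fin_num m01 ki.
split; last first.
  by rewrite /Rintegral E fineM //.
apply/integrableP; split; first exact/measurable_EFinP.
rewrite (_ : (\int[lebesgue_plane]_(v in Dp) _)%E =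
    \int[lebesgue_plane]_(v in Dp) (f v)%:E)%E.
  by rewrite E -[X in (_ * X)%E]fineK // -EFinM ltry.
by apply: eq_integral => v; rewrite inE => Dv /=; rewrite ger0_norm ?f0.
Qed.

Lemma weight_moment n v : Dp v ->
  normc (to_complex v) ^+ (2 * n) * weight_plane v =
  (pi * Beta (alpha + 1) (beta + 1))^-1 *
    beta_density alpha (beta + n%:R) (sqnorm_compl v).
Proof.
rewrite punctured_diskE /= => /andP[]; set r := normc (to_complex v) => r0 r1.
rewrite sqnorm_compl_normc -/r /beta_density subKr /weight_plane /weight -/r.
rewrite powRDs ?exprn_gt0 // powRrM powR_mulrn ?(ltW r0) //.
by rewrite powR_mulrn ?sqr_ge0 // exprM invfM; ring.
Qed.

Lemma integral_moment n :
  lebesgue_plane.-integrable Dp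
    (EFin \o (fun v => normc (to_complex v) ^+ (2 * n) * weight_plane v)) /\
  \int[lebesgue_plane]_(v in Dp) (normc (to_complex v) ^+ (2 * n) * weight_plane v)
  = moment n.
Proof.
have bn : -1 < beta + n%:R by rewrite (lt_le_trans beta_gt) // lerDl.
have B0 : 0 < Beta (alpha + 1) (beta + 1) by exact: Beta_gt0.
have c0 : 0 <= (pi * Beta (alpha + 1) (beta + 1))^-1.
  by rewrite invr_ge0 mulr_ge0 ?pi_ge0 // ltW.
have m01 : measurable (`]0, 1[%classic : set (measurableTypeR R)) by exact: measurable_itv.
have ib := integrable_beta_density alpha_gt bn.
have [||v Dv|fi ->] := @ge0_integrable_sqnorm_compl
  (fun t => (pi * Beta (alpha + 1) (beta + 1))^-1 * beta_density alpha (beta + n%:R) t)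
  (fun v => normc (to_complex v) ^+ (2 * n) * weight_plane v).
- by move=> t _; rewrite mulr_ge0 // mulr_ge0 ?powR_ge0.
- exact: integrableRZ.
- exact: weight_moment.
split=> //; rewrite RintegralZl // -BetaE invfM !mulrA divff ?gt_eqF ?pi_gt0 // mul1r.
by rewrite mulrC.
Qed.

Lemma rotation_punctured t v : Dp (rotation t v) <-> Dp v.
Proof.
rewrite punctured_diskE.
rewrite -[X in X <-> _]/(is_true (0 < normc (to_complex (rotation t v)) < 1)).
by rewrite to_complex_rotation mulrC normc_mul_cis.
Qed.

Lemma weight_plane_rotation t v : weight_plane (rotation t v) = weight_plane v.
Proof.
by rewrite /weight_plane /weight to_complex_rotation normcM normc_cis mul1r.
Qed.

(** By rotation invariance F may be replaced by its circle means, which leaves a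
moment of the weight. *)
Lemma disk_integral_circle (F : R[i] -> R[i]) (n : nat) (a : R[i]) :
  (forall z, punctured_disk z -> ccontinuous_at F z) ->
  disk_integrable mu F ->
  (forall w, punctured_disk w -> circle_int F w = (normc w ^+ (2 * n))%:C * a) ->
  (pi *+ 2)%:C * disk_integral mu F = (moment n)%:C * a.
Proof.
move=> cF iF Fa.
have mDp := @measurable_punctured_disk R.
have mF : Cmeasurable Dp (F \o to_complex).
  exact: (Cmeasurable_ccontinuous (@copen_punctured_disk R)).
rewrite disk_integral_density //.
move/(disk_integrable_density alpha beta mF) : iF => [i1 i2].
have [im Em] := integral_moment n.
have circF v : Dp v -> Cintegrable leb `[- pi, pi] (fun t => F (to_complex v * cis t)).
  move=> Dv; apply: circle_Cintegrable => z zv; apply: cF.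
  by move: Dv; rewrite punctured_diskE /= zv.
(* p is the real or the imaginary part *)
have key (p : R[i] -> R) : (forall r z, p (r%:C * z) = r * p z) ->
   (forall z r, p (z * r%:C) = p z * r) ->
   lebesgue_plane.-integrable Dp
     (EFin \o (fun v => p (F (to_complex v) * (weight_plane v)%:C))) ->
   (forall v, Dp v -> leb.-integrable `[- pi, pi]
     (EFin \o (fun t => p (F (to_complex v * cis t)))) /\
     \int[leb]_(t in `[- pi, pi]) p (F (to_complex v * cis t)) =
     p (circle_int F (to_complex v))) ->
   pi *+ 2 * \int[lebesgue_plane]_(v in Dp) p (F (to_complex v) * (weight_plane v)%:C)
   = moment n * p a.
  move=> pl pr ip pc.
  pose f0 v := p (F (to_complex v) * (weight_plane v)%:C).
  pose m0 v := normc (to_complex v) ^+ (2 * n) * weight_plane v.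
  have fi : lebesgue_plane.-integrable setT (EFin \o (f0 \_ Dp)).
    by rewrite -restrict_EFin; apply/(integrable_mkcond _ mDp); exact: ip.
  have mi : measurable (`[- pi, pi]%classic : set (measurableTypeR R)).
    exact: measurable_itv.
  have [v|_] := @integral_rotation_average _ (f0 \_ Dp) (fun v => p a * (m0 \_ Dp) v) fi.
    have [Dv|Dv] := pselect (Dp v); last first.
      have f00 t : (f0 \_ Dp) (rotation t v) = 0.
        by rewrite /patch memNset // => /rotation_punctured.
      have -> : (fun t => (f0 \_ Dp) (rotation t v)) = fun=> 0 by exact/funext.
      rewrite Rintegral_cst // mul0r.
      split; first exact: integrable0.
      by rewrite /patch memNset // mulr0.
    have fE t : (f0 \_ Dp) (rotation t v) =
        weight_plane v * p (F (to_complex v * cis t)).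
      rewrite /patch mem_set; [|by apply/rotation_punctured].
      by rewrite /f0 weight_plane_rotation to_complex_rotation pr mulrC (mulrC (cis t)).
    have [pi1 pi2] := pc v Dv.
    rewrite (_ : (fun t => _) = fun t => weight_plane v * p (F (to_complex v * cis t)));
      last exact/funext.
    split; first exact: integrableRZ.
    rewrite RintegralZl // pi2 Fa // pl /patch mem_set // /m0.
    by rewrite mulrA [LHS]mulrC (mulrC (weight_plane v)).
  move=> H; have -> : \int[lebesgue_plane]_(v in Dp) f0 v =
      \int[lebesgue_plane]_v (f0 \_ Dp) v by rewrite Rintegral_mkcond.
  rewrite -H RintegralZl //; last first.
    by rewrite -restrict_EFin; apply/(integrable_mkcond _ mDp); exact: im.
  have -> : \int[lebesgue_plane]_v (m0 \_ Dp) v =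
      \int[lebesgue_plane]_(v in Dp) m0 v by rewrite [RHS]Rintegral_mkcond.
  by rewrite Em mulrC.
rewrite /Cint; apply/eqP; rewrite eq_complex /= !mul0r subr0 addr0; apply/andP.
split; apply/eqP; rewrite ?subr0.
  rewrite (key (@complex.Re R)) //.
  - by rewrite Re_mul /= mul0r subr0.
  - by move=> r z; rewrite Re_mul /= mul0r subr0.
  - by move=> r z; rewrite Re_mul /= mulr0 subr0.
  - by move=> v Dv; split => //; case: (circF v Dv).
rewrite (key (@complex.Im R)) //.
- by rewrite Im_mul /= mul0r addr0.
- by move=> r z; rewrite Im_mul /= mul0r addr0.
- by move=> r z; rewrite Im_mul /= mulr0 add0r.
- by move=> v Dv; split => //; case: (circF v Dv).
Qed.

End Moments.

(** * Circle integrals near the origin *)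

Section VanishingMean.
Context {R : realType}.
Local Notation leb := (@lebesgue_measure R).
Local Notation Dp := (to_complex @^-1` @punctured_disk R : set (plane R)).

Definition small_annulus (e : R) : set R[i] := [set z | 0 < normc z < e].
Local Notation Ae e := (to_complex @^-1` small_annulus e : set (plane R)).

Lemma measurable_small_annulus e : measurable (Ae e).
Proof. by apply: measurable_copen; exact: copen_annulus. Qed.

Lemma integral_onem_inv_lower (s d : R) : 0 < d -> d <= s -> s < 1 ->
  (\int[leb]_(t in `[(1 - s)%R, (1 - d)%R]) ((1 - t) `^ (-1))%R%:E
   = (ln s - ln d)%R%:E)%E.
Proof.
move=> d0; rewrite le_eqVlt => /orP[/eqP <- _|ds s1].
  by rewrite set_itv1 integral_set1 subrr.
have s0 : 0 < s by exact: lt_trans ds.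
have dF (t : R) : t < 1 -> is_derive t 1 (fun t : R => - ln (1 - t)) ((1 - t) `^ (-1)).
  move=> t1; have t0 : 0 < 1 - t by rewrite subr_gt0.
  have d1 : is_derive (1 - t) 1 (@ln R) (1 - t)^-1 by exact: is_derive1_ln.
  have d2 : is_derive t 1 (fun s : R => 1 - s) (- 1).
    by apply: is_derive_eq; rewrite add0r mul1r.
  have d3 := @is_derive1_comp _ (@ln R) (fun s : R => 1 - s) t _ _ d1 d2.
  by apply: is_derive_eq; rewrite mulrN1 opprK powR_inv1 // ltW.
have cF (t : R) : t < 1 -> {for t, continuous (fun t : R => - ln (1 - t))}.
  by move=> t1; apply: differentiable_continuous; apply/derivable1_diffP;
    case: (dF _ t1).
have sd : 1 - s < 1 - d by lra.
rewrite (@continuous_FTC2 _ _ (fun t : R => - ln (1 - t)) _ _ sd).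
- by rewrite !subKr -EFinB; congr (_%:E); ring.
- apply: continuous_in_subspaceT => t; rewrite inE /= in_itv /= => /andP[_ t1].
  by apply: continuous_onem_powR; lra.
- split.
  + move=> t; rewrite in_itv /= => /andP[_ t1].
    by have [] // := dF t; lra.
  + by apply: cvg_at_right_filter; apply: cF; lra.
  + by apply: cvg_at_left_filter; apply: cF; lra.
- move=> t; rewrite in_itv /= => /andP[_ t1].
  have t1' : t < 1 by lra.
  by rewrite derive1E; have dFt := dF _ t1'; apply: derive_val.
Qed.

(** In the variable t = 1 - |w|^2, in which the area is uniform, this is the
divergence of the integral of 1 / (1 - t) at 1. *)
Lemma inv_sqnorm_not_integrable (e : R) : 0 < e -> e <= 1 ->
  ~ lebesgue_plane.-integrable (Ae e) (EFin \o (fun v => (normc (to_complex v) ^+ 2)^-1)).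
Proof.
move=> e0 e1 /integrableP[mf fi].
have sub : Ae e `<=` Dp.
  by move=> v; rewrite punctured_diskE /= => /andP[-> h]; rewrite (lt_le_trans h).
have mDp := @measurable_punctured_disk R; have mA := measurable_small_annulus e.
set I : set (measurableTypeR R) := `](1 - e ^+ 2), 1[%classic.
pose k (t : R) := (1 - t) `^ (-1) * \1_I t.
have e2 : 0 < e ^+ 2 by rewrite exprn_gt0.
have e21 : e ^+ 2 <= 1 by rewrite expr_le1 // ltW.
have mI : measurable I by exact: measurable_itv.
have m01 : measurable (`]0, 1[%classic : set (measurableTypeR R)) by exact: measurable_itv.
have mk : measurable_fun (`]0, 1[%classic : set (measurableTypeR R)) k.
  apply: measurable_funM; last by apply: measurable_funTS; exact: measurable_indic.
  apply: open_continuous_measurable_fun; first exact: interval_open.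
  by move=> t; rewrite inE /= in_itv /= => /andP[_ t1]; exact: continuous_onem_powR.
have k0 (t : R) : 0 <= k t by rewrite mulr_ge0 ?powR_ge0.
have kE : (\int[lebesgue_plane]_(v in sqnorm_compl @^-1` `]0%R, 1%R[) (k (sqnorm_compl v))%:E =
    \int[lebesgue_plane]_(v in Ae e) (normc (to_complex v) ^+ 2)^-1%:E)%E.
  rewrite preimage_sqnorm_compl -(setIidr sub) [RHS]integral_mkcondr.
  apply: eq_integral => v; rewrite inE => Dv; rewrite /patch /k sqnorm_compl_normc subKr.
  have n0 : 0 < normc (to_complex v) by rewrite normc_gt0; case: Dv.
  set n := normc (to_complex v) in n0 *.
  have IE : I (1 - n ^+ 2) <-> n < e.
    rewrite /I /= in_itv /= ltrD2l ltrN2 ltr_pXn2r ?nnegrE ?(ltW n0) ?(ltW e0) //.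
    by rewrite ltrBlDr ltrDl exprn_gt0 // andbT.
  rewrite powR_inv1 ?sqr_ge0 // indicE; case: ifPn => vA.
    rewrite mem_set ?mulr1 //; apply/IE.
    by move: vA; rewrite inE => /andP[].
  rewrite memNset ?mulr0 // => /IE vI; move/negP: vA; apply; rewrite inE.
  by apply/andP.
have kfin : (\int[leb]_(t in `]0%R, 1%R[) (k t)%:E < +oo)%E.
  have mk' : measurable_fun (`]0, 1[%classic : set (measurableTypeR R)) (EFin \o k).
    exact/measurable_EFinP.
  have H := ge0_integral_sqnorm_compl mk' (fun t _ => k0 t).
  rewrite [LHS]kE in H.
  have pi0 := @pi_gt0 R.
  have : (pi%:E * \int[leb]_(t in `]0%R, 1%R[) (k t)%:E < +oo)%E.
    rewrite -H; apply: le_lt_trans fi; apply: ge0_le_integral => //.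
    - by move=> v _; rewrite lee_fin invr_ge0 sqr_ge0.
    - exact: measurableT_comp.
    - by move=> v _; rewrite lee_abs.
  case: (integral _ _ _) => [r _|h|//]; first exact: ltry.
  by rewrite gt0_muley ?lte_fin in h.
(* d is chosen so that the integral of 1 / (1 - t) from 1 - s to 1 - d is M + 1 *)
set M := fine (\int[leb]_(t in `]0%R, 1%R[) (k t)%:E)%E.
have M0 : 0 <= M by apply: fine_ge0; apply: integral_ge0 => t _; rewrite lee_fin.
pose s := e ^+ 2 / 2; pose d := s * expR (- (M + 1)).
have s0 : 0 < s by rewrite divr_gt0.
have d0 : 0 < d by rewrite mulr_gt0 ?expR_gt0.
have ds : d <= s by rewrite ler_piMr ?(ltW s0) // expR_le1; lra.
have s1 : s < 1 by rewrite /s; lra.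
have : (\int[leb]_(t in `[(1 - s)%R, (1 - d)%R]) ((1 - t) `^ (-1))%R%:E <= M%:E)%E.
  rewrite /M fineK; last first.
    by rewrite ge0_fin_numE //; apply: integral_ge0 => t _; rewrite lee_fin.
  apply: (@le_trans _ _ (\int[leb]_(t in `[(1 - s)%R, (1 - d)%R]) (k t)%:E)%E).
    rewrite le_eqVlt; apply/orP; left; apply/eqP; apply: eq_integral => t.
    rewrite inE /= in_itv /= => /andP[t1 t2]; rewrite /k indicE mem_set ?mulr1 //.
    by rewrite /I /= in_itv /=; apply/andP; split; rewrite /s in t1 *; lra.
  have msd : measurable (`[(1 - s), (1 - d)]%classic : set (measurableTypeR R)).
    exact: measurable_itv.
  apply: (ge0_subset_integral leb msd m01).
  - exact/measurable_EFinP.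
  - by move=> t _; rewrite lee_fin.
  - by move=> t /=; rewrite !in_itv /= => /andP[t1 t2]; lra.
rewrite integral_onem_inv_lower // lee_fin /d lnM ?posrE ?expR_gt0 // expRK.
by lra.
Qed.

(** By convexity the integral of |h|^2 over a circle is at least
|c|^2 / (2 pi). If c were nonzero, averaging |h|^2 / |w|^2 over rotations would
bound 1 / |w|^2 by an integrable function. *)
Lemma circle_mean_vanishes (h : R[i] -> R[i]) (c : R[i]) (e : R) :
  0 < e -> e <= 1 ->
  (forall z, small_annulus e z -> ccontinuous_at h z) ->
  (forall w, small_annulus e w -> circle_int h w = c) ->
  lebesgue_plane.-integrable (Ae e)
    (EFin \o (fun v => normc (h (to_complex v)) ^+ 2 / normc (to_complex v) ^+ 2)) ->
  c = 0.
Proof.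
move=> e0 e1 ch hc hi; apply: eq0_normc; apply: contrapT => /eqP c0.
have {c0}c0 : 0 < normc c by rewrite lt_neqAle eq_sym c0 normc_ge0.
have mA := measurable_small_annulus e.
apply: (inv_sqnorm_not_integrable e0 e1).
pose f0 (v : plane R) : R := normc (h (to_complex v)) ^+ 2 / normc (to_complex v) ^+ 2.
pose phi (v : plane R) : R := \int[leb]_(t in `[- pi, pi]) (f0 \_ (Ae e)) (rotation t v).
have fi : lebesgue_plane.-integrable setT (EFin \o (f0 \_ (Ae e))).
  by rewrite -restrict_EFin; apply/(integrable_mkcond _ mA); exact: hi.
have rotA t v : Ae e (rotation t v) <-> Ae e v.
  rewrite -[X in X <-> _]/(is_true (0 < normc (to_complex (rotation t v)) < e)).
  by rewrite to_complex_rotation mulrC normc_mul_cis.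
have mi : measurable (`[- pi, pi]%classic : set (measurableTypeR R)).
  exact: measurable_itv.
have pi2 : 0 < pi *+ 2 :> R by rewrite mulrn_wgt0 // pi_gt0.
have fE v t : Ae e v -> (f0 \_ (Ae e)) (rotation t v) =
    (normc (to_complex v) ^+ 2)^-1 * normc (h (to_complex v * cis t)) ^+ 2.
  move=> Av; rewrite /patch mem_set; [|by apply/rotA].
  by rewrite /f0 to_complex_rotation mulrC (mulrC (cis t)) normc_mul_cis.
have hcont v : Ae e v -> forall t, path_continuous_at (fun t => h (to_complex v * cis t)) t.
  by move=> Av; apply: circle_path_continuous => z zv; apply: ch; rewrite /small_annulus /= zv.
have sq_int v : Ae e v ->
    leb.-integrable `[- pi, pi] (EFin \o (fun t => normc (h (to_complex v * cis t)) ^+ 2)).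
  move=> Av; apply: continuous_compact_integrable; first exact: segment_compact.
  pose H t := h (to_complex v * cis t).
  rewrite (_ : (fun t => _) = fun t => complex.Re (H t) * complex.Re (H t) +
      complex.Im (H t) * complex.Im (H t)); last first.
    by apply/funext => t; rewrite normc_sqr !expr2.
  apply: continuous_subspaceT => t.
  have c1 : {for t, continuous (fun t => complex.Re (H t))}.
    exact: path_continuous_Re (hcont v Av t).
  have c2 : {for t, continuous (fun t => complex.Im (H t))}.
    exact: path_continuous_Im (hcont v Av t).
  exact: (cvgD (cvgM c1 c1) (cvgM c2 c2)).
have [|iphi _] := @integral_rotation_average _ (f0 \_ (Ae e)) phi fi.
  move=> v; split=> //; have [Av|Av] := pselect (Ae e v).
    rewrite (_ : (fun t => _) = fun t => (normc (to_complex v) ^+ 2)^-1 *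
      normc (h (to_complex v * cis t)) ^+ 2); last by apply/funext => t; exact: fE.
    exact: integrableRZ (sq_int v Av).
  rewrite (_ : (fun t => _) = fun=> 0); first exact: integrable0.
  by apply/funext => t; rewrite /patch memNset // => /rotA.
have low v : Ae e v ->
    (normc (to_complex v) ^+ 2)^-1 <= pi *+ 2 / normc c ^+ 2 * phi v.
  move=> Av; have phiE : phi v = (normc (to_complex v) ^+ 2)^-1 *
      \int[leb]_(t in `[- pi, pi]) normc (h (to_complex v * cis t)) ^+ 2.
    rewrite -RintegralZl //; last exact: sq_int.
    by apply: eq_Rintegral => t _; exact: fE.
  set J := \int[leb]_(t in `[- pi, pi]) _ in phiE.
  suff : 1 <= pi *+ 2 / normc c ^+ 2 * J.
    rewrite phiE mulrCA => hJ; rewrite -[leLHS]mulr1 ler_wpM2l ?invr_ge0 ?sqr_ge0 //.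
  rewrite mulrAC ler_pdivlMr ?exprn_gt0 // mul1r.
  have [F1 F2] : Cintegrable leb `[- pi, pi] (fun t => h (to_complex v * cis t)).
    by apply: path_continuous_Cintegrable => t _; exact: hcont.
  (* the square of the modulus is convex: compare it with its tangent at the mean *)
  pose k : R[i] := c / (pi *+ 2)%:C.
  have tangent (z : R[i]) : 2 * (complex.Re k * complex.Re z + complex.Im k * complex.Im z)
      - normc k ^+ 2 <= normc z ^+ 2.
    have : 0 <= normc (z - k) ^+ 2 by rewrite sqr_ge0.
    by rewrite !normc_sqr Re_add Im_add Re_opp Im_opp; lra.
  have : \int[leb]_(t in `[- pi, pi]) (2 * (complex.Re k * complex.Re (h (to_complex v * cis t))
      + complex.Im k * complex.Im (h (to_complex v * cis t))) - normc k ^+ 2) <= J.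
    apply: le_Rintegral => //.
      apply: integrableRB => //.
        apply: integrableRZ => //; apply: integrableRD => //; exact: integrableRZ.
      apply: continuous_compact_integrable; first exact: segment_compact.
      by apply: continuous_subspaceT => t; exact: cst_continuous.
    exact: sq_int.
  have icst : leb.-integrable `[- pi, pi] (EFin \o (fun=> normc k ^+ 2)).
    apply: continuous_compact_integrable; first exact: segment_compact.
    by apply: continuous_subspaceT => t; exact: cst_continuous.
  have i1 : leb.-integrable `[- pi, pi]
    (EFin \o (fun t => complex.Re k * complex.Re (h (to_complex v * cis t)))).
    exact: integrableRZ.
  have i2 : leb.-integrable `[- pi, pi]
    (EFin \o (fun t => complex.Im k * complex.Im (h (to_complex v * cis t)))).
    exact: integrableRZ.
  have cstE : \int[leb]_(t in `[- pi, pi]) normc k ^+ 2 = normc k ^+ 2 * (pi - - pi).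
    by apply: Rintegral_itv_cst; have := pi_gt0 R; lra.
  rewrite RintegralB //; last by apply: integrableRZ => //; exact: integrableRD.
  rewrite [X in _ - X]cstE RintegralZl //; last exact: integrableRD.
  rewrite RintegralD // !RintegralZl //.
  have := hc _ Av; rewrite /circle_int /Cint => cE.
  have -> : \int[leb]_(t in `[- pi, pi]) complex.Re (h (to_complex v * cis t)) = complex.Re c.
    by rewrite -cE.
  have -> : \int[leb]_(t in `[- pi, pi]) complex.Im (h (to_complex v * cis t)) = complex.Im c.
    by rewrite -cE.
  have -> : pi - - pi = pi *+ 2 :> R by rewrite opprK mulr2n.
  have kR : complex.Re k = complex.Re c / (pi *+ 2).
    by rewrite /k -fmorphV Re_mul /= mulr0 subr0.
  have kI : complex.Im k = complex.Im c / (pi *+ 2).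
    by rewrite /k -fmorphV Im_mul /= mulr0 add0r.
  rewrite (normc_sqr k) kR kI => hJ.
  rewrite (normc_sqr c) [leRHS]mulrC -ler_pdivrMr //; apply: le_trans hJ.
  have alg (P x y : R) : P != 0 -> (x ^+ 2 + y ^+ 2) / P =
      2 * (x / P * x + y / P * y) - ((x / P) ^+ 2 + (y / P) ^+ 2) * P.
    by move=> P0; field.
  by rewrite alg ?gt_eqF.
apply: (@integrable_dominated _ _ _ lebesgue_plane _ mA _
  (fun v => pi *+ 2 / normc c ^+ 2 * phi v)).
- have hV : holomorphic_on (small_annulus e) (fun z => z^-1 ^+ 2).
    apply: (@holomorphicM _ _ (fun z => z^-1) (fun z => z^-1));
      by apply: (@holomorphicV _ _ id) => [z /= /andP[z0 _]|];
        [rewrite -normc_gt0|exact: holomorphic_id].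
  have [m1 m2] := Cmeasurable_ccontinuous (@copen_annulus R 0 e)
    (fun z => holomorphic_ccontinuous hV (z := z)).
  have := measurable_normc (conj m1 m2).
  apply: eq_measurable_fun => v _.
  by rewrite -[LHS]/(normc ((to_complex v)^-1 ^+ 2)) normcX normcV exprVn.
- move=> v Av; rewrite ger0_norm ?low // invr_ge0 sqr_ge0 //.
- apply: integrableRZ => //; exact: integrableS iphi.
Qed.

End VanishingMean.

(** * Dependence of circle integrals on the radius *)

Section CauchySeries.
Context {R : realType}.
Local Notation leb := (@lebesgue_measure R).
Local Notation Ae e := (to_complex @^-1` small_annulus e : set (plane R)).
Implicit Types (h g : R[i] -> R[i]).

Lemma punctured_diskP (z : R[i]) : punctured_disk z <-> 0 < normc z < 1.
Proof. by rewrite punctured_diskE. Qed.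

(** Uniform continuity, by compactness of the circle. *)
Lemma uniform_near_circle h (rho : R) : 0 < rho < 1 ->
  (forall z, punctured_disk z -> ccontinuous_at h z) ->
  forall e : R, 0 < e -> exists2 d : R, 0 < d & forall r, `|r - rho| < d ->
    forall t, - pi <= t <= pi -> normc (h (r%:C * cis t) - h (rho%:C * cis t)) < e.
Proof.
move=> /andP[rho0 rho1] ch e e0; have e2 : 0 < e / 2 by rewrite divr_gt0.
pose P (r t : R) := normc (h (r%:C * cis t) - h (rho%:C * cis t)) < e.
have nrho t : normc (rho%:C * cis t : R[i]) = rho.
  by rewrite normc_mul_cis normc_real gtr0_norm.
have cvr := (iffLR (compact_near_coveringP _)) (@segment_compact R (- pi) pi)
  R (nbhs rho) P _.
have /nbhs_ballP[d /= d0 dP] : \forall r \near rho, `[- pi, pi] `<=` P r.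
  apply: cvr => t0 _.
  have [d d0 dP] : exists2 d : R, 0 < d & forall w, normc (w - rho%:C * cis t0) < d ->
      normc (h w - h (rho%:C * cis t0)) < e / 2.
    by apply: ch => //; apply/punctured_diskP; rewrite nrho rho0.
  have d2 : 0 < d / 2 by rewrite divr_gt0.
  have [d' d'0 d'P] := plane_cderiv_continuous (@polar_cderiv R 0 t0 1) d2.
  have cisP t : `|t - t0| < d' -> normc (cis t - cis t0 : R[i]) < d / 2.
    move=> td; have := d'P 0 t; rewrite subrr normr0 => /(_ d'0 td).
    by rewrite /polar expR0 !mul1r.
  near=> t r; rewrite /P.
  have td : `|t - t0| < d' by near: t; apply/nbhs_ballP; exists d' => //= x; rewrite /ball /= distrC.
  have rd : `|r - rho| < d / 2 by near: r; apply/nbhs_ballP; exists (d / 2) => //= x; rewrite /ball /= distrC.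
  have h1 : normc (rho%:C * cis t - rho%:C * cis t0) < d / 2.
    rewrite -mulrBr normcM normc_real gtr0_norm //.
    apply: le_lt_trans (cisP t td); rewrite ler_piMl ?normc_ge0 // ltW //.
  have h2 : normc (r%:C * cis t - rho%:C * cis t0) < d.
    have -> : r%:C * cis t - rho%:C * cis t0 =
      (r - rho)%:C * cis t + (rho%:C * cis t - rho%:C * cis t0) by rewrite rmorphB /=; ring.
    apply: le_lt_trans (ler_normcD _ _) _; rewrite normc_mul_cis normc_real (splitr d).
    exact: ltrD.
  have -> : h (r%:C * cis t) - h (rho%:C * cis t) =
    (h (r%:C * cis t) - h (rho%:C * cis t0)) - (h (rho%:C * cis t) - h (rho%:C * cis t0)).
    by ring.
  apply: le_lt_trans (ler_normcB _ _) _; rewrite (splitr e).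
  by apply: ltrD; apply: dP => //; rewrite (lt_trans h1) // gtr_pMr // invf_lt1 // ltr1n.
exists d => // r rd t tI; apply: dP; first by rewrite /ball /= distrC.
by rewrite /= in_itv.
Unshelve. all: by end_near. Qed.

Lemma circle_int_continuous h (rho : R) : 0 < rho < 1 ->
  (forall z, punctured_disk z -> ccontinuous_at h z) ->
  forall e : R, 0 < e -> exists2 d : R, 0 < d & forall r, `|r - rho| < d -> 0 < r < 1 ->
    normc (circle_int h r%:C - circle_int h rho%:C) <= e * (pi *+ 2).
Proof.
move=> rho01 ch e e0; have [d d0 dP] := uniform_near_circle rho01 ch e0.
have ci r : 0 < r < 1 -> Cintegrable leb `[- pi, pi] (fun t => h (r%:C * cis t)).
  move=> r01; apply: circle_Cintegrable => z zr; apply: ch.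
  by apply/punctured_diskP; rewrite zr normc_real gtr0_norm //; case/andP: r01.
have mi : measurable (`[- pi, pi]%classic : set (measurableTypeR R)).
  exact: measurable_itv.
have pp : - pi <= pi :> R by have := pi_ge0 R; lra.
exists d => // r rd r01; rewrite /circle_int -CintB //; [|exact: ci|exact: ci].
have -> : pi *+ 2 = pi - - pi :> R by rewrite opprK mulr2n.
apply: ler_normc_Cint_itv => //; first by apply: CintegrableB => //; exact: ci.
by move=> t tI; apply: ltW; exact: dP.
Qed.

Lemma holomorphic_inv_pow (U : set R[i]) n : (forall z, U z -> z != 0) ->
  holomorphic_on U (fun z => z^-1 ^+ n).
Proof.
move=> U0; have hV : holomorphic_on U (fun z : R[i] => z^-1).
  by apply: (@holomorphicV _ _ id) => //; exact: holomorphic_id.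
elim: n => [|n IH]; first exact: holomorphic_cst.
have -> : (fun z : R[i] => z^-1 ^+ n.+1) = (fun z => z^-1 * z^-1 ^+ n).
  by apply/funext => z; rewrite exprS.
exact: (@holomorphicM _ U (fun z => z^-1) (fun z => z^-1 ^+ n) hV IH).
Qed.

(** Doubling the radius multiplies the integral by 2^-n, yet by holomorphy does
not change it. *)
Lemma circle_int_inv_pow (n : nat) (w : R[i]) : w != 0 ->
  circle_int (fun z => z^-1 ^+ n) w = if n is 0%N then (pi *+ 2)%:C else 0.
Proof.
have i0 : 0 <= (2^-1 : R) by rewrite invr_ge0.
have i1 : (2^-1 : R) < 1 by rewrite invf_lt1 // ltr1n.
move=> w0; have pp : - pi <= pi :> R by have := pi_ge0 R; lra.
case: n => [|n].
  rewrite /circle_int; under eq_Cint do rewrite expr0.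
  by rewrite Cint_itv_cst // mul1r opprK mulr2n.
pose p z : R[i] := z^-1 ^+ n.+1.
have hV : holomorphic_on [set z | 0 < normc z < normc w + 3] (p : R[i] -> R[i]).
  by apply: holomorphic_inv_pow => z /= /andP[z0 _]; rewrite -normc_gt0.
have nw : 0 < normc w by rewrite normc_gt0.
have n2 : normc (2 : R[i]) = 2.
  by rewrite (_ : 2 = (2 : R)%:C) ?normc_real ?ger0_norm // rmorph_nat.
have E2 : circle_int p 2 = 2^-1 ^+ n.+1 * circle_int p 1.
  rewrite /circle_int -CintZ; first last.
  - apply: circle_Cintegrable => z z1; apply: (holomorphic_ccontinuous hV) => /=.
    by rewrite z1 normc1; lra.
  - exact: measurable_itv.
  by apply: eq_Cint => t _; rewrite /p mul1r invfM exprMn.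
have E1 : circle_int p 1 = circle_int p 2.
  by apply: (circle_int_annulus (le_refl 0) hV); rewrite ?normc1 ?n2; lra.
have : (1 - 2^-1 ^+ n.+1) * circle_int p 1 = 0.
  by rewrite mulrBl mul1r -E2 E1 subrr.
move/eqP; rewrite mulf_eq0 => /orP[/eqP h|/eqP h].
  have hn : normc (2^-1 ^+ n.+1 : R[i]) < 1.
    rewrite normcX normcV n2.
    by rewrite (@exprn_ilt1 _ n.+1 _ i0 i1).
  have hE : (2^-1 ^+ n.+1 : R[i]) = 1 by apply/esym/eqP; rewrite -subr_eq0; apply/eqP.
  by exfalso; move: hn; rewrite hE normc1 ltxx.
rewrite -h; apply: (circle_int_annulus (le_refl 0) hV); rewrite ?normc1; lra.
Qed.

(** * Difference quotients *)

(** On a circle dw = i w dt, so that up to the factor i the circle integral of this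
function is the contour integral of (g w - g z0) / (w - z0). The parameter l is
meant to be the derivative of g at z0, which makes the function continuous
there. *)
Definition diff_quot g (z0 l w : R[i]) : R[i] :=
  if w == z0 then z0 * l else w * (g w - g z0) / (w - z0).

Lemma diff_quot_holomorphic g z0 l : holomorphic_on punctured_disk g ->
  holomorphic_on [set z | punctured_disk z /\ z != z0] (diff_quot g z0 l).
Proof.
move=> hg; apply: (@eq_holomorphic _ _ (fun w => w * (g w - g z0) * (w - z0)^-1)).
- move=> z [Dz zz0]; have [d d0 dP] := copen_punctured_disk Dz.
  exists (Num.min d (normc (z - z0))); first by rewrite lt_min d0 normc_gt0 subr_eq0.
  move=> w; rewrite lt_min => /andP[wd wz]; split; first exact: dP.
  by apply: contraTneq wz => ->; rewrite normc_distC ltxx.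
- by move=> z [_ /negbTE zz0]; rewrite /diff_quot zz0.
- apply: holomorphicM.
    apply: holomorphicM; first exact: holomorphic_id.
    by apply: holomorphicB; [apply: subset_holomorphic hg => z []|exact: holomorphic_cst].
  apply: holomorphicV => [z [_ zz0]|]; first by rewrite subr_eq0.
  by apply: holomorphicB; [exact: holomorphic_id|exact: holomorphic_cst].
Qed.

Lemma diff_quot_continuous g z0 l : holomorphic_on punctured_disk g ->
  cderiv_at g z0 l -> punctured_disk z0 ->
  forall z, punctured_disk z -> ccontinuous_at (diff_quot g z0 l) z.
Proof.
move=> hg gl /punctured_diskP/andP[_ z01] z Dz.
have [->|zz0] := eqVneq z z0; last first.
  exact: (holomorphic_ccontinuous (diff_quot_holomorphic (l := l) hg)).
move=> e e0; have e8 : 0 < e / 8 by rewrite divr_gt0.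
have [d d0 dP] := gl _ e8; have l0 := normc_ge0 l.
have l1 : 0 < 2 * (1 + normc l) by rewrite mulr_gt0 // ltr_pwDl.
exists (Num.min d (Num.min 1 (e / (2 * (1 + normc l))))).
  by rewrite !lt_min d0 ltr01 divr_gt0.
move=> w; rewrite !lt_min => /and3P[wd w1 we].
rewrite [X in _ - X]/diff_quot eqxx /diff_quot.
have [_|wz] := eqVneq w z0; first by rewrite subrr normc0.
have wz0 : w - z0 != 0 by rewrite subr_eq0.
have -> : w * (g w - g z0) / (w - z0) - z0 * l =
  w * ((g w - g z0 - l * (w - z0)) / (w - z0)) + (w - z0) * l.
  have -> : (g w - g z0 - l * (w - z0)) / (w - z0) = (g w - g z0) / (w - z0) - l.
    by rewrite mulrBl mulfK.
  rewrite -mulrA.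
  by set Q := _ / (w - z0); ring.
apply: le_lt_trans (ler_normcD _ _) _; rewrite !normcM.
have a1 : normc ((g w - g z0 - l * (w - z0)) / (w - z0)) <= e / 8.
  by rewrite normc_div ler_pdivrMr ?normc_gt0 //; exact: dP.
have a2 : normc w <= 2.
  by have := ler_normcD (w - z0) z0; rewrite subrK; lra.
have a3 : normc w * normc ((g w - g z0 - l * (w - z0)) / (w - z0)) <= 2 * (e / 8).
  by apply: ler_pM; rewrite ?normc_ge0.
have a4 : normc (w - z0) * normc l <= e / 2.
  move: we; rewrite ltr_pdivlMr // => we.
  have := normc_ge0 (w - z0); nra.
by rewrite -normcM; lra.
Qed.

Lemma integrable_small_annulus_cst (e k : R) :
  lebesgue_plane.-integrable (Ae e) (EFin \o (fun=> k)).
Proof.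
have mA := measurable_small_annulus e.
apply/integrableP; split; first by apply/measurable_EFinP; exact: measurable_cst.
have Ae_fin : (lebesgue_plane (Ae e) < +oo)%E.
  apply: (@le_lt_trans _ _ (lebesgue_plane (open_disk (e ^+ 2)))); last first.
    by rewrite area_open_disk ltry.
  apply: le_measure; rewrite ?inE //; first exact: measurable_open_disk.
  move=> v /andP[v0 ve]; rewrite /open_disk /=.
  have -> : v.1 ^+ 2 + v.2 ^+ 2 = normc (to_complex v) ^+ 2 by rewrite normc_sqr.
  by rewrite ltr_pXn2r // nnegrE ltW // (lt_trans v0).
under eq_integral do rewrite /= -/(abse _).
by rewrite integral_cst // lte_mul_pinfty // lee_fin.
Qed.

(** Near the origin w - z0 is bounded away from 0, so that the square integrability
of g is inherited by the difference quotient divided by w. *)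
Lemma diff_quot_inner g (e0 : R) z0 l : holomorphic_on punctured_disk g ->
  cderiv_at g z0 l -> punctured_disk z0 -> 0 < e0 -> e0 <= 1 ->
  lebesgue_plane.-integrable (Ae e0) (EFin \o (fun v => normc (g (to_complex v)) ^+ 2)) ->
  forall w, 0 < normc w < normc z0 -> circle_int (diff_quot g z0 l) w = 0.
Proof.
move=> hg gl Dz0 e00 e01 ig w wz0.
have [z00 z01] := andP (iffLR (punctured_diskP z0) Dz0).
set h := diff_quot g z0 l; set rho := normc z0 in z00 z01 wz0.
have hh : holomorphic_on [set z | 0 < normc z < rho] h.
  apply: subset_holomorphic (diff_quot_holomorphic (l := l) hg) => z /= /andP[zp zr].
  split; first by apply/punctured_diskP; rewrite zp (lt_trans zr).
  by apply: contraTneq zr => ->; rewrite ltxx.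
pose e := Num.min e0 (rho / 2).
have ep : 0 < e by rewrite lt_min e00 divr_gt0.
have ee : e <= e0 by rewrite ge_min lexx.
have er : e <= rho / 2 by rewrite ge_min lexx orbT.
have inn z : small_annulus e z -> 0 < normc z < rho.
  by move=> /andP[z1 z2]; apply/andP; split=> //; lra.
apply: (@circle_mean_vanishes _ h _ e ep) => //; first by lra.
- by move=> z ze; apply: (holomorphic_ccontinuous hh); exact: inn.
- by move=> z ze; apply: (circle_int_annulus (le_refl 0) hh) => //; exact: inn.
have mA := measurable_small_annulus e.
have Cm (F : R[i] -> R[i]) : (forall z, small_annulus e z -> ccontinuous_at F z) ->
    Cmeasurable (Ae e) (F \o to_complex).
  by move=> cF; apply: Cmeasurable_ccontinuous cF; exact: copen_annulus.
have m1 : Cmeasurable (Ae e) (h \o to_complex).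
  by apply: Cm => z ze; apply: (holomorphic_ccontinuous hh); exact: inn.
have m2 : Cmeasurable (Ae e) ((fun z => z^-1 ^+ 1) \o to_complex).
  apply: Cm => z ze; apply: (holomorphic_ccontinuous (U := small_annulus e)) ze.
  by apply: holomorphic_inv_pow => x /andP[x0 _]; rewrite -normc_gt0.
have m3 := measurable_normc (CmeasurableM m1 m2).
(* 8 / rho^2 is twice the square of the bound 2 / rho for 1 / |w - z0| *)
pose G (v : plane R) : R :=
  8 / rho ^+ 2 * (normc (g (to_complex v)) ^+ 2 + normc (g z0) ^+ 2).
apply: (@integrable_dominated _ _ _ lebesgue_plane _ mA _ G).
- have := measurable_funX 2 m3; apply: eq_measurable_fun => v _.
  rewrite -[LHS]/(normc (h (to_complex v) * (to_complex v)^-1 ^+ 1) ^+ 2).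
  by rewrite expr1 normcM normcV exprMn exprVn.
- move=> v Av; have vr := inn _ Av.
  set w0 := to_complex v in vr Av *; have {}Av : small_annulus e w0 by [].
  have w00 : 0 < normc w0 by case/andP: vr.
  rewrite ger0_norm ?divr_ge0 ?sqr_ge0 //.
  have wz : w0 != z0 by apply: contraTneq vr => ->; rewrite ltxx andbF.
  rewrite /h /diff_quot (negbTE wz) normc_div normcM.
  have far : rho / 2 <= normc (w0 - z0).
    have := lerB_normc z0 w0; rewrite normc_distC -/rho.
    by case/andP: Av => _; lra.
  have P0 : 0 < normc (w0 - z0) by lra.
  rewrite -!expr_div_n mulrAC.
  rewrite [normc w0 * _ / _]mulrC mulKf ?gt_eqF //.
  apply: (@le_trans _ _ ((normc (g w0 - g z0) / (rho / 2)) ^+ 2)).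
    rewrite ler_sqr ?nnegrE ?mulr_ge0 ?invr_ge0 ?normc_ge0 //; [|lra].
    by rewrite ler_wpM2l ?normc_ge0 // lef_pV2 ?posrE //; lra.
  have sq : normc (g w0 - g z0) ^+ 2 <= 2 * (normc (g w0) ^+ 2 + normc (g z0) ^+ 2).
    by rewrite -(normcN (g z0)); exact: sqr_normcD_le.
  rewrite /G expr_div_n -/w0.
  have -> : 8 / rho ^+ 2 * (normc (g w0) ^+ 2 + normc (g z0) ^+ 2) =
    2 * (normc (g w0) ^+ 2 + normc (g z0) ^+ 2) / (rho / 2) ^+ 2.
    by field; rewrite gt_eqF.
  by rewrite ler_wpM2r // invr_ge0 sqr_ge0.
- have i1 : lebesgue_plane.-integrable (Ae e)
      (EFin \o (fun v => normc (g (to_complex v)) ^+ 2)).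
    apply: (integrableS (measurable_small_annulus e0) mA _ ig).
    by move=> u /andP[v1 v2]; rewrite /= /small_annulus /= v1 (lt_le_trans v2).
  have i2 := integrable_small_annulus_cst e (normc (g z0) ^+ 2).
  have i3 := integrableRZ mA (8 / rho ^+ 2) (integrableRD mA i1 i2).
  exact: i3.
Qed.

(** Continuity of the circle means across the circle through z0 transports the
vanishing of the inner means to the outer ones. *)
Lemma diff_quot_outer g (e0 : R) z0 l : holomorphic_on punctured_disk g ->
  cderiv_at g z0 l -> punctured_disk z0 -> 0 < e0 -> e0 <= 1 ->
  lebesgue_plane.-integrable (Ae e0) (EFin \o (fun v => normc (g (to_complex v)) ^+ 2)) ->
  forall w, normc z0 < normc w < 1 -> circle_int (diff_quot g z0 l) w = 0.
Proof.
move=> hg gl Dz0 e00 e01 ig w wz0.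
have inner := diff_quot_inner hg gl Dz0 e00 e01 ig.
have hc := diff_quot_continuous hg gl Dz0.
have rho01 := iffLR (punctured_diskP z0) Dz0.
set h := diff_quot g z0 l in inner hc *; set rho := normc z0 in rho01 wz0 inner.
have [r0 r1] := andP rho01.
have hh : holomorphic_on [set z | rho < normc z < 1] h.
  apply: subset_holomorphic (diff_quot_holomorphic (l := l) hg) => z /= /andP[zp zr].
  split; first by apply/punctured_diskP; rewrite zr (lt_trans r0).
  by apply: contraTneq zp => ->; rewrite ltxx.
apply: eq0_normc; apply/eqP; rewrite eq_le normc_ge0 andbT.
apply/ler_addgt0Pr => e e_gt0; rewrite add0r.
have pi2 : 0 < pi *+ 2 :> R by rewrite mulrn_wgt0 // pi_gt0.
have e'0 : 0 < e / 2 / (pi *+ 2) by rewrite !divr_gt0.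
have [d d0 dP] := circle_int_continuous rho01 hc e'0.
pose m := Num.min (d / 2) (Num.min (rho / 2) ((1 - rho) / 2)).
have m0 : 0 < m by rewrite !lt_min !divr_gt0 //= subr_gt0.
have md : m <= d / 2 by rewrite /m !ge_min lexx.
have mr : m <= rho / 2 by rewrite /m !ge_min lexx !orbT.
have mr' : m <= (1 - rho) / 2 by rewrite /m !ge_min lexx !orbT.
have rm0 : 0 < rho - m by lra.
have rm1 : rho - m < rho by lra.
have rp0 : 0 < rho + m by lra.
have rp1 : rho < rho + m < 1 by apply/andP; split; lra.
have close r : `|r - rho| = m -> 0 < r < 1 ->
    normc (circle_int h r%:C - circle_int h rho%:C) <= e / 2.
  move=> rE r01; rewrite -[e / 2](divfK (lt0r_neq0 pi2)).
  by apply: dP => //; rewrite rE; lra.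
have I1 : normc (circle_int h (rho - m)%:C - circle_int h rho%:C) <= e / 2.
  apply: close; first by rewrite addrAC subrr add0r normrN gtr0_norm.
  by rewrite rm0 (lt_trans rm1).
have I2 : normc (circle_int h (rho + m)%:C - circle_int h rho%:C) <= e / 2.
  apply: close; first by rewrite addrAC subrr add0r gtr0_norm.
  by case/andP: rp1 => _ ->; rewrite rp0.
have E1 : circle_int h (rho - m)%:C = 0.
  by apply: inner; rewrite normc_real (gtr0_norm rm0) rm0 rm1.
have E2 : circle_int h w = circle_int h (rho + m)%:C.
  apply: (circle_int_annulus (ltW r0) hh wz0).
  by rewrite normc_real (gtr0_norm rp0).
rewrite E1 sub0r normcN in I1; rewrite E2.
rewrite -[X in normc X](subrK (circle_int h rho%:C)).
by apply: le_trans (ler_normcD _ _) _; rewrite (splitr e) lerD.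
Qed.

(** * Cauchy's formula as a power series *)

(** 2 pi times the Laurent coefficient of index n. The radius 1/2 is arbitrary, by
[circle_int_laurent]. *)
Definition laurent_coef g (n : nat) : R[i] :=
  circle_int (fun w => g w * w^-1 ^+ n) (2^-1)%:C.

Lemma circle_int_laurent g n w : holomorphic_on punctured_disk g ->
  punctured_disk w -> circle_int (fun w => g w * w^-1 ^+ n) w = laurent_coef g n.
Proof.
rewrite punctured_diskE => hg /= w01.
have hn : holomorphic_on [set z | 0 < normc z < 1] (fun w : R[i] => w^-1 ^+ n).
  by apply: holomorphic_inv_pow => x /andP[x0 _]; rewrite -normc_gt0.
apply: (circle_int_annulus (le_refl 0) (holomorphicM hg hn) w01).
by rewrite normc_real gtr0_norm ?invr_gt0 //; apply/andP; split; lra.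
Qed.

Lemma finite_geometric_sum (K : pzRingType) (z : K) N : (1 - z) * \sum_(n < N) z ^+ n = 1 - z ^+ N.
Proof. by rewrite -[RHS]opprB subrX1 -mulNr opprB. Qed.

Lemma cvg_geometric_le (q K : R) : 0 <= q -> q < 1 -> 0 <= K ->
  forall e : R, 0 < e -> \forall N \near \oo, q ^+ N * K < e.
Proof.
move=> q0 q1 K0 e e0.
have : (fun N => q ^+ N * K) @ \oo --> (0 * K).
  by apply: cvgM; [apply: cvg_expr; rewrite ger0_norm|exact: cvg_cst].
rewrite mul0r => /cvgrPdist_lt/(_ _ e0); apply: filterS => N.
by rewrite sub0r normrN ger0_norm // mulr_ge0 // exprn_ge0.
Qed.

(** On a circle beyond z0, (g w - g z0) times the sum of the (z0/w)^n for n < N is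
h w (1 - (z0/w)^N), where h is the difference quotient. The integral of h
vanishes and that of h w (z0/w)^N decays geometrically. *)
Theorem cauchy_series g (e0 : R) z0 : holomorphic_on punctured_disk g ->
  0 < e0 -> e0 <= 1 ->
  lebesgue_plane.-integrable (Ae e0) (EFin \o (fun v => normc (g (to_complex v)) ^+ 2)) ->
  punctured_disk z0 -> forall e : R, 0 < e -> \forall N \near \oo,
    normc ((pi *+ 2)%:C * g z0 - \sum_(n < N) z0 ^+ n * laurent_coef g n) < e.
Proof.
move=> hg e00 e01 ig Dz0 e e_gt0.
have [l gl] := derivable_cderiv (hg z0 Dz0).
have [z00 z01] := andP (iffLR (punctured_diskP z0) Dz0).
have outer := diff_quot_outer hg gl Dz0 e00 e01 ig.
have hc := diff_quot_continuous hg gl Dz0.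
set h := diff_quot g z0 l in outer hc.
pose r := (normc z0 + 1) / 2.
have r0 : 0 < r by rewrite /r; lra.
have rz : normc z0 < r by rewrite /r; lra.
have r1 : r < 1 by rewrite /r; lra.
pose zeta t : R[i] := r%:C * cis t.
have nzeta t : normc (zeta t) = r by rewrite normc_mul_cis normc_real gtr0_norm.
have zeta0 t : zeta t != 0 by rewrite -normc_gt0 nzeta.
have Dzeta z : normc z = r -> punctured_disk z.
  by move=> zr; apply/punctured_diskP; rewrite zr r0.
have mi : measurable (`[- pi, pi]%classic : set (measurableTypeR R)).
  exact: measurable_itv.
have ci (F : R[i] -> R[i]) : (forall z, punctured_disk z -> ccontinuous_at F z) ->
    Cintegrable leb `[- pi, pi] (fun t => F (zeta t)).
  move=> cF; apply: circle_Cintegrable => z zr; apply: cF; apply: Dzeta.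
  by rewrite zr normc_real gtr0_norm.
have hinv n : holomorphic_on punctured_disk (fun w : R[i] => w^-1 ^+ n).
  by apply: holomorphic_inv_pow => x [].
have cig n : Cintegrable leb `[- pi, pi] (fun t => g (zeta t) * (zeta t)^-1 ^+ n).
  apply: (ci (fun w => g w * w^-1 ^+ n)) => z.
  exact: (holomorphic_ccontinuous (holomorphicM hg (hinv n))).
have cinv n : Cintegrable leb `[- pi, pi] (fun t => (zeta t)^-1 ^+ n).
  by apply: (ci (fun w => w^-1 ^+ n)) => z; exact: (holomorphic_ccontinuous (hinv n)).
have cih : Cintegrable leb `[- pi, pi] (fun t => h (zeta t)) by exact: ci.
have inh := Cintegrable_normc mi cih.
set K := \int[leb]_(t in `[- pi, pi]) normc (h (zeta t)).
have K0 : 0 <= K by apply: Rintegral_ge0 => t _; exact: normc_ge0.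
pose q := normc z0 / r.
have q0 : 0 <= q by rewrite divr_ge0 ?normc_ge0 // ltW.
have q1 : q < 1 by rewrite /q ltr_pdivrMr // mul1r.
near=> N.
have N0 : (0 < N)%N by near: N; exact: nbhs_infty_gt.
apply: (@le_lt_trans _ _ (q ^+ N * K)); last by near: N; exact: cvg_geometric_le.
pose F n t := z0 ^+ n * (g (zeta t) * (zeta t)^-1 ^+ n - g z0 * (zeta t)^-1 ^+ n).
have iF n : Cintegrable leb `[- pi, pi] (F n).
  apply: CintegrableZ => //; apply: CintegrableB => //; exact: CintegrableZ.
have IF n : Cint leb `[- pi, pi] (F n) =
    z0 ^+ n * laurent_coef g n - (if n is 0%N then (pi *+ 2)%:C * g z0 else 0).
  rewrite CintZ //; last by apply: CintegrableB => //; exact: CintegrableZ.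
  rewrite CintB //; last exact: CintegrableZ.
  have J1 : Cint leb `[- pi, pi] (fun t => g (zeta t) * (zeta t)^-1 ^+ n) = laurent_coef g n.
    apply: (@circle_int_laurent g n r%:C hg).
    by apply: Dzeta; rewrite normc_real gtr0_norm.
  have J2 : Cint leb `[- pi, pi] (fun t => (zeta t)^-1 ^+ n) =
      if n is 0%N then (pi *+ 2)%:C else 0.
    by apply: circle_int_inv_pow; rewrite -normc_gt0 normc_real gtr0_norm.
  rewrite (CintZ mi (g z0) (cinv n)) J1 J2 mulrBr; congr (_ - _).
  case: (n) => [|n']; last by rewrite !mulr0.
  by rewrite expr0 mul1r mulrC.
have -> : (pi *+ 2)%:C * g z0 - \sum_(n < N) z0 ^+ n * laurent_coef g n =
    - Cint leb `[- pi, pi] (fun t => \sum_(n < N) F n t).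
  rewrite Cint_sum //.
  transitivity (- \sum_(n < N) (z0 ^+ n * laurent_coef g n -
      (if nat_of_ord n is 0%N then (pi *+ 2)%:C * g z0 else 0))); last first.
    by congr (- _); apply: eq_bigr => -[n nN] _; rewrite -IF.
  rewrite sumrB opprB; congr (_ - _).
  rewrite (bigD1 (Ordinal N0)) //= big1 ?addr0 // => -[[|n] nN] //.
have sumE t : \sum_(n < N) F n t = h (zeta t) - (z0 / zeta t) ^+ N * h (zeta t).
  have zz : zeta t != z0 by apply: contraTneq rz => e'; rewrite -e' nzeta ltxx.
  have -> : \sum_(n < N) F n t = (g (zeta t) - g z0) * \sum_(n < N) (z0 / zeta t) ^+ n.
    rewrite mulr_sumr; apply: eq_bigr => n _.
    by rewrite /F -mulrBl mulrCA exprMn.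
  have zz' : zeta t - z0 != 0 by rewrite subr_eq0.
  have -> : g (zeta t) - g z0 = h (zeta t) * (1 - z0 / zeta t).
    rewrite /h /diff_quot (negbTE zz) -[X in X - z0 / _](divff (zeta0 t)) -mulrBl.
    by rewrite mulrA divfK // mulrAC divff // mul1r.
  by rewrite -mulrA finite_geometric_sum mulrBr mulr1 [X in _ - X]mulrC.
have Ih : Cint leb `[- pi, pi] (fun t => h (zeta t)) = 0.
  by have := outer r%:C; rewrite normc_real gtr0_norm // rz r1 => /(_ isT).
(* the sum is written as h minus the remainder, which has the small factor *)
have -> : Cint leb `[- pi, pi] (fun t => \sum_(n < N) F n t) =
    Cint leb `[- pi, pi] (fun t => h (zeta t) - (h (zeta t) - \sum_(n < N) F n t)).
  by apply: eq_Cint => t _; rewrite opprB addrC subrK.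
rewrite normcN.
have isum : Cintegrable leb `[- pi, pi] (fun t => \sum_(n < N) F n t).
  exact: Cintegrable_sum.
rewrite CintB //; last exact: CintegrableB.
rewrite Ih sub0r normcN.
apply: le_trans (ler_normc_Cint mi (CintegrableB mi cih isum)) _.
rewrite -RintegralZl //; apply: le_Rintegral => //.
- exact: Cintegrable_normc (CintegrableB mi cih isum).
- exact: integrableRZ.
- move=> t _; rewrite sumE subKr normcM normcX normc_div nzeta //.
Unshelve. all: by end_near. Qed.

End CauchySeries.

(** * The hypergeometric kernel *)

Section Kernel.
Context {R : realType}.
Variables alpha beta : R.
Hypotheses (alpha_gt : -1 < alpha) (beta_gt : -1 < beta).

Local Notation moment n := (Beta (alpha + 1) (beta + n%:R + 1) / Beta (alpha + 1) (beta + 1)).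

Definition kernel_coef (n : nat) : R :=
  pochhammer (alpha + beta + 2) n / pochhammer (beta + 1) n.

Lemma pochhammerS (K : pzRingType) (a : K) n :
  pochhammer a n.+1 = pochhammer a n * (a + n%:R).
Proof. by rewrite /pochhammer big_ord_recr. Qed.

Lemma pochhammer_gt0 (a : R) n : 0 < a -> 0 < pochhammer a n.
Proof. by move=> a0; apply: prodr_gt0 => i _; rewrite ltr_wpDr. Qed.

Lemma pochhammer_complex (a : R) n : pochhammer a%:C n = (pochhammer a n)%:C.
Proof.
elim: n => [|n IH]; first by rewrite /pochhammer !big_ord0.
by rewrite !pochhammerS IH rmorphM rmorphD rmorph_nat.
Qed.

Lemma pochhammer1 (K : comPzRingType) n : pochhammer (1 : K) n = n`!%:R.
Proof.
elim: n => [|n IH]; first by rewrite /pochhammer big_ord0.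
by rewrite pochhammerS IH nat1r -natrM mulnC.
Qed.

Lemma kernel_coef_gt0 n : 0 < kernel_coef n.
Proof. by apply: divr_gt0; apply: pochhammer_gt0; have := alpha_gt; have := beta_gt; lra. Qed.

Lemma kernel_coefS n : kernel_coef n.+1 =
  kernel_coef n * ((alpha + beta + 2 + n%:R) / (beta + 1 + n%:R)).
Proof. by rewrite /kernel_coef !pochhammerS invfM mulrACA. Qed.

(** Both sequences obey the recurrence of the beta function. *)
Lemma kernel_coef_moment n : kernel_coef n * moment n = 1.
Proof.
have B0 : 0 < Beta (alpha + 1) (beta + 1) by exact: Beta_gt0.
elim: n => [|n IH].
  by rewrite /kernel_coef /pochhammer !big_ord0 addr0 divr1 mul1r divff ?gt_eqF.
have n0 : 0 <= n%:R :> R by [].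
have b1 := beta_gt; have a1 := alpha_gt.
have bn : -1 < beta + n%:R by lra.
have d0 : beta + 1 + n%:R != 0 by apply: lt0r_neq0; lra.
have := Beta_recurrence alpha_gt bn; move: IH; rewrite kernel_coefS.
have -> : beta + n.+1%:R + 1 = beta + n%:R + 1 + 1 by rewrite -natr1; ring.
have -> : alpha + (beta + n%:R) + 2 = alpha + beta + 2 + n%:R by ring.
have -> : beta + n%:R + 1 = beta + 1 + n%:R by ring.
have alg (c A D C C' B : R) : D != 0 -> A * C' = D * C ->
    c * (A / D) * (C' / B) = c * (C / B).
  by move=> D0 e; have -> : C = A * C' / D; [rewrite e mulrC mulKf|ring].
by move=> IH rec; rewrite (alg _ _ _ _ _ _ d0 rec).
Qed.

Lemma hyp2F1_termE (xi : R[i]) n :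
  pochhammer 1 n * pochhammer (alpha + beta + 2)%:C n / pochhammer (beta + 1)%:C n
    * (xi ^+ n / n`!%:R) = (kernel_coef n)%:C * xi ^+ n.
Proof.
rewrite pochhammer1 !pochhammer_complex /kernel_coef rmorphM fmorphV.
set a := _%:C; set b := _%:C; set f := n`!%:R.
have f0 : f != 0 by rewrite pnatr_eq0 -lt0n fact_gt0.
by rewrite -[RHS]mulr1 -(mulfV f0); ring.
Qed.

(** The ratio of consecutive coefficients tends to 1, so that the sequence
[kernel_coef n * (q / s) ^+ n] decreases from some index on. *)
Lemma kernel_coef_geometric (q s : R) : 0 <= q -> q < s ->
  exists2 K : R, 0 <= K & forall n, kernel_coef n * q ^+ n <= K * s ^+ n.
Proof.
have b1 := beta_gt; have a1 := alpha_gt.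
move=> q0 qs; have s0 : 0 < s by exact: le_lt_trans qs.
pose u n := kernel_coef n * (q / s) ^+ n.
have u0 n : 0 <= u n by rewrite mulr_ge0 ?(ltW (kernel_coef_gt0 n)) // exprn_ge0 // divr_ge0 // ltW.
(* solving (alpha + beta + 2 + n) q <= s (beta + 1 + n) for n *)
pose x := ((alpha + beta + 2) * q - s * (beta + 1)) / (s - q).
pose N0 := Num.bound `|x|.
have N0P : `|x| < N0%:R by exact: archi_boundP.
have decr n : (N0 <= n)%N -> u n.+1 <= u n.
  move=> Nn; rewrite /u kernel_coefS exprS -mulrA ler_pM2l ?kernel_coef_gt0 //.
  rewrite mulrA -[leRHS]mul1r ler_wpM2r //.
    by rewrite exprn_ge0 // divr_ge0 // ltW.
  have n0 : 0 <= n%:R :> R by [].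
  rewrite mulrAC ler_pdivrMr; last by lra.
  rewrite mul1r mulrA ler_pdivrMr //.
  have : x <= n%:R.
    by rewrite (le_trans (ler_norm x)) // (le_trans (ltW N0P)) // ler_nat.
  by rewrite ler_pdivrMr ?subr_gt0 //; lra.
pose K := \sum_(i < N0.+1) u i.
have K0 : 0 <= K by apply: sumr_ge0.
exists K => // n.
have uK m : u m <= K.
  have small i : (i <= N0)%N -> u i <= K.
    rewrite -ltnS => iN; rewrite /K (bigD1 (Ordinal iN)) //= lerDl.
    exact: sumr_ge0.
  elim: m => [|m IH]; first exact: small.
  by case: (leqP N0 m) => [/decr/le_trans->//|]; exact: small.
have := uK n; rewrite /u expr_div_n mulrA ler_pdivrMr ?exprn_gt0 //.
Qed.

Lemma geometric_sum_le (s : R) N : 0 <= s -> s < 1 -> \sum_(n < N) s ^+ n <= (1 - s)^-1.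
Proof.
move=> s0 s1; rewrite -[leRHS]mulr1 ler_pdivlMl ?subr_gt0 //.
by rewrite finite_geometric_sum gerBl exprn_ge0.
Qed.

Lemma kernel_sum_bounded (q : R) : 0 <= q -> q < 1 ->
  exists2 K : R, 0 <= K & forall N, \sum_(n < N) kernel_coef n * q ^+ n <= K.
Proof.
move=> q0 q1; have qs : q < (q + 1) / 2 by lra.
have [K K0 Kn] := kernel_coef_geometric q0 qs.
set s := (q + 1) / 2 in qs Kn; have s0 : 0 <= s by lra.
have s1 : s < 1 by rewrite /s; lra.
exists (K / (1 - s)); first by rewrite divr_ge0 // subr_ge0 ltW.
move=> N; apply: (@le_trans _ _ (\sum_(n < N) K * s ^+ n)); first exact: ler_sum.
by rewrite -mulr_sumr ler_wpM2l // geometric_sum_le.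
Qed.

Local Notation kernel_series xi :=
  (hyp2F1_series 1 (alpha + beta + 2)%:C (beta + 1)%:C xi).

Lemma kernel_seriesE xi N : kernel_series xi N = \sum_(n < N) (kernel_coef n)%:C * xi ^+ n.
Proof.
rewrite /hyp2F1_series /series /= big_mkord.
by apply: eq_bigr => n _; exact: hyp2F1_termE.
Qed.

Lemma normc_kernel_sum (xi : R[i]) q K : normc xi <= q ->
  (forall N, \sum_(n < N) kernel_coef n * q ^+ n <= K) ->
  forall N, normc (\sum_(n < N) (kernel_coef n)%:C * xi ^+ n) <= K.
Proof.
move=> xq HK N; apply: le_trans (ler_normc_sum _ _) _; apply: le_trans (HK N).
apply: ler_sum => n _; rewrite normcM normc_real gtr0_norm ?kernel_coef_gt0 //.
by rewrite normcX ler_wpM2l ?(ltW (kernel_coef_gt0 n)) // lerXn2r ?nnegrE ?(le_trans (normc_ge0 xi)) ?normc_ge0.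
Qed.

Lemma cvg_kernel_series (xi : R[i]) : normc xi < 1 -> cvgn (kernel_series xi).
Proof.
move=> xi1; have [K K0 HK] := kernel_sum_bounded (normc_ge0 xi) xi1.
pose f n : R[i] := (kernel_coef n)%:C * xi ^+ n.
have part (p : R[i] -> R) : (forall z, `|p z| <= normc z) -> cvgn (series (p \o f)).
  move=> pn; apply: normed_cvg.
  apply: nondecreasing_is_cvgn; first by apply: nondecreasing_series => n _ _ /=.
  exists K => _ [N _ <-]; rewrite /normed_series_of /series /= big_mkord; apply: le_trans (HK N).
  apply: ler_sum => n _; apply: le_trans (pn _) _.
  by rewrite /f normcM normc_real gtr0_norm ?kernel_coef_gt0 // normcX.
have /cvgrPdist_lt cR := part _ (@ler_Re_normc R).
have /cvgrPdist_lt cI := part _ (@ler_Im_normc R).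
set A := limn _ in cR; set B := limn _ in cI.
apply/cvg_ex; exists (A +i* B); apply/cvg_normcP => e e0.
have e2 : 0 < e / 2 by rewrite divr_gt0.
near=> N; apply: le_lt_trans (ler_normc_ReIm _) _.
have := kernel_seriesE xi N; rewrite /hyp2F1_series /series /= => ->.
rewrite !Re_add !Im_add !Re_opp !Im_opp Re_sum Im_sum /= (splitr e).
apply: ltrD.
  have : `|A - series (@complex.Re R \o f) N| < e / 2 by near: N; exact: cR.
  by rewrite /series /= big_mkord.
have : `|B - series (@complex.Im R \o f) N| < e / 2 by near: N; exact: cI.
by rewrite /series /= big_mkord.
Unshelve. all: by end_near. Qed.

Lemma cvg_kernel_normc (xi : R[i]) : normc xi < 1 -> forall e : R, 0 < e ->
  \forall N \near \oo, normc (hyp2F1 1 (alpha + beta + 2)%:C (beta + 1)%:C xi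
    - \sum_(n < N) (kernel_coef n)%:C * xi ^+ n) < e.
Proof.
move=> xi1 e e0; have /cvg_normcP/(_ _ e0) := cvg_kernel_series xi1.
by apply: filterS => N; rewrite -kernel_seriesE.
Qed.

End Kernel.

(** * The reproducing formula *)

Section Continuity.
Context {R : realType}.
Implicit Types (f g : R[i] -> R[i]).

Lemma ccontinuousM f g z : ccontinuous_at f z -> ccontinuous_at g z ->
  ccontinuous_at (fun w => f w * g w) z.
Proof.
move=> cf cg e e0; have f0 := normc_ge0 (f z); have g0 := normc_ge0 (g z).
pose m := 1 + normc (f z) + normc (g z).
have m0 : 0 < m by rewrite /m; lra.
have e'0 : 0 < Num.min 1 (e / m) by rewrite lt_min ltr01 divr_gt0.
have [d1 d10 h1] := cf _ e'0; have [d2 d20 h2] := cg _ e'0.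
exists (Num.min d1 d2) => [|w]; first by rewrite lt_min d10.
rewrite lt_min => /andP[/h1 {}h1 /h2 {}h2].
have -> : f w * g w - f z * g z =
  (f w - f z) * (g w - g z) + (f z * (g w - g z) + g z * (f w - f z)) by ring.
apply: le_lt_trans (ler_normcD _ _) _.
apply: le_lt_trans (lerD (lexx _) (ler_normcD _ _)) _; rewrite !normcM.
set x := normc (f w - f z) in h1 *; set y := normc (g w - g z) in h2 *.
have x0 : 0 <= x by exact: normc_ge0.
have y0 : 0 <= y by exact: normc_ge0.
move: h1 h2; rewrite !lt_min => /andP[x1 xe] /andP[y1 ye].
apply: (@le_lt_trans _ _ (Num.max x y * m)).
  have mx : x <= Num.max x y by rewrite le_max lexx.
  have my : y <= Num.max x y by rewrite le_max lexx orbT.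
  have xy : x * y <= Num.max x y by rewrite (le_trans _ mx) // ler_piMr // ltW.
  have fy : normc (f z) * y <= normc (f z) * Num.max x y by rewrite ler_wpM2l.
  have gx : normc (g z) * x <= normc (g z) * Num.max x y by rewrite ler_wpM2l.
  by rewrite /m; lra.
by rewrite -ltr_pdivlMr // gt_max xe.
Qed.

Lemma ccontinuous_conjX n z : ccontinuous_at (fun w : R[i] => w^* ^+ n) z.
Proof.
elim: n => [|n IH].
  by move=> e e0; exists 1 => // w _; rewrite !expr0 subrr normc0.
have -> : (fun w : R[i] => w^* ^+ n.+1) = (fun w => w^* * w^* ^+ n).
  by apply/funext => w; rewrite exprS.
apply: ccontinuousM => // e e0; exists e => // w.
by rewrite -rmorphB normc_conj.
Qed.

Lemma Cmeasurable_holomorphic f : holomorphic_on punctured_disk f ->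
  Cmeasurable (to_complex @^-1` @punctured_disk R : set (plane R)) (f \o to_complex).
Proof.
move=> hf; apply: Cmeasurable_ccontinuous (@copen_punctured_disk R) _ => z.
exact: (holomorphic_ccontinuous hf).
Qed.

Lemma measurable_sqnormc f : holomorphic_on punctured_disk f ->
  measurable_fun (to_complex @^-1` @punctured_disk R : set (plane R)) (fun v => normc (f (to_complex v)) ^+ 2).
Proof.
by move=> hf; apply: measurable_funX; exact: measurable_normc (Cmeasurable_holomorphic hf).
Qed.

End Continuity.

Section Reproducing.
Context {R : realType}.
Variables alpha beta : R.
Hypotheses (alpha_gt : -1 < alpha) (beta_gt : -1 < beta) (beta_le0 : beta <= 0).
Local Notation mu := (weighted_area alpha beta).
Local Notation Dp := (to_complex @^-1` @punctured_disk R : set (plane R)).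
Local Notation Dd := (to_complex @^-1` @unit_disk R : set (plane R)).
Local Notation Ae e := (to_complex @^-1` small_annulus e : set (plane R)).
Local Notation kernel xi := (hyp2F1 1 (alpha + beta + 2)%:C (beta + 1)%:C xi).
Local Notation moment n := (Beta (alpha + 1) (beta + n%:R + 1) / Beta (alpha + 1) (beta + 1)).

(** As beta <= 0, the power of |w| in the weight is at least 1, and the other factor
stays away from 0 near the origin. *)
Lemma weight_plane_lower : exists2 k : R, 0 < k &
  forall v, Ae 2^-1 v -> k <= weight_plane alpha beta v.
Proof.
have a1 := alpha_gt; have B0 : 0 < Beta (alpha + 1) (beta + 1) by exact: Beta_gt0.
have p0 := pi_gt0 R.
have t0 : 0 < (3 / 4 : R) by lra.
exists ((3 / 4) `^ (alpha + 1) / Beta (alpha + 1) (beta + 1) / pi).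
  by rewrite !divr_gt0 // powR_gt0.
move=> v /andP[v0 v1]; rewrite /weight_plane /weight.
set r := normc (to_complex v) in v0 v1 *.
have v2 : r ^+ 2 <= 4^-1.
  have -> : 4^-1 = 2^-1 ^+ 2 :> R by rewrite exprVn -natrX.
  by rewrite ler_pXn2r ?nnegrE ?(ltW v0) ?(ltW v1) // invr_ge0.
have v3 : 0 < r ^+ 2 by rewrite exprn_gt0.
have v4 : 3 / 4 <= 1 - r ^+ 2 by lra.
have v5 : 1 - r ^+ 2 <= 1 by lra.
rewrite !ler_pM2r ?invr_gt0 //.
apply: (@le_trans _ _ ((1 - r ^+ 2) `^ alpha)).
  apply: (@le_trans _ _ ((1 - r ^+ 2) `^ (alpha + 1))).
    apply: ge0_ler_powR; rewrite ?nnegrE //.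
    - by lra.
    - by lra.
  by apply: ger_powR; [apply/andP; split|]; lra.
have r1 : r `^ 0 <= r `^ (2 * beta).
  by apply: ger_powR; [apply/andP; split=> //; lra|rewrite pmulr_rle0].
by rewrite ler_peMl ?powR_ge0 //; rewrite powRr0 in r1.
Qed.

Lemma bergman_integrable_annulus (g : R[i] -> R[i]) : holomorphic_on punctured_disk g ->
  mu.-integrable Dd (EFin \o (fun v => normc (g (to_complex v)) ^+ 2)) ->
  lebesgue_plane.-integrable (Ae 2^-1) (EFin \o (fun v => normc (g (to_complex v)) ^+ 2)).
Proof.
move=> hg ig; have mDp := @measurable_punctured_disk R.
have mA := @measurable_small_annulus R 2^-1.
have mg2 := measurable_sqnormc hg.
have sub : Ae 2^-1 `<=` Dp.
  by move=> v /andP[v0 v1]; apply/punctured_diskP; rewrite v0 (lt_trans v1) // invf_lt1 // ltr1n.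
have [k k0 kP] := weight_plane_lower.
have [H _] := disk_integrable_densityR alpha beta mg2.
have {}H := integrableS mDp mA sub (H ig).
apply: (@integrable_dominated _ _ _ lebesgue_plane _ mA _
  (fun v => k^-1 * (normc (g (to_complex v)) ^+ 2 * weight_plane alpha beta v))).
- exact: measurable_funS mDp sub mg2.
- move=> v Av; rewrite ger0_norm ?sqr_ge0 // mulrCA ler_peMr ?sqr_ge0 //.
  by rewrite ler_pdivlMl // mulr1 kP.
- exact: integrableRZ.
Qed.

Lemma disk_integrable_cst (k : R) : mu.-integrable Dd (EFin \o (fun=> k)).
Proof.
have [_] := disk_integrable_densityR alpha beta (@measurable_cst _ _ _ _ Dp k).
apply; have [i0 _] := integral_moment alpha_gt beta_gt 0.
have := integrableRZ (@measurable_punctured_disk R) k i0.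
by apply: eq_integrable => [|v _ /=]; [exact: measurable_punctured_disk|rewrite muln0 expr0 mul1r].
Qed.

(** The measure is finite and |g| <= 1 + |g|^2. *)
Lemma bergman_disk_integrable (g : R[i] -> R[i]) : holomorphic_on punctured_disk g ->
  mu.-integrable Dd (EFin \o (fun v => normc (g (to_complex v)) ^+ 2)) ->
  Cintegrable mu Dd (g \o to_complex).
Proof.
move=> hg ig; have mDd : measurable Dd by exact: measurable_unit_disk.
have [m1 m2] := Cmeasurable_holomorphic hg.
apply: (@Cintegrable_dominated _ _ _ mu _ mDd _
   (fun v => 1 + normc (g (to_complex v)) ^+ 2)).
- by split; exact: measurable_fun_disk.
- move=> v _ /=; set x := normc _; have := sqr_ge0 (x - 1); have : 0 <= x by exact: normc_ge0.
  by rewrite !expr2; lra.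
- by apply: integrableRD => //; exact: disk_integrable_cst.
Qed.

(** The conjugate of w is |w|^2 / w, so that on a circle the integrand is |w|^2n
times that of the Laurent coefficient. *)
Lemma disk_integral_monomial (g : R[i] -> R[i]) n : holomorphic_on punctured_disk g ->
  mu.-integrable Dd (EFin \o (fun v => normc (g (to_complex v)) ^+ 2)) ->
  disk_integrable mu (fun w => g w * w^* ^+ n) /\
  (pi *+ 2)%:C * disk_integral mu (fun w => g w * w^* ^+ n) =
    (moment n)%:C * laurent_coef g n.
Proof.
move=> hg ig; have mDd : measurable Dd by exact: measurable_unit_disk.
have cF z : punctured_disk z -> ccontinuous_at (fun w => g w * w^* ^+ n) z.
  move=> Dz; apply: ccontinuousM; last exact: ccontinuous_conjX.
  exact: (holomorphic_ccontinuous hg).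
have iF : disk_integrable mu (fun w => g w * w^* ^+ n).
  have [m1 m2] : Cmeasurable Dp ((fun w => g w * w^* ^+ n) \o to_complex).
    exact: Cmeasurable_ccontinuous (@copen_punctured_disk R) cF.
  apply: (@Cintegrable_dominated _ _ _ mu _ mDd _ (fun v => normc (g (to_complex v)))).
  - by split; exact: measurable_fun_disk.
  - move=> v vD; rewrite normcM normcX normc_conj ler_piMr ?normc_ge0 //.
    by rewrite exprn_ile1 ?normc_ge0 // ltW.
  - exact: Cintegrable_normc (bergman_disk_integrable hg ig).
split=> //; apply: disk_integral_circle => // w Dw.
have cg z : normc z = normc w -> ccontinuous_at (fun w => g w * w^-1 ^+ n) z.
  move=> zw; have hn : holomorphic_on punctured_disk (fun w : R[i] => w^-1 ^+ n).
    by apply: holomorphic_inv_pow => x [].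
  apply: (holomorphic_ccontinuous (holomorphicM hg hn)).
  by apply/punctured_diskP; rewrite zw; apply/punctured_diskP.
rewrite -(circle_int_laurent n hg Dw) /circle_int.
have mi : measurable (`[- pi, pi]%classic : set (measurableTypeR R)).
  exact: measurable_itv.
rewrite -(CintZ mi _ (circle_Cintegrable cg (- pi) pi)).
apply: eq_Cint => t _; rewrite mulrCA; congr (_ * _).
have w0 : w * cis t != 0 by rewrite mulf_neq0 ?cis_neq0 //; case: Dw.
have -> : (normc w ^+ (2 * n))%:C = ((w * cis t) * (w * cis t)^*) ^+ n.
  by rewrite mulc_conj normc_mul_cis exprM rmorphXn.
by rewrite -exprMn mulrAC divff // mul1r.
Qed.

(** Integrated term by term, the kernel series gives the Cauchy series of g,
because its coefficients are the inverses of the moments. *)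
Theorem reproducing_formula (g : R[i] -> R[i]) z : holomorphic_on punctured_disk g ->
  mu.-integrable Dd (EFin \o (fun v => normc (g (to_complex v)) ^+ 2)) ->
  punctured_disk z ->
  disk_integrable mu (fun w => g w * kernel (w^* * z)) /\
  disk_integral mu (fun w => g w * kernel (w^* * z)) = g z.
Proof.
move=> hg ig Dz; have mDd : measurable Dd by exact: measurable_unit_disk.
have [z0 z1] := andP (iffLR (punctured_diskP z) Dz).
have iFn n := (disk_integral_monomial n hg ig).1.
pose S N (w : R[i]) := \sum_(n < N) ((kernel_coef alpha beta n)%:C * z ^+ n) * (g w * w^* ^+ n).
have SE N w : S N w = g w * \sum_(n < N) (kernel_coef alpha beta n)%:C * (w^* * z) ^+ n.
  by rewrite mulr_sumr; apply: eq_bigr => n _; rewrite exprMn; ring.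
have iS N : Cintegrable mu Dd (S N \o to_complex).
  apply: Cintegrable_sum => // n; apply: CintegrableZ => //; exact: iFn.
have IS N : (pi *+ 2)%:C * Cint mu Dd (S N \o to_complex) =
    \sum_(n < N) z ^+ n * laurent_coef g n.
  rewrite Cint_sum //; last by move=> n; apply: CintegrableZ => //; exact: iFn.
  rewrite mulr_sumr; apply: eq_bigr => n _.
  rewrite CintZ //; last exact: iFn.
  have [_ E] := disk_integral_monomial n hg ig.
  rewrite mulrCA -[X in _ * (_ * X)]/(disk_integral mu (fun w => g w * w^* ^+ n)) E.
  have := kernel_coef_moment alpha_gt beta_gt n.
  move=> /(congr1 (@real_complex R)); rewrite rmorphM rmorph1 /= => km.
  by rewrite mulrA [_ * z ^+ n]mulrC -[z ^+ n * _ * _]mulrA km mulr1.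
have zb v : Dd v -> normc ((to_complex v)^* * z) <= normc z.
  by move=> vD; rewrite normcM normc_conj ler_piMl ?normc_ge0 // ltW.
have [K K0 HK] := kernel_sum_bounded alpha_gt beta_gt (normc_ge0 z) z1.
have [||||iR cR] := @Cint_dominated_convergence _ _ _ mu _ mDd (fun N => S N \o to_complex)
   ((fun w => g w * kernel (w^* * z)) \o to_complex) (fun v => K * normc (g (to_complex v))).
- by move=> N; exact: Cintegrable_measurable.
- move=> v vD e e0 /=; have zv := zb v vD.
  have c1 : normc ((to_complex v)^* * z) < 1 by exact: le_lt_trans z1.
  set G := g (to_complex v).
  have e'0 : 0 < e / (1 + normc G) by rewrite divr_gt0 // ltr_pwDl // normc_ge0.
  have := cvg_kernel_normc alpha_gt beta_gt c1 e'0; apply: filterS => N.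
  rewrite SE -/G -mulrBr normcM => h.
  have G0 := normc_ge0 G.
  apply: (@le_lt_trans _ _ (normc G * (e / (1 + normc G)))).
    by rewrite ler_wpM2l // ltW.
  rewrite mulrCA gtr_pMr // ltr_pdivrMr; lra.
- apply: integrableRZ => //; exact: Cintegrable_normc (bergman_disk_integrable hg ig).
- move=> N v vD; rewrite /= SE normcM mulrC ler_wpM2r ?normc_ge0 //.
  have partial := normc_kernel_sum alpha_gt beta_gt (zb v vD).
  exact: partial HK N.
split=> //.
apply/eqP; rewrite eq_sym -subr_eq0 -normc_eq0 eq_le normc_ge0 andbT.
have pi2 : 0 < pi *+ 2 :> R by rewrite mulrn_wgt0 // pi_gt0.
apply/ler_addgt0Pr => e e0; rewrite add0r.
have e2 : 0 < e / 2 by rewrite divr_gt0.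
have e3 : 0 < e / 2 * (pi *+ 2) by rewrite mulr_gt0.
have half0 : 0 < (2^-1 : R) by rewrite invr_gt0.
have half1 : (2^-1 : R) <= 1 by rewrite invf_le1 // ler1n.
have C := cauchy_series hg half0 half1 (bergman_integrable_annulus hg ig) Dz e3.
set I := disk_integral _ _.
near \oo => N.
have c1 : normc (I - Cint mu Dd (S N \o to_complex)) < e / 2 by near: N; exact: cR.
have c2 : normc ((pi *+ 2)%:C * g z - \sum_(n < N) z ^+ n * laurent_coef g n) <
   e / 2 * (pi *+ 2) by near: N.
rewrite -IS -mulrBr normcM normc_real gtr0_norm // mulrC ltr_pM2r // in c2.
have -> : g z - I = (g z - Cint mu Dd (S N \o to_complex)) -
  (I - Cint mu Dd (S N \o to_complex)) by ring.
by apply: le_trans (ler_normcB _ _) _; rewrite (splitr e) lerD // ltW.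
Unshelve. all: by end_near. Qed.

End Reproducing.

(** * The transform as a multiplication operator *)

Section Bergman.
Context {R : realType}.
Variables alpha beta : R.
Local Notation mu := (weighted_area alpha beta).
Local Notation Dp := (to_complex @^-1` @punctured_disk R : set (plane R)).
Local Notation Dd := (to_complex @^-1` @unit_disk R : set (plane R)).
Implicit Types f g : R[i] -> R[i].

Lemma bergman_linear a f g : bergman alpha beta f -> bergman alpha beta g ->
  bergman alpha beta (fun w => a * f w + g w).
Proof.
move=> [hf jf] [hg jg]; have mDd : measurable Dd by exact: measurable_unit_disk.
have h : holomorphic_on punctured_disk (fun w => a * f w + g w).
  exact: (holomorphicD (holomorphicM (@holomorphic_cst R punctured_disk a) hf) hg).
split=> //.
apply: (@integrable_dominated _ _ _ mu _ mDd _ (fun v => 2 *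
  (normc a ^+ 2 * normc (f (to_complex v)) ^+ 2 + normc (g (to_complex v)) ^+ 2))).
- by apply: measurable_fun_disk; exact: (measurable_sqnormc h).
- move=> v _; rewrite ger0_norm ?sqr_ge0 // -exprMn -normcM.
  exact: sqr_normcD_le.
- by apply: integrableRZ => //; apply: integrableRD => //; exact: integrableRZ.
Qed.

Lemma bergman_normE f : bergman alpha beta f -> bergman_norm alpha beta f =
  Num.sqrt (\int[lebesgue_plane]_(v in Dp)
    (normc (f (to_complex v)) ^+ 2 * weight_plane alpha beta v)).
Proof.
move=> [hf jf]; rewrite /bergman_norm; congr Num.sqrt.
rewrite -(disk_Rintegral_density (measurable_sqnormc hf) jf).
by apply: eq_Rintegral => v _; rewrite mulc_conj.
Qed.

End Bergman.

Section Multiplier.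
Context {R : realType}.
Variables alpha beta0 : R.
Hypotheses (alpha_gt : -1 < alpha) (beta_gt : -1 < beta0) (beta_le0 : beta0 <= 0).
Local Notation mu n := (weighted_area alpha (beta0 + n%:R)).
Local Notation wp n := (weight_plane alpha (beta0 + n%:R)).
Local Notation c := (kernel_coef alpha beta0).
Local Notation Dp := (to_complex @^-1` @punctured_disk R : set (plane R)).
Local Notation Dd := (to_complex @^-1` @unit_disk R : set (plane R)).
Local Notation Bn n := (Beta (alpha + 1) (beta0 + n%:R + 1)).
Implicit Types f g : R[i] -> R[i].

Lemma beta_shift_gt n : -1 < beta0 + n%:R.
Proof. by rewrite (lt_le_trans beta_gt) // lerDl. Qed.

(** Both weights are beta densities in 1 - |w|^2 up to constants, whose quotient is
an inverse moment. *)
Lemma weight_plane_shift n v : Dp v ->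
  wp n v = c n * (normc (to_complex v) ^+ (2 * n) * weight_plane alpha beta0 v).
Proof.
move=> Dv.
have B0 : 0 < Beta (alpha + 1) (beta0 + 1) by exact: Beta_gt0.
have B1 : 0 < Bn n by apply: Beta_gt0 => //; exact: beta_shift_gt.
have := kernel_coef_moment alpha_gt beta_gt n.
rewrite weight_moment //.
have := @weight_moment _ alpha (beta0 + n%:R) 0 v Dv.
rewrite muln0 expr0 mul1r addr0 => -> cm.
have -> : c n = Beta (alpha + 1) (beta0 + 1) / Bn n.
  apply: (@mulIf _ (Bn n / Beta (alpha + 1) (beta0 + 1))).
    exact: mulf_neq0 (lt0r_neq0 B1) (invr_neq0 (lt0r_neq0 B0)).
  by rewrite cm mulrA (divfK (lt0r_neq0 B1)) (mulfV (lt0r_neq0 B0)).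
have alg (x b0 bn : R) : b0 != 0 -> x * bn^-1 = b0 / bn * (x * b0^-1).
  by move=> h; rewrite [RHS]mulrC mulrA divfK.
by rewrite [RHS]mulrA !invfM -(alg _ _ _ (lt0r_neq0 B0)).
Qed.

Definition multiplier_cst p q : R := cst_pq alpha beta0 p q * c p.

Lemma cst_pqE p q : cst_pq alpha beta0 p q = Num.sqrt ((c p)^-1 * (c q)^-1).
Proof. by rewrite /cst_pq /kernel_coef -!invfM !invfM !invrK; congr Num.sqrt; ring. Qed.

Lemma cst_pqC p q : cst_pq alpha beta0 p q = cst_pq alpha beta0 q p.
Proof. by rewrite !cst_pqE mulrC. Qed.

Lemma cst_pq_sqr p q : cst_pq alpha beta0 p q ^+ 2 = (c p)^-1 * (c q)^-1.
Proof.
have c0 n : 0 <= (c n)^-1 by rewrite invr_ge0 ltW // kernel_coef_gt0.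
by rewrite cst_pqE sqr_sqrtr // mulr_ge0.
Qed.

Lemma multiplier_cst_sqr p q : multiplier_cst p q ^+ 2 = c p / c q.
Proof.
have c0 : c p != 0 by rewrite gt_eqF // kernel_coef_gt0.
by rewrite exprMn cst_pq_sqr mulrAC expr2 mulKf.
Qed.

Lemma multiplier_cstK p q : multiplier_cst p q * multiplier_cst q p = 1.
Proof.
have c0 n : c n != 0 by rewrite gt_eqF // kernel_coef_gt0.
rewrite /multiplier_cst (cst_pqC q p) mulrACA -expr2 cst_pq_sqr -invfM.
by rewrite mulVf // mulf_neq0.
Qed.

(** What the transform turns out to be on the punctured disk. *)
Definition multiplier p q f (z : R[i]) : R[i] :=
  (multiplier_cst p q)%:C * (z ^+ p * f z * z^-1 ^+ q).

Lemma multiplierK p q f g z : punctured_disk z ->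
  {in punctured_disk, g =1 multiplier p q f} -> multiplier q p g z = f z.
Proof.
move=> Dz gE; rewrite /multiplier gE ?inE // /multiplier.
have z0 : z != 0 by case: Dz.
have zK n : z ^+ n * z^-1 ^+ n = 1 by rewrite -exprMn mulfV // expr1n.
have := multiplier_cstK p q; move/(congr1 (@real_complex R)); rewrite rmorphM rmorph1 /= => kK.
transitivity (((multiplier_cst p q)%:C * (multiplier_cst q p)%:C) *
   (z ^+ p * z^-1 ^+ p) * (z ^+ q * z^-1 ^+ q) * f z); first by ring.
by rewrite kK !zK !mul1r.
Qed.

Lemma multiplier_holomorphic p q f : holomorphic_on punctured_disk f ->
  holomorphic_on punctured_disk (multiplier p q f).
Proof.
move=> hf; have hinv : holomorphic_on punctured_disk (fun z : R[i] => z^-1 ^+ q).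
  by apply: holomorphic_inv_pow => z [].
have hp := holomorphicM (@holomorphicX R punctured_disk p) hf.
exact: (holomorphicM (@holomorphic_cst R punctured_disk (multiplier_cst p q)%:C)
  (holomorphicM hp hinv)).
Qed.

(** The factor |z|^(2p - 2q) converts one weight into the other, up to the quotient
of kernel coefficients that the square of the constant compensates. *)
Lemma multiplier_weight p q f v : Dp v ->
  normc (multiplier p q f (to_complex v)) ^+ 2 * wp q v =
  normc (f (to_complex v)) ^+ 2 * wp p v.
Proof.
move=> Dv; rewrite !weight_plane_shift //.
have r0 : normc (to_complex v) != 0 by rewrite gt_eqF // normc_gt0; case: Dv.
have cq : c q != 0 by rewrite gt_eqF // kernel_coef_gt0.
rewrite /multiplier !normcM normc_real !exprMn real_normK ?num_real //.
rewrite multiplier_cst_sqr !normcX normcV.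
set r := normc (to_complex v) in r0 *; rewrite !exprM.
have rK : r ^+ q ^+ 2 * (r^-1 ^+ q ^+ 2) = 1 by rewrite -exprMn -exprMn mulfV // !expr1n.
rewrite -!exprM [(2 * _)%N]mulnC [(2 * _)%N]mulnC !exprM.
transitivity ((c q / c q) * (r ^+ q ^+ 2 * r^-1 ^+ q ^+ 2) *
  (normc (f (to_complex v)) ^+ 2 * (c p * (r ^+ p ^+ 2 * weight_plane alpha beta0 v)))).
  by ring.
by rewrite rK mulfV // !mul1r.
Qed.

Lemma multiplier_bergman p q f g : bergman alpha (beta0 + p%:R) f ->
  {in punctured_disk, g =1 multiplier p q f} ->
  bergman alpha (beta0 + q%:R) g /\
  bergman_norm alpha (beta0 + q%:R) g = bergman_norm alpha (beta0 + p%:R) f.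
Proof.
move=> bf gE; have [hf jf] := bf.
have gE' z : punctured_disk z -> multiplier p q f z = g z.
  by move=> Dz; rewrite gE ?inE.
have hg : holomorphic_on punctured_disk g.
  exact: (eq_holomorphic (@copen_punctured_disk R) gE'
    (multiplier_holomorphic (p := p) (q := q) hf)).
have wE v : Dp v -> normc (f (to_complex v)) ^+ 2 * wp p v =
    normc (g (to_complex v)) ^+ 2 * wp q v.
  by move=> Dv; rewrite -(gE' _ Dv) (multiplier_weight p q f Dv).
have bg : bergman alpha (beta0 + q%:R) g.
  split=> //.
  have [_ H] := disk_integrable_densityR alpha (beta0 + q%:R) (measurable_sqnormc hg).
  have [H' _] := disk_integrable_densityR alpha (beta0 + p%:R) (measurable_sqnormc hf).
  apply: H; apply: eq_integrable (H' jf); first exact: measurable_punctured_disk.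
  by move=> v; rewrite inE => Dv; rewrite /= wE.
split; first exact: bg.
apply: (etrans (bergman_normE bg)); apply: (etrans _ (esym (bergman_normE bf))).
apply: (congr1 Num.sqrt).
by apply: eq_Rintegral => v; rewrite inE => /wE ->.
Qed.

(** Passing from the weight with exponent beta0 + p to that with exponent beta0
produces |w|^2p, which turns the division by the p-th power of the conjugate of w
into a multiplication by w^p. The reproducing formula then applies to w^p f. *)
Lemma transform_formula p q f z : bergman alpha (beta0 + p%:R) f ->
  punctured_disk z ->
  disk_integrable (mu p) (transform_integrand alpha beta0 p q f z) /\
  transform alpha beta0 p q f z = multiplier p q f z.
Proof.
move=> bf Dz; have [hf jf] := bf; have z0 : z != 0 by case: Dz.
have mDp := @measurable_punctured_disk R.
pose g w := w ^+ p * f w.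
have hg : holomorphic_on punctured_disk g.
  exact: (holomorphicM (@holomorphicX R punctured_disk p) hf).
have c0 n : 0 < c n by exact: kernel_coef_gt0.
have jg : (weighted_area alpha beta0).-integrable Dd
    (EFin \o (fun v => normc (g (to_complex v)) ^+ 2)).
  have [_ H] := disk_integrable_densityR alpha beta0 (measurable_sqnormc hg).
  have [H' _] := disk_integrable_densityR alpha (beta0 + p%:R) (measurable_sqnormc hf).
  apply: H; apply: eq_integrable (integrableRZ mDp (c p)^-1 (H' jf)) => // v.
  rewrite inE => Dv; rewrite /= weight_plane_shift // normcM normcX exprMn -exprM mulnC.
  by congr (_%:E); rewrite [X in _ * X]mulrCA mulKf ?gt_eqF //; ring.
have [iG IG] := reproducing_formula alpha_gt beta_gt beta_le0 hg jg Dz.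
pose G w := g w * hyp2F1 1 (alpha + beta0 + 2)%:C (beta0 + 1)%:C (w^* * z).
have mG : Cmeasurable Dp (G \o to_complex).
  have [m1 m2] := Cintegrable_measurable iG.
  have sub : Dp `<=` Dd by move=> v [].
  have mDd : measurable Dd by exact: measurable_unit_disk.
  by split; [exact: measurable_funS mDd sub m1|exact: measurable_funS mDd sub m2].
have conjE (w : R[i]) : w != 0 -> (w^* ^+ p)^-1 = w ^+ p * ((normc (w^-1 ^+ p)) ^+ 2)%:C.
  move=> w0; rewrite -mulc_conj mulrA -exprMn mulfV // expr1n mul1r.
  by rewrite rmorphXn fmorphV exprVn.
have IE w : punctured_disk w -> transform_integrand alpha beta0 p q f z w =
    z^-1 ^+ q * (G w * ((normc (w^-1 ^+ p)) ^+ 2)%:C).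
  move=> [_ w0]; rewrite /transform_integrand /G /g invfM conjE // (exprVn z q); ring.
have mI : Cmeasurable Dp (transform_integrand alpha beta0 p q f z \o to_complex).
  have hinv : holomorphic_on punctured_disk (fun z : R[i] => z^-1 ^+ p).
    by apply: holomorphic_inv_pow => w [].
  have [m1 m2] : Cmeasurable Dp (fun v => z^-1 ^+ q * (G (to_complex v) *
      ((normc ((to_complex v)^-1 ^+ p)) ^+ 2)%:C)).
    apply: CmeasurableM; first exact: Cmeasurable_cst.
    apply: CmeasurableM => //; apply: Cmeasurable_real.
    exact: measurable_sqnormc hinv.
  split.
    by apply: eq_measurable_fun m1 => v; rewrite inE => /IE; rewrite /comp => ->.
  by apply: eq_measurable_fun m2 => v; rewrite inE => /IE; rewrite /comp => ->.
have wE v : Dp v -> (c p)%:C * z^-1 ^+ q * (G (to_complex v) * (weight_plane alpha beta0 v)%:C)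
   = transform_integrand alpha beta0 p q f z (to_complex v) * (wp p v)%:C.
  move=> Dv; rewrite IE // weight_plane_shift // !rmorphM /=.
  have r0 : normc (to_complex v) != 0 by rewrite gt_eqF // normc_gt0; case: Dv.
  set r := normc (to_complex v) in r0 *.
  have rK : ((normc ((to_complex v)^-1 ^+ p)) ^+ 2)%:C * (r ^+ (2 * p))%:C = 1 :> R[i].
    rewrite -rmorphM normcX normcV -/r [(2 * p)%N]mulnC exprM -exprMn -exprMn.
    by rewrite mulVf // !expr1n rmorph1.
  rewrite -[LHS]mulr1 -rK; ring.
have [iG' _] := disk_integrable_density alpha beta0 mG.
have iGd := iG' iG.
have [_ iI'] := disk_integrable_density alpha (beta0 + p%:R) mI.
have iI : disk_integrable (mu p) (transform_integrand alpha beta0 p q f z).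
  by apply: iI'; apply: (eq_Cintegrable mDp wE (CintegrableZ mDp _ iGd)).
split=> //; rewrite /transform (disk_integral_density mI iI).
rewrite (_ : Cint _ _ _ = (c p)%:C * z^-1 ^+ q * Cint lebesgue_plane Dp
   (fun v => G (to_complex v) * (weight_plane alpha beta0 v)%:C)); last first.
  by rewrite -CintZ //; apply: eq_Cint => v /wE <-.
rewrite -(disk_integral_density mG iG) [disk_integral _ _]IG.
rewrite /multiplier /multiplier_cst /g; move: (cst_pq _ _ _ _) (c p) => A C.
have -> : (A * C)%:C = A%:C * C%:C :> R[i] by exact: rmorphM.
ring.
Qed.

End Multiplier.

Theorem theorem3 (R : realType) (alpha beta0 : R) (p q : nat)
    (halpha : -1 < alpha) (hbeta0 : -1 < beta0) (hbeta0' : beta0 <= 0) :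
  let betap := beta0 + p%:R in
  let betaq := beta0 + q%:R in
  let D := transform alpha beta0 p q in
  let D' := transform alpha beta0 q p in
  (* the series and the integral defining D f z converge *)
  (forall z w : R[i], punctured_disk z -> unit_disk w ->
     cvgn (hyp2F1_series 1 (alpha + beta0 + 2)%:C (beta0 + 1)%:C (w^* * z))) /\
  (forall f z, bergman alpha betap f -> punctured_disk z ->
     disk_integrable (weighted_area alpha betap)
       (transform_integrand alpha beta0 p q f z)) /\
  (* D is a bounded operator, isometric and onto *)
  bounded_operator alpha betap alpha betaq D /\
  (forall f, bergman alpha betap f ->
     bergman_norm alpha betaq (D f) = bergman_norm alpha betap f) /\
  (forall g, bergman alpha betaq g ->
     exists2 f, bergman alpha betap f & {in punctured_disk, D f =1 g}) /\
  (* D' is its inverse, and is given by the stated integral *)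
  (forall g, bergman alpha betaq g -> bergman alpha betap (D' g)) /\
  (forall f, bergman alpha betap f -> {in punctured_disk, D' (D f) =1 f}) /\
  (forall g, bergman alpha betaq g -> {in punctured_disk, D (D' g) =1 g}) /\
  (forall g w, bergman alpha betaq g -> punctured_disk w ->
     let integrand z :=
       g z / (z^* ^+ q * w ^+ p)
       * hyp2F1 1 (alpha + beta0 + 2)%:C (beta0 + 1)%:C (z^* * w) in
     disk_integrable (weighted_area alpha betaq) integrand /\
     D' g w = (cst_pq alpha beta0 p q)%:C
              * disk_integral (weighted_area alpha betaq) integrand).
Proof.
move=> betap betaq D D'.
have formula m n f z := @transform_formula R alpha beta0 halpha hbeta0 hbeta0' m n f z.
have formulaE m n f : bergman alpha (beta0 + m%:R) f ->
    {in punctured_disk, transform alpha beta0 m n f =1 multiplier alpha beta0 m n f}.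
  by move=> bf z; rewrite inE => Dz; exact: (formula m n f z bf Dz).2.
have closed m n f (bf : bergman alpha (beta0 + m%:R) f) :=
  multiplier_bergman halpha hbeta0 bf (formulaE m n f bf).
have inverse m n f : bergman alpha (beta0 + m%:R) f ->
    {in punctured_disk, transform alpha beta0 n m (transform alpha beta0 m n f) =1 f}.
  move=> bf z zD; have Dz : punctured_disk z by rewrite inE in zD.
  rewrite (formulaE n m _ (closed m n f bf).1 z zD).
  exact: (multiplierK halpha hbeta0 Dz (formulaE m n f bf)).
split; [|split; [|split; [|split; [|split; [|split; [|split; [|split]]]]]]].
- move=> z w [z1 _] w1; apply: cvg_kernel_series => //.
  rewrite normcM normc_conj; apply: le_lt_trans z1.
  by rewrite ler_piMl ?normc_ge0 // ltW.
- by move=> f z bf Dz; exact: (formula p q f z bf Dz).1.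
- split.
  + by move=> f bf; exact: (closed p q f bf).1.
  + move=> f g bf bg fg z zD.
    by rewrite /D (formulaE p q f bf z zD) (formulaE p q g bg z zD) /multiplier fg.
  + move=> a f g bf bg z zD.
    rewrite /D (formulaE p q _ (bergman_linear a bf bg) z zD).
    rewrite (formulaE p q f bf z zD) (formulaE p q g bg z zD) /multiplier; ring.
  + by exists 1 => f bf; rewrite mul1r (closed p q f bf).2.
- by move=> f bf; exact: (closed p q f bf).2.
- by move=> g bg; exists (D' g); [exact: (closed q p g bg).1|exact: inverse].
- by move=> g bg; exact: (closed q p g bg).1.
- by move=> f bf; exact: inverse.
- by move=> g bg; exact: inverse.
- move=> g w bg Dw integrand; split; first exact: (formula q p g w bg Dw).1.
  by rewrite /D' /transform cst_pqC.
Qed.
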